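(* For integers $n\ge j\ge1$ and $m\ge1$, the number $X_{n,j}$ of descendants of node $j$ in a random ordered increasing $k$-tree of size $n$ satisfies \[ \mathbb{P}\{X_{n,j}=m\}=\frac{\binom{m-1-\frac{1}{k+1}}{m-1}\binom{n-m-1+\frac{2}{k+1}}{n-m-j+1}}{\binom{n-\frac{k}{k+1}}{n-j}}. \] Moreover, as $n\to\infty$: (i) For fixed $j\ge1$: $X_{n,j}/n$ converges in distribution to a Beta$(\frac{k}{k+1},\,j-1+\frac{2}{k+1})$ random variable $X_j$, whose moments are $\mathbb{E}(X_j^s)=\binom{s-\frac1{k+1}}{s}\big/\binom{s+j-\frac{k}{k+1}}{s}$, $s\ge0$. (ii) If $j=j(n)\to\infty$ with $j=o(n)$: $\frac jn X_{n,j}$ converges in distribution to a Gamma$(\frac{k}{k+1},1)$ random variable $X$, with $\mathbb{E}(X^s)=s!\binom{s-\frac1{k+1}}{s}$, $s\ge0$. (iii) If $j=j(n)\to\infty$ with $j\sim\rho n$ for fixed $0<\rho<1$: $X_{n,j}-1$ converges in distribution to a random variable $X_\rho$ with $\mathbb{P}\{X_\rho=m\}=\binom{m-\frac1{k+1}}{m}\rho^{\frac{k}{k+1}}(1-\rho)^m$, $m\ge0$ (negative binomial law). (iv) If $j=j(n)\to\infty$ with $n-j=o(n)$: $\mathbb{P}\{X_{n,j}=1\}\to1$.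
   Context: Fix an integer $k\ge1$. An ordered increasing $k$-tree of size $n\ge0$ is built as follows. Start with the root-clique $K_0$: $k$ pairwise adjacent vertices labelled $0_1,\dots,0_k$ (the root nodes; each label $0_\ell$ has value $0$). For $j=1,\dots,n$ in turn, node $j$ is inserted by choosing a currently existing $k$-clique $K$ and attaching $j$ to it, i.e. adding edges from $j$ to all $k$ vertices of $K$; $j$ is then a child of $K$ and the vertices of $K$ are the parents of $j$. The $k$-cliques available for attachment are the root-clique and, for every previously inserted node $x$ attached to a clique $K'$, the $k$ cliques $\{x\}\cup(K'\setminus\{w\})$, $w\in K'$. The children of each $k$-clique are linearly ordered: if $K$ currently has $d^+(K)$ children, there are $d^+(K)+1$ positions at which the new child may be placed, and the choice of position is part of the structure. Thus there are $1+(k+1)(j-1)$ ways to insert node $j$, and distinct sequences of choices give distinct trees. A random ordered increasing $k$-tree of size $n$ is one chosen uniformly among all of them; equivalently, it is produced by the process in which node $n$ is attached to the clique $K$ with probability $\frac{d^+(K)+1}{1+(k+1)(n-1)}$ (and a uniformly random position among the $d^+(K)+1$). A node $w$ is a descendant of $u$ if $w=u$ or some parent of $w$ is a descendant of $u$ (so $u$ counts as its own descendant). For real $x$ and integer $m\ge0$, $\binom{x}{m}=x(x-1)\cdots(x-m+1)/m!$, and $\binom{x}{m}=0$ for $m<0$. *)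

(* Defs.v *)
From Stdlib Require Import Reals Lra Lia ZArith Arith List.
Import ListNotations.
Open Scope R_scope.

Inductive vtx : Type := Root (l : nat) | Node (x : nat).

Definition root_clique (k : nat) : list vtx := map Root (seq 1 k).

Fixpoint remove_at (w : nat) (l : list vtx) : list vtx :=
  match l, w with
  | [], _ => []
  | _ :: l', O => l'
  | a :: l', S w' => a :: remove_at w' l'
  end.

(* A tree of size n is encoded by the sequence of its insertion choices:
   the i-th entry (c, p) (i = 0..n-1) says that node i+1 is attached to the
   clique with index c (in the list of currently available cliques) at
   position p among the children of that clique. *)

Fixpoint cliques_aux (k : nat) (cs : list (list vtx)) (x : nat)
         (t : list (nat * nat)) : list (list vtx) :=
  match t with
  | [] => cs
  | (c, _) :: t' =>
      let K := nth c cs [] in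
      cliques_aux k (cs ++ map (fun w => Node x :: remove_at w K) (seq 0 k))
                  (S x) t'
  end.

Definition cliques (k : nat) (t : list (nat * nat)) : list (list vtx) :=
  cliques_aux k [root_clique k] 1%nat t.

Definition nchildren (t : list (nat * nat)) (c : nat) : nat :=
  length (filter (fun q => Nat.eqb (fst q) c) t).

(* all ways to insert the next node: 1 + k * |t| cliques, and
   (d+(K) + 1) positions for clique K *)
Definition choices (k : nat) (t : list (nat * nat)) : list (nat * nat) :=
  flat_map (fun c => map (fun p => (c, p)) (seq 0 (S (nchildren t c))))
           (seq 0 (S (k * length t))).

(* all ordered increasing k-trees of size n (each exactly once) *)
Fixpoint trees (k n : nat) : list (list (nat * nat)) :=
  match n with
  | O => [[]]
  | S n' => flat_map (fun t => map (fun q => t ++ [q]) (choices k t)) (trees k n')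
  end.

Definition parents (k : nat) (t : list (nat * nat)) (x : nat) : list vtx :=
  nth (fst (nth (x - 1) t (0%nat, 0%nat))) (cliques k t) [].

(* v is a descendant of node u (fuel-bounded recursion; parents of node w
   are root nodes or nodes < w) *)
Fixpoint desc_f (k : nat) (t : list (nat * nat)) (u : nat) (fuel : nat)
         (v : vtx) : bool :=
  match fuel with
  | O => false
  | S f =>
      match v with
      | Root _ => false
      | Node w => Nat.eqb w u || existsb (desc_f k t u f) (parents k t w)
      end
  end.

Definition is_desc (k : nat) (t : list (nat * nat)) (u w : nat) : bool :=
  desc_f k t u (S w) (Node w).

(* X_{n,j}: number of descendants of node j (j itself included) *)
Definition ndesc (k : nat) (t : list (nat * nat)) (j : nat) : nat :=
  length (filter (fun w => is_desc k t j w) (seq 1 (length t))).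

Definition prob (k n : nat) (E : list (nat * nat) -> bool) : R :=
  INR (length (filter E (trees k n))) / INR (length (trees k n)).

Definition Rle_bool (a b : R) : bool := if Rle_dec a b then true else false.

Fixpoint falling (x : R) (m : nat) : R :=
  match m with
  | O => 1
  | S m' => falling x m' * (x - INR m')
  end.

Definition gbinom (x : R) (m : nat) : R := falling x m / INR (fact m).

Definition gbinomZ (x : R) (m : Z) : R :=
  if Z.ltb m 0 then 0 else gbinom x (Z.to_nat m).

(* v = ∫_a^b h (improper Riemann integral of h, continuous on (a,b)):
   there is an antiderivative G of h on (a,b), continuous on [a,b]. *)
Definition improper_int (a b : R) (h : R -> R) (v : R) : Prop :=
  exists G : R -> R,
    (forall x, a <= x <= b -> limit1_in G (fun y => a <= y <= b) (G x) x) /\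
    (forall x, a < x < b -> derivable_pt_lim G x (h x)) /\
    G b - G a = v.

Definition improper_int_inf (a : R) (h : R -> R) (v : R) : Prop :=
  exists G : R -> R,
    (forall x, a <= x -> limit1_in G (fun y => a <= y) (G x) x) /\
    (forall x, a < x -> derivable_pt_lim G x (h x)) /\
    (forall eps, 0 < eps -> exists M, forall x, M < x -> Rabs (G x - G a - v) < eps).

Definition beta_density (a b : R) (f : R -> R) : Prop :=
  (exists c, 0 < c /\ forall x, 0 < x < 1 ->
      f x = c * Rpower x (a - 1) * Rpower (1 - x) (b - 1)) /\
  improper_int 0 1 f 1.

Definition cdf01 (f : R -> R) (x v : R) : Prop :=
  (x <= 0 /\ v = 0) \/ (0 < x < 1 /\ improper_int 0 x f v) \/ (1 <= x /\ v = 1).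

Definition gamma_density (a : R) (f : R -> R) : Prop :=
  (exists c, 0 < c /\ forall x, 0 < x -> f x = c * Rpower x (a - 1) * exp (- x)) /\
  improper_int_inf 0 f 1.

Definition cdf0inf (f : R -> R) (x v : R) : Prop :=
  (x <= 0 /\ v = 0) \/ (0 < x /\ improper_int 0 x f v).

Definition tends_to_inf (u : nat -> nat) : Prop :=
  forall M : nat, exists N : nat, forall n : nat, (N <= n)%nat -> (M <= u n)%nat.

(* Main.v *)
From Coquelicot Require Import Coquelicot.
Require Import Defs.
From Stdlib Require Import Reals ZArith Arith List Lia Lra Bool.
Import ListNotations.
Open Scope R_scope.

(** The descendants of node j grow as a Polya urn: a new node is a descendant
    of j exactly when its parent clique meets the descendants of j, and m
    descendants give these cliques total attachment weight (k+1) m - 1 out of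
    1 + (k+1) n.  Hence X - 1 is beta-binomial with N = n - j draws and
    parameters a = k/(k+1), b = j - 1 + 2/(k+1).

    Writing (a)_n / n! as [rbin a n], Bernoulli's inequality
    x^p <= 1 + p (x - 1) gives Gautschi-type bounds, which show that
    rbin a n ~ g n^(a-1) for some constant g > 0.  This yields a local limit
    theorem with an unknown constant; summing it against an antiderivative of
    the density gives the limit of the distribution function up to that
    constant, and the tail bounds force the constant to be the normalizing one,
    so that the Gamma function is never needed.  The negative binomial and
    degenerate regimes follow directly from the same bounds.  Moments come from
    integration by parts. *)

(** * Trees and the urn recurrence *)

Local Open Scope nat_scope.

(** The insertions form an urn with integer weights: when n = j the cliques meeting the descendants
    of j carry weight k out of 1 + (k+1) j, and every insertion adds k + 1 to the side that receives
    it. Dividing by k + 1 gives unit increments, a = k/(k+1) and b = ((k+1)(j-1) + 2)/(k+1) = j - 1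
    + 2/(k+1). The obstacle in the limits is that a Beta or Gamma density is known only as c times
    an explicit expression with some antiderivative G, continuous up to endpoints where the density
    may be unbounded. Point masses are therefore matched with increments of G away from 0, and the
    mass near 0 is bounded separately. When j grows, b is no longer fixed, and asymptotics of (b)_n
    / n! for fixed b do not apply. The bounds for quotients of such terms are uniform in b instead,
    which is possible because a <= 1 keeps the exponents within the range of Bernoulli's
    inequality. *)

Definition valid_tree (k : nat) (t : list (nat * nat)) : Prop :=
  forall i, i < length t -> fst (nth i t (0, 0)) <= k * i.

Lemma valid_tree_snoc k t q :
  valid_tree k (t ++ [q]) <-> valid_tree k t /\ fst q <= k * length t.
Proof.
  unfold valid_tree; rewrite length_app; simpl; split.
  - intros H; split.
    + intros i Hi. specialize (H i ltac:(lia)).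
      now rewrite app_nth1 in H by lia.
    + specialize (H (length t) ltac:(lia)).
      now rewrite nth_middle in H.
  - intros [H1 H2] i Hi.
    destruct (Nat.eq_dec i (length t)) as [->|Hne].
    + now rewrite nth_middle.
    + rewrite app_nth1 by lia. apply H1; lia.
Qed.

Lemma choices_fst_le k t q : In q (choices k t) -> fst q <= k * length t.
Proof.
  unfold choices; rewrite in_flat_map; intros [c [Hc Hq]].
  apply in_seq in Hc. apply in_map_iff in Hq.
  destruct Hq as [p [<- _]]. simpl; lia.
Qed.

Lemma trees_valid k n t : In t (trees k n) -> valid_tree k t /\ length t = n.
Proof.
  revert t; induction n as [|n IH]; intros t Ht.
  - destruct Ht as [<-|[]]. split; [intros i Hi; simpl in Hi; lia|reflexivity].
  - cbn [trees] in Ht. apply in_flat_map in Ht. destruct Ht as [s [Hs Ht]].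
    apply in_map_iff in Ht. destruct Ht as [q [<- Hq]].
    destruct (IH s Hs) as [Hv Hl]. apply choices_fst_le in Hq.
    rewrite valid_tree_snoc, length_app; simpl.
    repeat split; auto; lia.
Qed.

Lemma cliques_aux_snoc k cs x t q :
  cliques_aux k cs x (t ++ [q]) =
  cliques_aux k cs x t ++
    map (fun w => Node (x + length t)
                  :: remove_at w (nth (fst q) (cliques_aux k cs x t) []))
        (seq 0 k).
Proof.
  revert cs x; induction t as [|[c p] t IH]; intros cs x; simpl.
  - destruct q as [c p]; simpl. now rewrite Nat.add_0_r.
  - rewrite IH. now rewrite Nat.add_succ_r.
Qed.

Lemma cliques_snoc k t q :
  cliques k (t ++ [q]) =
  cliques k t ++
    map (fun w => Node (S (length t)) :: remove_at w (nth (fst q) (cliques k t) []))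
        (seq 0 k).
Proof. unfold cliques; now rewrite cliques_aux_snoc. Qed.

Lemma cliques_length k t : length (cliques k t) = S (k * length t).
Proof.
  induction t as [|q t IH] using rev_ind; [simpl; lia|].
  rewrite cliques_snoc, !length_app, length_map, length_seq, IH. simpl. lia.
Qed.

Lemma nth_cliques_snoc_old k t q c :
  c <= k * length t -> nth c (cliques k (t ++ [q])) [] = nth c (cliques k t) [].
Proof.
  intros H. rewrite cliques_snoc, app_nth1; auto. rewrite cliques_length; lia.
Qed.

Lemma nth_cliques_snoc_new k t q i :
  i < k ->
  nth (S (k * length t) + i) (cliques k (t ++ [q])) [] =
  Node (S (length t)) :: remove_at i (nth (fst q) (cliques k t) []).
Proof.
  intros H. rewrite cliques_snoc, app_nth2; rewrite cliques_length; [|lia].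
  replace (S (k * length t) + i - S (k * length t)) with i by lia.
  set (f := fun w => _).
  rewrite (nth_indep _ _ (f 0)) by (rewrite length_map, length_seq; lia).
  rewrite map_nth, seq_nth by lia. reflexivity.
Qed.

Lemma in_remove_at w l v : In v (remove_at w l) -> In v l.
Proof.
  revert w; induction l as [|a l IH]; intros [|w]; simpl; auto.
  intros [H|H]; eauto.
Qed.

(** Cliques are listed in order of creation, so the index bound k m says that the clique exists once
    m nodes are present. Keeping m apart from the length of the tree makes the bound applicable to
    the parents of any earlier node, whence labels decrease along parents. *)
Lemma clique_node_le k t : valid_tree k t -> forall m c w,
  m <= length t -> c <= k * m -> In (Node w) (nth c (cliques k t) []) -> 1 <= w <= m.
Proof.
  induction t as [|q t IH] using rev_ind; intros Hv m c w Hm Hc Hin.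
  - simpl in Hm. replace m with 0 in * by lia.
    replace c with 0 in Hin by lia. simpl in Hin.
    unfold root_clique in Hin. apply in_map_iff in Hin.
    destruct Hin as [? [? _]]; discriminate.
  - apply valid_tree_snoc in Hv. destruct Hv as [Hv Hq].
    rewrite length_app in Hm; simpl in Hm.
    destruct (le_lt_dec c (k * length t)) as [Hold|Hnew].
    + rewrite nth_cliques_snoc_old in Hin by auto.
      destruct (le_lt_dec m (length t)) as [Hml|Hml].
      * eapply IH; eauto.
      * assert (1 <= w <= length t) by (eapply IH; eauto). lia.
    + assert (m = S (length t)) as -> by nia.
      replace c
        with (S (k * length t) + (c - S (k * length t))) in Hin by lia.
      rewrite nth_cliques_snoc_new in Hin by nia.
      destruct Hin as [Hin|Hin]; [injection Hin; lia|].
      apply in_remove_at in Hin.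
      assert (1 <= w <= length t) by (eapply IH; eauto). lia.
Qed.

Lemma existsb_ext_in {A : Type} (f g : A -> bool) l :
  (forall a, In a l -> f a = g a) -> existsb f l = existsb g l.
Proof.
  induction l as [|a l IH]; simpl; intros H; auto.
  rewrite H, IH; auto.
Qed.

Lemma parent_lt k t w w' :
  valid_tree k t -> 1 <= w <= length t -> In (Node w') (parents k t w) -> 1 <= w' <= w - 1.
Proof.
  intros Hv Hw Hin. unfold parents in Hin.
  eapply clique_node_le; [exact Hv| | |exact Hin]; [lia|].
  apply Hv; lia.
Qed.

Lemma desc_f_root k t u f l : desc_f k t u f (Root l) = false.
Proof. now destruct f. Qed.

(** Labels decrease along parents, so any fuel above w suffices. [is_desc] gives each node its own
    fuel, while the recursion hands the parents of w what is left of the fuel of w; this reconciles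
    the two. *)
Lemma desc_f_fuel k t u : valid_tree k t -> forall w f g,
  1 <= w <= length t -> w < f -> w < g ->
  desc_f k t u f (Node w) = desc_f k t u g (Node w).
Proof.
  intros Hv w. induction w as [w IH] using lt_wf_ind.
  intros [|f] [|g] Hw Hf Hg; try lia. simpl. f_equal.
  apply existsb_ext_in. intros [l|w'] Hin.
  - now rewrite !desc_f_root.
  - apply parent_lt in Hin; auto. apply IH; lia.
Qed.

Lemma parents_snoc_old k t q w :
  valid_tree k t -> 1 <= w <= length t -> parents k (t ++ [q]) w = parents k t w.
Proof.
  intros Hv Hw. unfold parents. rewrite (app_nth1 t) by lia.
  apply nth_cliques_snoc_old.
  specialize (Hv (w - 1) ltac:(lia)). nia.
Qed.

Lemma desc_f_snoc k t q u : valid_tree k t -> forall f w, 1 <= w <= length t ->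
  desc_f k (t ++ [q]) u f (Node w) = desc_f k t u f (Node w).
Proof.
  intros Hv f. induction f as [|f IH]; intros w Hw; auto.
  simpl. f_equal. rewrite parents_snoc_old by auto.
  apply existsb_ext_in. intros [l|w'] Hin.
  - now rewrite !desc_f_root.
  - apply parent_lt in Hin; auto. apply IH; lia.
Qed.

Lemma is_desc_snoc_old k t q u w :
  valid_tree k t -> 1 <= w <= length t -> is_desc k (t ++ [q]) u w = is_desc k t u w.
Proof. intros; unfold is_desc; now apply desc_f_snoc. Qed.

Lemma is_desc_lt k t u w :
  valid_tree k t -> 1 <= w <= length t -> length t < u -> is_desc k t u w = false.
Proof.
  intros Hv Hw Hu. unfold is_desc. generalize (S w) as f. intros f.
  revert w Hw; induction f as [|f IH]; intros w Hw; auto.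
  simpl. destruct (Nat.eqb_spec w u); [lia|]. simpl.
  apply not_true_is_false. rewrite existsb_exists.
  intros [[l|w'] [Hin Hd]].
  - now rewrite desc_f_root in Hd.
  - apply parent_lt in Hin; auto. rewrite IH in Hd by lia. discriminate.
Qed.

Definition hits (k : nat) (t : list (nat * nat)) (u c : nat) : bool :=
  existsb (fun v => match v with Root _ => false | Node w => is_desc k t u w end)
          (nth c (cliques k t) []).

Lemma is_desc_snoc_new k t q u :
  valid_tree k t -> fst q <= k * length t ->
  is_desc k (t ++ [q]) u (S (length t)) = Nat.eqb (S (length t)) u || hits k t u (fst q).
Proof.
  intros Hv Hq. unfold is_desc, hits.
  change (desc_f k (t ++ [q]) u (S (S (length t))) (Node (S (length t))))
    with (Nat.eqb (S (length t)) u
          || existsb (desc_f k (t ++ [q]) u (S (length t))) (parents k (t ++ [q]) (S (length t)))).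
  f_equal. unfold parents. simpl (S (length t) - 1). rewrite Nat.sub_0_r, nth_middle.
  rewrite nth_cliques_snoc_old by auto.
  apply existsb_ext_in. intros [l|w] Hin.
  - apply desc_f_root.
  - assert (1 <= w <= length t) by (eapply clique_node_le; eauto).
    unfold is_desc. rewrite desc_f_snoc by auto. apply desc_f_fuel; auto; lia.
Qed.

Lemma hits_snoc_old k t q u c :
  valid_tree k t -> c <= k * length t -> hits k (t ++ [q]) u c = hits k t u c.
Proof.
  intros Hv Hc. unfold hits. rewrite nth_cliques_snoc_old by auto.
  apply existsb_ext_in. intros [l|w] Hin; auto.
  apply is_desc_snoc_old; auto. eapply clique_node_le; eauto.
Qed.

(** All k new cliques contain the new node and otherwise only vertices of its parent clique. If the
    new node is a descendant they are all hit; if not, the parent clique was not hit and neither are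
    they. Hence they share one status. *)
Lemma hits_snoc_new k t q u i :
  valid_tree k t -> fst q <= k * length t -> i < k ->
  hits k (t ++ [q]) u (S (k * length t) + i) =
  Nat.eqb (S (length t)) u || hits k t u (fst q).
Proof.
  intros Hv Hq Hi. unfold hits at 1. rewrite nth_cliques_snoc_new by auto.
  simpl existsb at 1. rewrite <- (is_desc_snoc_new k t q u) by auto.
  destruct (is_desc k (t ++ [q]) u (S (length t))) eqn:E; auto. simpl.
  rewrite is_desc_snoc_new in E by auto. apply orb_false_elim in E. destruct E as [_ E].
  apply not_true_is_false. rewrite existsb_exists. intros [[l|w] [Hin Hd]]; [discriminate|].
  apply in_remove_at in Hin.
  assert (Hw : 1 <= w <= length t) by (eapply clique_node_le; eauto).
  rewrite is_desc_snoc_old in Hd by auto.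
  apply not_true_iff_false in E. apply E. unfold hits. rewrite existsb_exists.
  exists (Node w); auto.
Qed.

Lemma hits_lt k t u c :
  valid_tree k t -> length t < u -> c <= k * length t -> hits k t u c = false.
Proof.
  intros Hv Hu Hc. apply not_true_is_false. unfold hits. rewrite existsb_exists.
  intros [[l|w] [Hin Hd]]; [discriminate|].
  assert (Hw : 1 <= w <= length t) by (eapply clique_node_le; eauto).
  rewrite is_desc_lt in Hd by auto. discriminate.
Qed.

Lemma filter_ext_in_length {A : Type} (f g : A -> bool) l :
  (forall a, In a l -> f a = g a) -> length (filter f l) = length (filter g l).
Proof. intros H. now rewrite (filter_ext_in f g l H). Qed.

Lemma ndesc_snoc k t q u :
  valid_tree k t -> fst q <= k * length t ->
  ndesc k (t ++ [q]) u =
  ndesc k t u + (if Nat.eqb (S (length t)) u || hits k t u (fst q) then 1 else 0).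
Proof.
  intros Hv Hq. unfold ndesc. rewrite length_app; simpl length.
  rewrite seq_app, filter_app, length_app. f_equal.
  - apply filter_ext_in_length. intros w Hw. apply in_seq in Hw.
    apply is_desc_snoc_old; auto; lia.
  - simpl. rewrite is_desc_snoc_new by auto.
    now destruct (_ || _).
Qed.

(* The attachment weight d+(K) + 1, summed over the cliques selected by P. *)
Definition weight (k : nat) (t : list (nat * nat)) (P : nat -> bool) : nat :=
  length (filter (fun q => P (fst q)) (choices k t)).

Lemma length_filter_flat_map {A B : Type} (P : B -> bool) (f : A -> list B) l :
  length (filter P (flat_map f l)) = list_sum (map (fun a => length (filter P (f a))) l).
Proof.
  induction l as [|a l IH]; simpl; auto.
  now rewrite filter_app, length_app, IH.
Qed.

Lemma length_filter_map {A B : Type} (P : B -> bool) (f : A -> B) l :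
  length (filter P (map f l)) = length (filter (fun a => P (f a)) l).
Proof.
  induction l as [|a l IH]; simpl; auto.
  destruct (P (f a)); simpl; now rewrite IH.
Qed.

Lemma weight_sum k t P :
  weight k t P =
  list_sum (map (fun c => if P c then S (nchildren t c) else 0) (seq 0 (S (k * length t)))).
Proof.
  unfold weight, choices. rewrite length_filter_flat_map. f_equal.
  apply map_ext. intros c. rewrite length_filter_map. simpl fst.
  destruct (P c).
  - rewrite <- (length_seq (S (nchildren t c)) 0) at 2. f_equal.
    apply forallb_filter_id, forallb_forall; auto.
  - induction (seq 0 _); simpl; auto.
Qed.

Lemma nchildren_snoc t q c :
  nchildren (t ++ [q]) c = nchildren t c + (if Nat.eqb (fst q) c then 1 else 0).
Proof.
  unfold nchildren. rewrite filter_app, length_app. simpl.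
  now destruct (Nat.eqb (fst q) c).
Qed.

Lemma nchildren_new k t c : valid_tree k t -> k * length t < c -> nchildren t c = 0.
Proof.
  intros Hv Hc. unfold nchildren. apply length_zero_iff_nil.
  destruct (filter _ t) as [|e l] eqn:E; auto. exfalso.
  assert (He : In e (filter (fun q => Nat.eqb (fst q) c) t)) by (rewrite E; left; auto).
  apply filter_In in He. destruct He as [He Hf]. apply Nat.eqb_eq in Hf.
  apply (In_nth _ _ (0, 0)) in He. destruct He as [i [Hi He]].
  specialize (Hv i Hi). rewrite He in Hv. nia.
Qed.

Lemma list_sum_add_indicator f c0 a n (v : nat) :
  a <= c0 < a + n ->
  list_sum (map (fun c => f c + (if Nat.eqb c0 c then v else 0)) (seq a n)) =
  list_sum (map f (seq a n)) + v.
Proof.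
  revert a; induction n as [|n IH]; intros a H; [lia|]. simpl.
  destruct (Nat.eqb_spec c0 a) as [->|Hne].
  - rewrite (map_ext_in _ f). { lia. }
    intros c Hc. apply in_seq in Hc. destruct (Nat.eqb_spec a c); lia.
  - rewrite IH by lia. lia.
Qed.

Lemma list_sum_const {A : Type} (v : nat) (l : list A) :
  list_sum (map (fun _ => v) l) = length l * v.
Proof. induction l; simpl; auto. Qed.

(** An insertion adds one slot to the chosen clique and creates k cliques with one slot each, on
    which P has the common value b. *)
Lemma weight_snoc k t q P b :
  valid_tree k t -> fst q <= k * length t ->
  (forall i, i < k -> P (S (k * length t) + i) = b) ->
  weight k (t ++ [q]) P =
  weight k t P + (if P (fst q) then 1 else 0) + (if b then k else 0).
Proof.
  intros Hv Hq Hb. rewrite !weight_sum, length_app. simpl length.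
  replace (S (k * (length t + 1))) with (S (k * length t) + k) by lia.
  rewrite seq_app, map_app, list_sum_app. f_equal.
  - rewrite <- (list_sum_add_indicator _ (fst q)) by lia. f_equal.
    apply map_ext. intros c. rewrite nchildren_snoc.
    destruct (Nat.eqb_spec (fst q) c) as [->|_]; destruct (P c); lia.
  - rewrite (map_ext_in _ (fun _ => if b then 1 else 0)).
    + rewrite list_sum_const, length_seq. destruct b; lia.
    + intros c Hc. apply in_seq in Hc.
      rewrite nchildren_snoc, (nchildren_new k) by (auto; lia).
      replace c with (S (k * length t) + (c - S (k * length t))) by lia.
      rewrite Hb by lia.
      destruct (Nat.eqb_spec (fst q) (S (k * length t) + (c - S (k * length t)))); [lia|].
      reflexivity.
Qed.

Lemma weight_ext k t P Q :
  (forall c, c <= k * length t -> P c = Q c) -> weight k t P = weight k t Q.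
Proof.
  intros H. apply filter_ext_in_length. intros q Hq.
  apply H. now apply choices_fst_le.
Qed.

(** This is [weight] with every clique selected: it starts at 1 and grows by k + 1 at each
    insertion. *)
Lemma choices_length k t : valid_tree k t -> length (choices k t) = S (S k * length t).
Proof.
  intros Hv. transitivity (weight k t (fun _ => true)).
  { unfold weight. f_equal. symmetry. apply forallb_filter_id, forallb_forall; auto. }
  revert Hv. induction t as [|q t IH] using rev_ind; intros Hv.
  - rewrite weight_sum. simpl. rewrite Nat.mul_0_r. reflexivity.
  - apply valid_tree_snoc in Hv. destruct Hv as [Hv Hq].
    rewrite (weight_snoc _ _ _ _ true) by auto.
    rewrite IH, length_app by auto. simpl. nia.
Qed.

(* Each descendant of u brings k new cliques meeting the descendants of u and
   one extra slot at its parent clique, except that the parent clique of u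
   itself does not meet the descendants of u. *)
Lemma weight_hits k t u :
  valid_tree k t -> 1 <= u <= length t ->
  1 <= ndesc k t u /\ S (weight k t (hits k t u)) = S k * ndesc k t u.
Proof.
  induction t as [|q t IH] using rev_ind; intros Hv Hu; [simpl in Hu; lia|].
  apply valid_tree_snoc in Hv. destruct Hv as [Hv Hq].
  rewrite length_app in Hu; simpl in Hu.
  rewrite (weight_snoc _ _ _ _ (Nat.eqb (S (length t)) u || hits k t u (fst q)))
    by (auto; intros; now apply hits_snoc_new).
  rewrite ndesc_snoc by auto.
  rewrite (weight_ext k t _ (hits k t u)) by (intros; now apply hits_snoc_old).
  rewrite hits_snoc_old by auto.
  (* When u is the newest node, its count passes from 0 to 1 and the weight from 0 to k, since only
     its own k cliques are hit. *)
  destruct (Nat.eqb_spec (S (length t)) u) as [<-|Hne].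
  - rewrite hits_lt by (auto; lia). simpl.
    replace (ndesc k t (S (length t))) with 0.
    + replace (weight k t (hits k t (S (length t)))) with 0; [lia|].
      rewrite (weight_ext _ _ _ (fun _ => false)) by (intros; apply hits_lt; auto).
      unfold weight. induction (choices k t); simpl; auto.
    + unfold ndesc. rewrite (filter_ext_in_length _ (fun _ => false)).
      * induction (seq 1 _); simpl; auto.
      * intros w Hw. apply in_seq in Hw. apply is_desc_lt; auto; lia.
  - destruct (IH Hv ltac:(lia)) as [H1 H2]. simpl orb.
    destruct (hits k t u (fst q)); lia.
Qed.

Lemma ndesc_last k t : valid_tree k t -> 1 <= length t -> ndesc k t (length t) = 1.
Proof.
  destruct t as [|q t _] using rev_ind; [simpl; lia|]. intros Hv _.
  apply valid_tree_snoc in Hv. destruct Hv as [Hv Hq].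
  rewrite ndesc_snoc by auto. rewrite length_app. simpl length.
  rewrite Nat.add_1_r, Nat.eqb_refl. simpl.
  unfold ndesc. rewrite (filter_ext_in_length _ (fun _ => false)).
  - induction (seq 1 _); simpl; auto.
  - intros w Hw. apply in_seq in Hw. apply is_desc_lt; auto; lia.
Qed.

(** * Counting trees by the number of descendants *)

Definition tree_count (k n j m : nat) : nat :=
  length (filter (fun t => Nat.eqb (ndesc k t j) m) (trees k n)).

Lemma trees_length_S k n : length (trees k (S n)) = length (trees k n) * S (S k * n).
Proof.
  cbn [trees]. assert (H : forall t, In t (trees k n) -> length (choices k t) = S (S k * n)).
  { intros t Ht. apply trees_valid in Ht. destruct Ht as [Hv <-]. now apply choices_length. }
  induction (trees k n) as [|t l IH]; [reflexivity|].
  cbn [flat_map]. rewrite length_app, length_map, (H t) by (left; auto).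
  rewrite IH by (intros s Hs; apply H; right; auto). cbn [length]. lia.
Qed.

Lemma filter_negb_length {A : Type} (P : A -> bool) l :
  length (filter P l) + length (filter (fun a => negb (P a)) l) = length l.
Proof. induction l as [|a l IH]; simpl; auto. destruct (P a); simpl; lia. Qed.

(** Terms are moved across to avoid subtraction in [nat]. A tree with i + 1 descendants keeps that
    number under 1 + (k+1) n - ((k+1)(i+1) - 1) choices, and a tree with i descendants reaches i + 1
    under (k+1) i - 1 choices. *)
Lemma tree_count_S k n j i :
  1 <= j <= n ->
  tree_count k (S n) j (S i) + S k * S i * tree_count k n j (S i) + tree_count k n j i =
  (2 + S k * n) * tree_count k n j (S i) + S k * i * tree_count k n j i.
Proof.
  intros Hj. unfold tree_count. cbn [trees].
  assert (H : forall t, In t (trees k n) -> valid_tree k t /\ length t = n)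
    by apply trees_valid.
  induction (trees k n) as [|t l IH]; [simpl; lia|].
  specialize (IH (fun s Hs => H s (or_intror Hs))).
  destruct (H t (or_introl eq_refl)) as [Hv Hl].
  cbn [flat_map]. rewrite filter_app, length_app, length_filter_map.
  (* A choice that hits raises the count by one, so the target i + 1 is reached from i by a hit and
     from i + 1 by a miss. *)
  rewrite (filter_ext_in_length _
    (fun q => if hits k t j (fst q) then Nat.eqb (ndesc k t j) i
              else Nat.eqb (ndesc k t j) (S i))).
  2:{ intros q Hq. apply choices_fst_le in Hq. rewrite ndesc_snoc by auto.
      destruct (Nat.eqb_spec (S (length t)) j); [lia|]. simpl orb.
      destruct (hits k t j (fst q)).
      - now rewrite Nat.add_1_r.
      - now rewrite Nat.add_0_r. }
  destruct (weight_hits k t j Hv ltac:(lia)) as [H1 H2].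
  pose proof (choices_length k t Hv) as H3.
  pose proof (filter_negb_length (fun q => hits k t j (fst q)) (choices k t)) as H4.
  unfold weight in H2. cbn [filter].
  destruct (Nat.eqb_spec (ndesc k t j) i) as [E1|E1];
  destruct (Nat.eqb_spec (ndesc k t j) (S i)) as [E2|E2]; [lia| | |].
  - rewrite (filter_ext_in_length _ (fun q => hits k t j (fst q)))
      by (intros q _; now destruct (hits k t j (fst q))).
    cbn [length]. rewrite E1 in H2. rewrite Hl in H3.
    generalize dependent (S k * S i). generalize dependent (S k * i).
    generalize dependent (S k * n). intros. lia.
  - rewrite (filter_ext_in_length _ (fun q => negb (hits k t j (fst q))))
      by (intros q _; now destruct (hits k t j (fst q))).
    cbn [length]. rewrite E2 in H2. rewrite Hl in H3.
    generalize dependent (S k * S i). generalize dependent (S k * i).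
    generalize dependent (S k * n). intros. lia.
  - rewrite (filter_ext_in_length _ (fun q => false))
      by (intros q _; now destruct (hits k t j (fst q))).
    replace (length (filter (fun _ => false) (choices k t))) with 0
      by (clear; induction (choices k t); simpl; auto).
    cbn [length]. exact IH.
Qed.

Lemma tree_count_0 k n j : 1 <= j <= n -> tree_count k n j 0 = 0.
Proof.
  intros Hj. unfold tree_count. rewrite (filter_ext_in_length _ (fun _ => false)).
  - induction (trees k n); simpl; auto.
  - intros t Ht. apply trees_valid in Ht. destruct Ht as [Hv Hl].
    destruct (weight_hits k t j Hv ltac:(lia)) as [H1 _].
    destruct (Nat.eqb_spec (ndesc k t j) 0); lia.
Qed.

Lemma tree_count_diag k j m :
  1 <= j -> tree_count k j j m = if Nat.eqb m 1 then length (trees k j) else 0.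
Proof.
  intros Hj. unfold tree_count.
  rewrite (filter_ext_in_length _ (fun _ => Nat.eqb m 1)).
  - destruct (Nat.eqb m 1); induction (trees k j); simpl; auto.
  - intros t Ht. apply trees_valid in Ht. destruct Ht as [Hv Hl].
    rewrite <- Hl, ndesc_last by (auto; lia). apply Nat.eqb_sym.
Qed.

Local Close Scope nat_scope.

(** * The Polya urn law *)

Fixpoint rbin (a : R) (n : nat) : R :=
  match n with
  | O => 1
  | S m => rbin a m * (a + INR m) / INR (S m)
  end.

Lemma INR_S_pos n : 0 < INR (S n).
Proof. apply lt_0_INR; lia. Qed.

Lemma rbin_pos a n : 0 < a -> 0 < rbin a n.
Proof.
  intros Ha; induction n as [|n IH]; [simpl; lra|].
  cbn [rbin]. pose proof (pos_INR n). pose proof (INR_S_pos n).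
  apply Rdiv_lt_0_compat; auto. apply Rmult_lt_0_compat; lra.
Qed.

Lemma rbin_S a n : INR (S n) * rbin a (S n) = (a + INR n) * rbin a n.
Proof. cbn [rbin]. pose proof (INR_S_pos n). field. lra. Qed.

Lemma falling_shift x n : falling (x + 1) (S n) = (x + 1) * falling x n.
Proof.
  induction n as [|n IH]; [simpl; lra|].
  change (falling (x + 1) (S (S n))) with (falling (x + 1) (S n) * (x + 1 - INR (S n))).
  rewrite IH, S_INR. simpl. ring.
Qed.

(** The identity binom(a + n - 1, n) = a (a+1) ... (a+n-1) / n!, through which the binomial
    coefficients of the statement are translated. *)
Lemma gbinom_rbin a n : gbinom (a + INR n - 1) n = rbin a n.
Proof.
  induction n as [|n IH]; [unfold gbinom; simpl; lra|].
  cbn [rbin]. rewrite <- IH. unfold gbinom.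
  replace (a + INR (S n) - 1) with (a + INR n - 1 + 1) by (rewrite S_INR; ring).
  rewrite falling_shift.
  change (fact (S n)) with (S n * fact n)%nat. rewrite mult_INR.
  pose proof (INR_S_pos n). pose proof (INR_fact_neq_0 n). field. split; lra.
Qed.

(* The law of the number of successes in N draws from a Polya urn started with weights a and b. *)
Definition polya (a b : R) (N i : nat) : R :=
  if (i <=? N)%nat then rbin a i * rbin b (N - i) / rbin (a + b) N else 0.

Lemma polya_nonneg a b N i : 0 < a -> 0 < b -> 0 <= polya a b N i.
Proof.
  intros Ha Hb. unfold polya. destruct (i <=? N)%nat; [|lra].
  apply Rlt_le, Rdiv_lt_0_compat; [apply Rmult_lt_0_compat|]; apply rbin_pos; lra.
Qed.

Lemma polya_gt a b N i : (N < i)%nat -> polya a b N i = 0.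
Proof. intros H. unfold polya. destruct (Nat.leb_spec i N); [lia|reflexivity]. Qed.

Lemma polya_S_0 a b N :
  0 < a -> 0 < b ->
  (a + b + INR N) * polya a b (S N) 0 = (b + INR N) * polya a b N 0.
Proof.
  intros Ha Hb. unfold polya. simpl Nat.leb. cbv iota. rewrite !Nat.sub_0_r.
  pose proof (rbin_pos (a + b) N ltac:(lra)). pose proof (pos_INR N). pose proof (INR_S_pos N).
  cbn [rbin]. field. lra.
Qed.

(** One draw of the urn: after N draws with i successes, a success has weight a + i and a failure b
    + N - i out of a + b + N. Written without division, the relation has the shape of the tree
    recurrence. *)
Lemma polya_S_S a b N i :
  0 < a -> 0 < b ->
  (a + b + INR N) * polya a b (S N) (S i) =
  (b + INR N - INR (S i)) * polya a b N (S i) + (a + INR i) * polya a b N i.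
Proof.
  intros Ha Hb. unfold polya.
  pose proof (rbin_pos (a + b) N ltac:(lra)) as HD. pose proof (pos_INR N). pose proof (INR_S_pos N).
  pose proof (INR_S_pos i).
  destruct (Nat.leb_spec (S i) (S N)); destruct (Nat.leb_spec (S i) N);
    destruct (Nat.leb_spec i N); try lia; try lra.
  - pose proof (rbin_S b (N - S i)) as E.
    replace (S N - S i)%nat with (N - i)%nat by lia.
    replace (S (N - S i)) with (N - i)%nat in E by lia.
    rewrite !minus_INR in E by lia.
    replace (b + INR N - INR (S i)) with (b + (INR N - INR (S i))) by ring.
    (* Both terms on the right are multiples of this product, with factors N - i and i + 1, which
       add up to N + 1. *)
    transitivity (INR (S N) * rbin a (S i) * rbin b (N - i) / rbin (a + b) N).
    { cbn [rbin]. field. lra. }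
    transitivity (((b + (INR N - INR (S i))) * rbin b (N - S i)) * rbin a (S i) / rbin (a + b) N
                  + ((a + INR i) * rbin a i) * rbin b (N - i) / rbin (a + b) N).
    { rewrite <- E, <- (rbin_S a i). rewrite !S_INR. field. lra. }
    field. lra.
  - assert (i = N) as -> by lia. rewrite Nat.sub_diag. rewrite Nat.sub_diag. cbn [rbin]. field. lra.
Qed.

Lemma sum_shift (g p : nat -> R) n :
  sum_f_R0 (fun i => g i * p i) (S n) = g O * p O + sum_f_R0 (fun i => g (S i) * p (S i)) n.
Proof. rewrite decomp_sum by lia. reflexivity. Qed.

(** The expectation of g after one more draw, conditioned on the state after N draws. The constant g
    = 1 gives the total mass and the identity gives the mean. *)
Lemma polya_expect_S a b N (g : nat -> R) :
  0 < a -> 0 < b ->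
  (a + b + INR N) * sum_f_R0 (fun i => g i * polya a b (S N) i) (S N) =
  sum_f_R0 (fun i => (g i * (b + INR N - INR i) + g (S i) * (a + INR i)) * polya a b N i) N.
Proof.
  intros Ha Hb. rewrite sum_shift, Rmult_plus_distr_l, scal_sum.
  rewrite (sum_eq _ (fun i => g (S i) * ((b + INR N - INR (S i)) * polya a b N (S i))
                              + g (S i) * (a + INR i) * polya a b N i)).
  2:{ intros i _. transitivity (g (S i) * ((a + b + INR N) * polya a b (S N) (S i))); [ring|].
      rewrite polya_S_S by auto. ring. }
  rewrite sum_plus.
  replace ((a + b + INR N) * (g O * polya a b (S N) 0))
    with (g O * ((b + INR N - INR 0) * polya a b N 0))
    by (rewrite Rminus_0_r, <- polya_S_0 by auto; ring).
  rewrite <- Rplus_assoc.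
  rewrite <- (sum_shift g (fun i => (b + INR N - INR i) * polya a b N i)).
  rewrite tech5, polya_gt by lia. rewrite !Rmult_0_r, Rplus_0_r.
  rewrite <- sum_plus. apply sum_eq. intros i _. ring.
Qed.

Lemma polya_total a b N : 0 < a -> 0 < b -> sum_f_R0 (polya a b N) N = 1.
Proof.
  intros Ha Hb. induction N as [|N IH].
  - unfold polya; simpl. lra.
  - pose proof (polya_expect_S a b N (fun _ => 1) Ha Hb) as H. cbv beta in H.
    rewrite (sum_eq _ (fun i => polya a b N i * (a + b + INR N)) N) in H by (intros; ring).
    rewrite <- scal_sum, IH in H.
    rewrite (sum_eq _ (fun i => 1 * polya a b (S N) i) (S N)) by (intros; ring).
    pose proof (pos_INR N).
    apply Rmult_eq_reg_l with (a + b + INR N); lra.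
Qed.

Lemma polya_mean a b N :
  0 < a -> 0 < b -> sum_f_R0 (fun i => INR i * polya a b N i) N = INR N * a / (a + b).
Proof.
  intros Ha Hb. induction N as [|N IH].
  - simpl. field. lra.
  - pose proof (polya_expect_S a b N INR Ha Hb) as H.
    rewrite (sum_eq _ (fun i => (INR i * polya a b N i) * (a + b + INR N + 1)
                                + polya a b N i * a) N) in H
      by (intros; rewrite S_INR; ring).
    rewrite sum_plus, <- !scal_sum, IH, polya_total in H by auto.
    pose proof (pos_INR N).
    apply Rmult_eq_reg_l with (a + b + INR N); [|lra].
    rewrite H, S_INR. field. lra.
Qed.

Lemma trees_length_pos k n : 0 < INR (length (trees k n)).
Proof.
  apply lt_0_INR. induction n as [|n IH]; [simpl; lia|].
  rewrite trees_length_S. lia.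
Qed.

Lemma tree_count_S_INR k n j i :
  (1 <= j <= n)%nat ->
  INR (tree_count k (S n) j (S i)) =
  (2 + (INR k + 1) * (INR n - INR (S i))) * INR (tree_count k n j (S i))
  + ((INR k + 1) * INR i - 1) * INR (tree_count k n j i).
Proof.
  intros Hj. pose proof (tree_count_S k n j i Hj) as H. apply (f_equal INR) in H.
  repeat rewrite ?plus_INR, ?mult_INR in H. rewrite !(S_INR k) in H.
  change (INR 2) with 2 in H. lra.
Qed.

(** By induction on d = n - j: at d = 0 the newest node is its own only descendant, and afterwards
    tree counts divided by the number of trees obey the recurrence of the urn. *)
Lemma ndesc_law k n j i :
  (1 <= k)%nat -> (1 <= j <= n)%nat ->
  prob k n (fun t => Nat.eqb (ndesc k t j) (S i)) =
  polya (INR k / (INR k + 1)) (INR j - 1 + 2 / (INR k + 1)) (n - j) i.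
Proof.
  intros Hk [Hj Hn]. apply le_INR in Hk. simpl in Hk.
  pose proof (le_INR _ _ Hj) as Hj'. simpl in Hj'.
  set (a := INR k / (INR k + 1)). set (b := INR j - 1 + 2 / (INR k + 1)).
  assert (Ha : 0 < a) by (apply Rdiv_lt_0_compat; lra).
  assert (Hb : 0 < b).
  { enough (0 < 2 / (INR k + 1)) by (unfold b; lra). apply Rdiv_lt_0_compat; lra. }
  unfold prob. fold (tree_count k n j (S i)).
  enough (H : forall d i, INR (tree_count k (j + d) j (S i)) / INR (length (trees k (j + d)))
                          = polya a b d i).
  { rewrite <- (H (n - j)%nat i). now replace (j + (n - j))%nat with n by lia. }
  clear i. induction d as [|d IH]; intros i.
  - rewrite Nat.add_0_r, tree_count_diag by auto. pose proof (trees_length_pos k j).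
    destruct i as [|i]; simpl Nat.eqb; cbv iota.
    + unfold polya; simpl. field. lra.
    + rewrite polya_gt by lia. simpl. lra.
  - assert (Hk' : INR k + 1 <> 0) by lra.
    pose proof (pos_INR d) as Hd. pose proof (trees_length_pos k (j + d)) as HT.
    rewrite Nat.add_succ_r, trees_length_S, tree_count_S_INR by lia.
    rewrite mult_INR, (S_INR (S k * (j + d))), mult_INR, (S_INR k).
    (* The total weight, the weight missing the descendants when there are i + 1 of them, and the
       weight hitting them when there are i, each written as k + 1 times an urn weight. *)
    assert (E0 : (INR k + 1) * INR (j + d) + 1 = (INR k + 1) * (a + b + INR d)).
    { unfold a, b. rewrite plus_INR. field. lra. }
    assert (E1 : 2 + (INR k + 1) * (INR (j + d) - INR (S i)) = (INR k + 1) * (b + INR d - INR i)).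
    { unfold b. rewrite plus_INR, S_INR. field. lra. }
    assert (E2 : (INR k + 1) * INR i - 1 = (INR k + 1) * (a + INR i - 1)).
    { unfold a. field. lra. }
    rewrite E0, E1, E2.
    transitivity (((b + INR d - INR i) * (INR (tree_count k (j + d) j (S i)) / INR (length (trees k (j + d))))
                   + (a + INR i - 1) * (INR (tree_count k (j + d) j i) / INR (length (trees k (j + d)))))
                  / (a + b + INR d)).
    { field. repeat split; lra. }
    rewrite IH.
    destruct i as [|i].
    + rewrite tree_count_0 by lia. apply Rmult_eq_reg_l with (a + b + INR d); [|lra].
      rewrite polya_S_0 by auto. simpl. field. split; lra.
    + rewrite IH. apply Rmult_eq_reg_l with (a + b + INR d); [|lra].
      rewrite polya_S_S by auto. rewrite !S_INR. field. lra.
Qed.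

(** * Bernoulli's inequality for real exponents *)

Lemma Rpower_pos x y : 0 < Rpower x y.
Proof. apply exp_pos. Qed.

(** With t = ln x, the bound exp s >= 1 + s at s = (1-p) t and at s = - p t gives two inequalities
    for exp (p t); combined with weights p and 1 - p, their linear terms cancel. *)
Lemma Rpower_le_bernoulli x p : 0 <= p <= 1 -> 0 < x -> Rpower x p <= 1 + p * (x - 1).
Proof.
  intros Hp Hx. unfold Rpower. set (t := ln x).
  assert (Ht : x = exp t) by (unfold t; now rewrite exp_ln).
  pose proof (exp_pos (p * t)) as H0.
  assert (H1 : exp (p * t) * (1 + (1 - p) * t) <= exp t).
  { apply Rle_trans with (exp (p * t) * exp ((1 - p) * t)).
    - apply Rmult_le_compat_l; [lra|]. apply exp_ineq1_le.
    - rewrite <- exp_plus. apply Req_le. f_equal. ring. }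
  assert (H2 : exp (p * t) * (1 + - (p * t)) <= 1).
  { apply Rle_trans with (exp (p * t) * exp (- (p * t))).
    - apply Rmult_le_compat_l; [lra|]. apply exp_ineq1_le.
    - rewrite <- exp_plus, Rplus_opp_r, exp_0. lra. }
  rewrite Ht.
  pose proof (Rmult_le_compat_l p _ _ ltac:(lra) H1).
  pose proof (Rmult_le_compat_l (1 - p) _ _ ltac:(lra) H2). nra.
Qed.

Lemma Rpower_div x y p : 0 < x -> 0 < y -> Rpower (x / y) p = Rpower x p / Rpower y p.
Proof.
  intros Hx Hy. unfold Rdiv. rewrite <- Rpower_mult_distr by (auto; now apply Rinv_0_lt_compat).
  f_equal. unfold Rpower. rewrite ln_Rinv by auto. rewrite <- exp_Ropp. f_equal. ring.
Qed.

Lemma Rpower_base_1 p : Rpower 1 p = 1.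
Proof. unfold Rpower. rewrite ln_1, Rmult_0_r. apply exp_0. Qed.

(** * Gautschi bounds and asymptotics *)

(* The next two bounds are the one-step versions of Gautschi's inequality. *)
Lemma Rpower_step_upper x a :
  0 <= a <= 1 -> 0 < x -> x / (x + a) <= Rpower (x / (x + 1)) a.
Proof.
  intros Ha Hx.
  pose proof (Rpower_le_bernoulli ((x + 1) / x) a Ha ltac:(apply Rdiv_lt_0_compat; lra)) as H.
  replace (1 + a * ((x + 1) / x - 1)) with (/ (x / (x + a))) in H by (field; lra).
  replace (Rpower ((x + 1) / x) a) with (/ Rpower (x / (x + 1)) a) in H.
  - apply Rinv_le_contravar in H; [|apply Rinv_0_lt_compat, Rpower_pos].
    now rewrite !Rinv_inv in H.
  - rewrite !Rpower_div by lra. pose proof (Rpower_pos x a). pose proof (Rpower_pos (x + 1) a).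
    field. lra.
Qed.

Lemma Rpower_step_lower x a :
  0 <= a <= 1 -> 0 < x + a - 1 -> Rpower ((x + a - 1) / (x + a)) a <= x / (x + a).
Proof.
  intros Ha Hx.
  pose proof (Rpower_le_bernoulli ((x + a - 1) / (x + a)) a Ha
                ltac:(apply Rdiv_lt_0_compat; lra)) as H.
  replace (1 + a * ((x + a - 1) / (x + a) - 1)) with (x / (x + a)) in H by (field; lra).
  exact H.
Qed.

Lemma rbin_ratio_S a b N :
  0 < a -> 0 < b ->
  rbin b (S N) / rbin (a + b) (S N) =
  rbin b N / rbin (a + b) N * ((b + INR N) / (b + INR N + a)).
Proof.
  intros Ha Hb. cbn [rbin]. pose proof (rbin_pos (a + b) N ltac:(lra)).
  pose proof (pos_INR N). pose proof (INR_S_pos N). field. lra.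
Qed.

Lemma rbin_ratio_pos a b N : 0 < a -> 0 < b -> 0 < rbin b N / rbin (a + b) N.
Proof. intros. apply Rdiv_lt_0_compat; apply rbin_pos; lra. Qed.

(** The quotient is the product of x / (x + a) over x = b, ..., b + N - 1. Each factor is at most (x
    / (x + 1))^a, and these bounds telescope. Nothing depends on b being fixed. *)
Lemma rbin_ratio_upper a b N :
  0 < a <= 1 -> 0 < b -> rbin b N / rbin (a + b) N <= Rpower (b / (b + INR N)) a.
Proof.
  intros Ha Hb. induction N as [|N IH].
  - simpl. rewrite Rplus_0_r, !Rdiv_diag by lra. rewrite Rpower_base_1. lra.
  - pose proof (pos_INR N). rewrite rbin_ratio_S by lra.
    apply Rle_trans with (Rpower (b / (b + INR N)) a * Rpower ((b + INR N) / (b + INR N + 1)) a).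
    + apply Rmult_le_compat; auto.
      * apply Rlt_le, rbin_ratio_pos; lra.
      * apply Rlt_le, Rdiv_lt_0_compat; lra.
      * apply Rpower_step_upper; lra.
    + rewrite Rpower_mult_distr by (apply Rdiv_lt_0_compat; lra).
      apply Req_le. f_equal. rewrite S_INR. field. lra.
Qed.

(** The same telescoping with the lower one-step bound, whose base is shifted by a - 1 and must stay
    positive. *)
Lemma rbin_ratio_lower a b N :
  0 < a <= 1 -> 0 < b + a - 1 ->
  Rpower ((b + a - 1) / (b + a - 1 + INR N)) a <= rbin b N / rbin (a + b) N.
Proof.
  intros Ha Hb. induction N as [|N IH].
  - simpl. rewrite Rplus_0_r, !Rdiv_diag by lra. rewrite Rpower_base_1. lra.
  - pose proof (pos_INR N). rewrite rbin_ratio_S by lra.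
    apply Rle_trans with (Rpower ((b + a - 1) / (b + a - 1 + INR N)) a
      * Rpower ((b + INR N + a - 1) / (b + INR N + a)) a).
    + rewrite Rpower_mult_distr by (apply Rdiv_lt_0_compat; lra).
      apply Req_le. f_equal. rewrite S_INR. field. lra.
    + apply Rmult_le_compat; auto; try (apply Rlt_le, Rpower_pos).
      apply Rpower_step_lower; lra.
Qed.

Lemma Un_cv_ext_loc u v l n0 :
  (forall n, (n0 <= n)%nat -> u n = v n) -> Un_cv u l -> Un_cv v l.
Proof.
  intros H Hu eps He. destruct (Hu eps He) as [n1 H1].
  exists (max n0 n1). intros n Hn. rewrite <- H by lia. apply H1. lia.
Qed.

Lemma Un_cv_squeeze_loc u v w l n0 :
  (forall n, (n0 <= n)%nat -> u n <= v n <= w n) -> Un_cv u l -> Un_cv w l -> Un_cv v l.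
Proof.
  intros H Hu Hw eps He. destruct (Hu eps He) as [n1 H1]. destruct (Hw eps He) as [n2 H2].
  exists (max n0 (max n1 n2)). intros n Hn.
  specialize (H n ltac:(lia)). specialize (H1 n ltac:(lia)). specialize (H2 n ltac:(lia)).
  unfold Rdist in *. apply Rabs_def2 in H1, H2. apply Rabs_def1; lra.
Qed.

Lemma Un_cv_const l : Un_cv (fun _ => l) l.
Proof. intros eps He. exists O. intros n _. unfold Rdist. rewrite Rminus_diag, Rabs_R0. lra. Qed.

Lemma Un_cv_div u v l m :
  Un_cv u l -> Un_cv v m -> m <> 0 -> Un_cv (fun n => u n / v n) (l / m).
Proof.
  intros Hu Hv Hm. rewrite <- is_lim_seq_Reals in *. now apply is_lim_seq_div'.
Qed.

Lemma Un_cv_inv_INR : Un_cv (fun n => / INR n) 0.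
Proof.
  rewrite <- is_lim_seq_Reals.
  apply (is_lim_seq_inv INR p_infty is_lim_seq_INR). discriminate.
Qed.

Lemma Un_cv_inv_tends u : tends_to_inf u -> Un_cv (fun n => / INR (u n)) 0.
Proof.
  intros H eps He. destruct (Un_cv_inv_INR eps He) as [M HM].
  destruct (H M) as [N HN]. exists N. intros n Hn. apply HM. apply HN. lia.
Qed.

(** For exponent 1 - a in [0, 1) the one-step bounds make the sequence nondecreasing, and make
    [rbin a n * Rpower (a + INR n) (1 - a)], which dominates it, nonincreasing. So it converges, to
    a limit no smaller than its value at n = 1. *)
Lemma rbin_asymp_le1 a :
  0 < a <= 1 -> exists g, 0 < g /\ Un_cv (fun n => rbin a n * Rpower (INR n) (1 - a)) g.
Proof.
  intros Ha. set (u := fun n => rbin a n * Rpower (INR n) (1 - a)).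
  (* The index starts at 1: as [Rpower 0 (1 - a)] is 1, the terms at 0 and 1 are 1 and a, out of
     order when a < 1. *)
  assert (Hgrow : Un_growing (fun n => u (n + 1)%nat)).
  { intros n. unfold u. rewrite !Nat.add_1_r. pose proof (INR_S_pos n) as Hn.
    pose proof (INR_S_pos (S n)) as Hn'. pose proof (rbin_pos a (S n) ltac:(lra)).
    replace (rbin a (S (S n))) with (rbin a (S n) * ((a + INR (S n)) / INR (S (S n))))
      by (cbn [rbin]; field; lra).
    rewrite Rmult_assoc. apply Rmult_le_compat_l; [lra|].
    pose proof (Rpower_step_lower (a + INR (S n)) (1 - a) ltac:(lra) ltac:(lra)) as Hs.
    replace (a + INR (S n) + (1 - a) - 1) with (INR (S n)) in Hs by ring.
    replace (a + INR (S n) + (1 - a)) with (INR (S (S n))) in Hs by (rewrite (S_INR (S n)); ring).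
    apply (Rmult_le_compat_r (Rpower (INR (S (S n))) (1 - a))) in Hs; [|apply Rlt_le, Rpower_pos].
    rewrite Rpower_mult_distr in Hs by (auto; now apply Rdiv_lt_0_compat).
    now replace (INR (S n) / INR (S (S n)) * INR (S (S n))) with (INR (S n)) in Hs by (field; lra). }
  assert (Hub : forall n, rbin a n * Rpower (a + INR n) (1 - a) <= Rpower a (1 - a)).
  { induction n as [|n IH]; [simpl; rewrite Rplus_0_r; lra|].
    refine (Rle_trans _ _ _ _ IH). pose proof (pos_INR n). pose proof (INR_S_pos n).
    pose proof (rbin_pos a n ltac:(lra)).
    replace (rbin a (S n)) with (rbin a n * ((a + INR n) / INR (S n))) by (cbn [rbin]; field; lra).
    rewrite Rmult_assoc. apply Rmult_le_compat_l; [lra|].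
    pose proof (Rpower_step_upper (a + INR n) (1 - a) ltac:(lra) ltac:(lra)) as Hs.
    replace (a + INR n + (1 - a)) with (INR (S n)) in Hs by (rewrite S_INR; ring).
    replace (a + INR n + 1) with (a + INR (S n)) in Hs by (rewrite S_INR; ring).
    apply (Rmult_le_compat_r (Rpower (a + INR (S n)) (1 - a))) in Hs; [|apply Rlt_le, Rpower_pos].
    rewrite Rpower_mult_distr in Hs by (try apply Rdiv_lt_0_compat; lra).
    now replace ((a + INR n) / (a + INR (S n)) * (a + INR (S n))) with (a + INR n) in Hs by (field; lra). }
  destruct (growing_cv _ Hgrow) as [g Hg].
  { exists (Rpower a (1 - a)). intros x [n ->]. unfold u. rewrite Nat.add_1_r.
    refine (Rle_trans _ _ _ _ (Hub (S n))). pose proof (INR_S_pos n).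
    apply Rmult_le_compat_l; [apply Rlt_le, rbin_pos; lra|].
    apply Rle_Rpower_l; lra. }
  exists g. split.
  - apply Rlt_le_trans with (u 1%nat).
    + apply Rmult_lt_0_compat; [apply rbin_pos; lra|apply Rpower_pos].
    + apply (growing_ineq _ _ Hgrow Hg 0).
  - now apply CV_shift with 1%nat.
Qed.

(** Raising the parameter by one costs the factor (b + n) / b. This carries asymptotics to larger
    parameters and yields closed forms of partial sums. *)
Lemma rbin_succ b n : 0 < b -> rbin (b + 1) n = rbin b n * (b + INR n) / b.
Proof.
  intros Hb. induction n as [|n IH]; [simpl; field; lra|].
  cbn [rbin]. rewrite IH. pose proof (INR_S_pos n). rewrite (S_INR n) in *. field. lra.
Qed.

(* g = 1 / Gamma(b) *)
Lemma rbin_asymp b :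
  0 < b -> exists g, 0 < g /\ Un_cv (fun n => rbin b n * Rpower (INR n) (1 - b)) g.
Proof.
  (* The one-step bounds need exponents in [0, 1]; larger parameters are reached by unit steps,
     counted by m. *)
  assert (H : forall m b, 0 < b <= INR m + 1 ->
    exists g, 0 < g /\ Un_cv (fun n => rbin b n * Rpower (INR n) (1 - b)) g).
  { induction m as [|m IH]; intros c Hc.
    - apply rbin_asymp_le1. simpl in Hc. lra.
    - destruct (Rle_lt_dec c 1) as [H1|H1]; [apply rbin_asymp_le1; lra|].
      rewrite S_INR in Hc. destruct (IH (c - 1) ltac:(lra)) as [g [Hg0 Hg]].
      exists (g / (c - 1)). split; [apply Rdiv_lt_0_compat; lra|].
      apply Un_cv_ext_loc with (n0 := 1%nat)
        (u := fun n => (rbin (c - 1) n * Rpower (INR n) (1 - (c - 1)))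
                       * ((1 + (c - 1) * / INR n) * / (c - 1))).
      + intros n Hn. apply le_INR in Hn. simpl in Hn.
        assert (E : rbin c n = rbin (c - 1) n * (c - 1 + INR n) / (c - 1))
          by (rewrite <- rbin_succ by lra; f_equal; ring).
        rewrite E.
        replace (1 - (c - 1)) with (1 - c + 1) by ring.
        rewrite Rpower_plus, Rpower_1 by lra. field. lra.
      + replace (g / (c - 1)) with (g * ((1 + (c - 1) * 0) * / (c - 1))) by (field; lra).
        apply CV_mult; auto. apply CV_mult; [|apply Un_cv_const].
        apply CV_plus; [apply Un_cv_const|].
        apply CV_mult; [apply Un_cv_const|apply Un_cv_inv_INR]. }
  intros Hb. destruct (INR_unbounded b) as [m Hm]. apply (H m). lra.
Qed.

Lemma Un_cv_bounded u l : Un_cv u l -> exists C, 0 < C /\ forall n, Rabs (u n) <= C.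
Proof.
  intros H. destruct (maj_by_pos u (exist _ l H)) as [C HC]. now exists C.
Qed.

Lemma Rpower_mult_opp x p q : p + q = 0 -> Rpower x p * Rpower x q = 1.
Proof. intros H. rewrite <- Rpower_plus, H. unfold Rpower. rewrite Rmult_0_l. apply exp_0. Qed.

Lemma rbin_upper b :
  0 < b -> exists C, 0 < C /\ forall n, rbin b n <= C * Rpower (INR n) (b - 1).
Proof.
  intros Hb. destruct (rbin_asymp b Hb) as [g [Hg0 Hg]].
  destruct (Un_cv_bounded _ _ Hg) as [C [HC0 HC]].
  exists C. split; auto. intros n. specialize (HC n).
  apply (Rle_trans _ _ _ (Rle_abs _)) in HC.
  apply (Rmult_le_compat_r (Rpower (INR n) (b - 1))) in HC; [|apply Rlt_le, Rpower_pos].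
  rewrite Rmult_assoc, Rpower_mult_opp, Rmult_1_r in HC by ring. exact HC.
Qed.

Lemma rbin_lower b :
  0 < b -> exists C, 0 < C /\ forall n, / rbin b n <= C * Rpower (INR n) (1 - b).
Proof.
  intros Hb. destruct (rbin_asymp b Hb) as [g [Hg0 Hg]].
  pose proof (Un_cv_div _ _ _ _ (Un_cv_const 1) Hg ltac:(lra)) as Hi.
  destruct (Un_cv_bounded _ _ Hi) as [C [HC0 HC]].
  exists C. split; auto. intros n. specialize (HC n). cbv beta in HC.
  pose proof (rbin_pos b n Hb). pose proof (Rpower_pos (INR n) (1 - b)).
  apply (Rle_trans _ _ _ (Rle_abs _)) in HC.
  apply (Rmult_le_compat_r (Rpower (INR n) (1 - b))) in HC; [|lra].
  replace (1 / (rbin b n * Rpower (INR n) (1 - b)) * Rpower (INR n) (1 - b))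
    with (/ rbin b n) in HC by (field; lra).
  exact HC.
Qed.

(** The hockey-stick identity; it evaluates the sums that bound the mass near 0. *)
Lemma sum_rbin a n : 0 < a -> sum_f_R0 (rbin a) n = rbin (a + 1) n.
Proof.
  intros Ha. induction n as [|n IH]; [reflexivity|].
  rewrite tech5, IH, !rbin_succ by auto. cbn [rbin].
  pose proof (INR_S_pos n). rewrite (S_INR n) in *. field. lra.
Qed.

(** * From local limits to distribution functions *)

(** A substitute for Riemann sums: every term is compared with the increment of F over its own cell,
    the increments telescope, and the errors add up. *)
Lemma telescope_error (p F : nat -> R) d A m :
  (forall i, (A < i <= A + m)%nat -> Rabs (p i - (F i - F (i - 1)%nat)) <= d) ->
  Rabs (sum_f_R0 p (A + m) - sum_f_R0 p A - (F (A + m)%nat - F A)) <= INR m * d.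
Proof.
  induction m as [|m IH]; intros H.
  - rewrite Nat.add_0_r. simpl. rewrite Rmult_0_l.
    replace (_ - _ - _) with 0 by ring. rewrite Rabs_R0. lra.
  - specialize (IH (fun i Hi => H i ltac:(lia))).
    specialize (H (A + S m)%nat ltac:(lia)).
    rewrite Nat.add_succ_r in *. rewrite tech5, S_INR.
    replace (S (A + m) - 1)%nat with (A + m)%nat in H by lia.
    apply Rabs_le_between in IH, H. apply Rabs_le_between. lra.
Qed.

Definition floor_nat (y : R) : nat := Z.to_nat (Int_part y).

Lemma floor_nat_spec y : 0 <= y -> INR (floor_nat y) <= y < INR (floor_nat y) + 1.
Proof.
  intros Hy. destruct (base_Int_part y) as [H1 H2].
  assert (H : (0 <= Int_part y)%Z).
  { apply Z.lt_pred_le. apply lt_IZR. simpl. lra. }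
  unfold floor_nat. rewrite INR_IZR_INZ, Z2Nat.id by auto. lra.
Qed.

Lemma Un_cv_eventually u l eps :
  Un_cv u l -> 0 < eps -> exists n0, forall n, (n0 <= n)%nat -> Rabs (u n - l) <= eps.
Proof.
  intros H He. destruct (H eps He) as [n0 Hn]. exists n0. intros n Hle.
  specialize (Hn n Hle). unfold Rdist in Hn. lra.
Qed.

(** [P n] holds point masses, [h n] is the mesh, [phi] the limit density up to its constant, [Phi]
    an antiderivative. Near 0, where [phi] may be unbounded, the mass is controlled by the tail
    hypothesis; beyond, the local limit, the mean value theorem and uniform continuity of [phi]
    match each mass with an increment of [Phi]. The margin x' > x leaves room for cutoffs
    [INR (M n) * h n] slightly above x. *)
Lemma cdf_of_local_limit (P : nat -> nat -> R) (h : nat -> R) (phi Phi : R -> R)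
  (x x' : R) (M : nat -> nat) (n1 : nat) :
  0 < x < x' ->
  (forall n, (n1 <= n)%nat -> 0 < h n) ->
  Un_cv h 0 ->
  (forall eps, 0 < eps -> exists al, 0 < al /\ exists n0, forall n m, (n0 <= n)%nat ->
     INR m * h n <= al -> Rabs (sum_f_R0 (P n) m) <= eps) ->
  (forall al eps, 0 < al -> 0 < eps -> exists n0, forall n i, (n0 <= n)%nat ->
     al <= INR i * h n <= x' -> Rabs (P n i - h n * phi (INR i * h n)) <= eps * h n) ->
  (forall y, 0 < y <= x' -> continuity_pt phi y) ->
  (forall y, 0 < y <= x' -> derivable_pt_lim Phi y (phi y)) ->
  (forall eps, 0 < eps -> exists al, 0 < al /\
     forall y, 0 <= y <= al -> Rabs (Phi y - Phi 0) <= eps) ->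
  Un_cv (fun n => INR (M n) * h n) x ->
  Un_cv (fun n => sum_f_R0 (P n) (M n)) (Phi x - Phi 0).
Proof.
  intros Hx Hh Hh0 Htail Hloc Hcont Hder Hright HM.
  (* The budget: one eps each for the mass near 0, for [Phi] near 0 and for [Phi] near x; 2 eps h
     per cell, over a total length of at most x'. *)
  assert (Main : forall eps, 0 < eps -> exists n0, forall n, (n0 <= n)%nat ->
    Rabs (sum_f_R0 (P n) (M n) - (Phi x - Phi 0)) <= eps * (3 + 2 * x')).
  2:{ intros eps He.
      destruct (Main (eps / (2 * (3 + 2 * x')))) as [n0 H0];
        [apply Rdiv_lt_0_compat; lra|].
      exists n0. intros n Hn. unfold Rdist. apply Rle_lt_trans with (1 := H0 n Hn).
      replace (eps / (2 * (3 + 2 * x')) * (3 + 2 * x')) with (eps / 2) by (field; lra). lra. }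
  intros eps He.
  destruct (Htail eps He) as [al1 [Hal1 [n2 H2]]].
  destruct (Hright eps He) as [al2 [Hal2 H3]].
  (* The bound x / 4 keeps the splitting index A below [M n]. *)
  set (al := Rmin (Rmin al1 al2) (x / 4)).
  assert (Hal : 0 < al <= al1 /\ al <= al2 /\ al <= x / 4).
  { unfold al. repeat split; repeat apply Rmin_pos; try lra;
      unfold Rmin; repeat destruct Rle_dec; lra. }
  (* The interval starts at al / 2 because rounding puts [INR A * h n] anywhere between al / 2 and
     al. *)
  assert (Hcomp : compact (fun y => al / 2 <= y <= x')) by apply compact_P3.
  destruct (Heine phi _ Hcomp (fun y Hy => Hcont y ltac:(lra)) (mkposreal eps He))
    as [[dl Hdl] Hunif]. simpl in Hunif.
  destruct (Hloc (al / 2) eps ltac:(lra) He) as [n3 H4].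
  assert (Hcx : continuity_pt Phi x).
  { apply derivable_continuous_pt. exists (phi x). apply Hder; lra. }
  destruct (Un_cv_eventually _ _ eps (continuity_seq Phi _ x Hcx HM) He) as [n4 H5].
  destruct (Un_cv_eventually _ _ (Rmin (x / 4) (x' - x)) HM) as [n5 H6];
    [apply Rmin_pos; lra|].
  destruct (Un_cv_eventually _ _ (Rmin (al / 2) (dl / 2)) Hh0) as [n6 H7];
    [apply Rmin_pos; lra|].
  exists (n1 + n2 + n3 + n4 + n5 + n6)%nat. intros n Hn.
  specialize (Hh n ltac:(lia)). specialize (H5 n ltac:(lia)).
  specialize (H6 n ltac:(lia)). specialize (H7 n ltac:(lia)).
  pose proof (Rmin_l (x / 4) (x' - x)). pose proof (Rmin_r (x / 4) (x' - x)).
  pose proof (Rmin_l (al / 2) (dl / 2)). pose proof (Rmin_r (al / 2) (dl / 2)).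
  apply Rabs_le_between in H6, H7.
  set (A := floor_nat (al / h n)).
  assert (HA : al / 2 <= INR A * h n <= al).
  { destruct (floor_nat_spec (al / h n)) as [Ha Hb]; [apply Rlt_le, Rdiv_lt_0_compat; lra|].
    fold A in Ha, Hb.
    apply (Rmult_le_compat_r (h n)) in Ha; [|lra].
    apply (Rmult_lt_compat_r (h n)) in Hb; [|lra].
    replace (al / h n * h n) with al in * by (field; lra). lra. }
  assert (HAM : (A <= M n)%nat).
  { apply INR_le. apply Rmult_le_reg_r with (h n); lra. }
  assert (Hsum : Rabs (sum_f_R0 (P n) (M n) - sum_f_R0 (P n) A
                   - (Phi (INR (M n) * h n) - Phi (INR A * h n)))
                 <= INR (M n - A) * (2 * eps * h n)).
  { replace (M n) with (A + (M n - A))%nat at 1 2 by lia.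
    apply (telescope_error (P n) (fun i => Phi (INR i * h n)) (2 * eps * h n)).
    intros i Hi. replace (A + (M n - A))%nat with (M n) in Hi by lia.
    assert (Hi1 : INR A * h n <= INR (i - 1) * h n).
    { apply Rmult_le_compat_r; [lra|]. apply le_INR. lia. }
    assert (Hi2 : INR i * h n <= INR (M n) * h n).
    { apply Rmult_le_compat_r; [lra|]. apply le_INR. lia. }
    assert (Hi3 : INR i * h n = INR (i - 1) * h n + h n).
    { replace i with (S (i - 1)) at 1 by lia. rewrite S_INR. ring. }
    destruct (MVT_cor2 Phi phi (INR (i - 1) * h n) (INR i * h n)) as [c [Hc1 Hc2]];
      [lra|intros c Hc; apply Hder; lra|].
    rewrite Hc1, Hi3.
    replace (INR (i - 1) * h n + h n - INR (i - 1) * h n) with (h n) by ring.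
    specialize (H4 n i ltac:(lia) ltac:(lra)).
    assert (Hu : Rabs (phi (INR i * h n) - phi c) < eps).
    { apply Hunif; try lra. rewrite Rabs_pos_eq; lra. }
    replace (P n i - phi c * h n)
      with ((P n i - h n * phi (INR i * h n)) + h n * (phi (INR i * h n) - phi c)) by ring.
    eapply Rle_trans; [apply Rabs_triang|].
    rewrite Rabs_mult, (Rabs_pos_eq (h n)) by lra.
    apply (Rmult_lt_compat_l (h n)) in Hu; lra. }
  specialize (H2 n A ltac:(lia) ltac:(lra)).
  specialize (H3 (INR A * h n) ltac:(lra)).
  assert (Hlen : INR (M n - A) * (2 * eps * h n) <= 2 * eps * x').
  { replace (INR (M n - A) * (2 * eps * h n)) with (2 * eps * (INR (M n - A) * h n)) by ring.
    apply Rmult_le_compat_l; [lra|]. apply Rle_trans with (INR (M n) * h n); [|lra].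
    apply Rmult_le_compat_r; [lra|]. apply le_INR. lia. }
  apply Rabs_le_between in H2, H3, H5, Hsum. apply Rabs_le_between. lra.
Qed.

(** How the unknown constant is identified: r H is a limit of distribution functions, hence at most
    1, and no mass escaping brings it within eps of 1; H itself tends to 1 because the density is
    normalized. *)
Lemma scale_one (r : R) (H : R -> R) (S : R -> Prop) :
  (forall x, S x -> r * H x <= 1) ->
  (forall eps, 0 < eps -> exists x0, S x0 /\ forall x, x0 <= x -> S x -> 1 - eps <= r * H x) ->
  (forall eps, 0 < eps -> exists x0, S x0 /\ forall x, x0 <= x -> S x -> Rabs (H x - 1) <= eps) ->
  r = 1.
Proof.
  intros H1 H2 H3.
  assert (K : forall eps, 0 < eps -> exists y, Rabs (y - 1) <= eps /\ 1 - eps <= r * y <= 1).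
  { intros eps He. destruct (H2 eps He) as [x0 [S0 K0]]. destruct (H3 eps He) as [x1 [S1 K1]].
    (* At the larger of the two thresholds both eventual bounds hold. *)
    destruct (Rle_lt_dec x0 x1) as [Hle|Hlt].
    - exists (H x1). split; [apply K1; auto; lra|]. split; [apply K0|apply H1]; auto.
    - exists (H x0). split; [apply K1; auto; lra|]. split; [apply K0; auto; lra|apply H1; auto]. }
  (* The tolerance 1/2 only yields r > 0. The final tolerance d depends on r, since |r - 1| <= d (1
     + r). *)
  destruct (K (1 / 2) ltac:(lra)) as [y [Hy1 Hy2]]. apply Rabs_le_between in Hy1.
  assert (Hr : 0 < r) by nra.
  apply cond_eq. intros eps He.
  destruct (K (Rmin (1 / 2) (eps / (2 * (2 + r)))))  as [z [Hz1 Hz2]].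
  { apply Rmin_pos; [lra|]. apply Rdiv_lt_0_compat; lra. }
  set (d := Rmin _ _) in *.
  assert (Hd : d * (2 + r) <= eps / 2).
  { apply Rle_trans with (eps / (2 * (2 + r)) * (2 + r)).
    - apply Rmult_le_compat_r; [lra|]. apply Rmin_r.
    - apply Req_le. field. lra. }
  assert (Hd0 : 0 <= d) by nra.
  apply Rabs_le_between in Hz1. apply Rabs_def1; nra.
Qed.

(** * Distribution functions of the number of descendants *)

Lemma prob_ext k n E E' :
  (forall t, In t (trees k n) -> E t = E' t) -> prob k n E = prob k n E'.
Proof. intros H. unfold prob. now rewrite (filter_ext_in _ _ _ H). Qed.

Lemma ndesc_pos k n j t : (1 <= j <= n)%nat -> In t (trees k n) -> (1 <= ndesc k t j)%nat.
Proof.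
  intros Hj Ht. apply trees_valid in Ht. destruct Ht as [Hv Hl].
  apply weight_hits; auto; lia.
Qed.

(** Every cutoff in the limit laws amounts, for m >= 1, to m <= M + 1; a node being its own
    descendant, smaller m do not occur. The urn law is that of X - 1, whence the summation up to
    M. *)
Lemma prob_ndesc_le k n j M (E : nat -> bool) :
  (1 <= k)%nat -> (1 <= j <= n)%nat ->
  (forall m, (1 <= m)%nat -> E m = Nat.leb m (S M)) ->
  prob k n (fun t => E (ndesc k t j)) =
  sum_f_R0 (polya (INR k / (INR k + 1)) (INR j - 1 + 2 / (INR k + 1)) (n - j)) M.
Proof.
  intros Hk Hj HE.
  rewrite (prob_ext _ _ _ (fun t => Nat.leb (ndesc k t j) (S M)))
    by (intros t Ht; apply HE; eapply ndesc_pos; eauto).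
  clear E HE. induction M as [|M IH].
  - simpl sum_f_R0. rewrite <- ndesc_law by auto. apply prob_ext. intros t Ht.
    apply (ndesc_pos k n j) in Ht; auto.
    destruct (Nat.leb_spec (ndesc k t j) 1); destruct (Nat.eqb_spec (ndesc k t j) 1); lia.
  - rewrite tech5, <- IH, <- ndesc_law by auto. unfold prob.
    rewrite <- Rdiv_plus_distr, <- plus_INR. do 2 f_equal.
    induction (trees k n) as [|t l IHl]; auto. cbn [filter].
    destruct (Nat.leb_spec (ndesc k t j) (S (S M)));
    destruct (Nat.leb_spec (ndesc k t j) (S M));
    destruct (Nat.eqb_spec (ndesc k t j) (S (S M))); try lia; cbn [length]; lia.
Qed.

Lemma prob_ndesc_none k n j (E : nat -> bool) :
  (1 <= j <= n)%nat -> (forall m, (1 <= m)%nat -> E m = false) ->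
  prob k n (fun t => E (ndesc k t j)) = 0.
Proof.
  intros Hj HE. rewrite (prob_ext _ _ _ (fun _ => false))
    by (intros t Ht; apply HE; eapply ndesc_pos; eauto).
  unfold prob. replace (length (filter _ (trees k n))) with O.
  - unfold Rdiv. apply Rmult_0_l.
  - induction (trees k n); auto.
Qed.

Lemma prob_ndesc_all k n j (E : nat -> bool) :
  (1 <= j <= n)%nat -> (forall m, (m <= n)%nat -> E m = true) ->
  prob k n (fun t => E (ndesc k t j)) = 1.
Proof.
  intros Hj HE. rewrite (prob_ext _ _ _ (fun _ => true)).
  - unfold prob. replace (filter _ (trees k n)) with (trees k n).
    + pose proof (trees_length_pos k n). field. lra.
    + symmetry. apply forallb_filter_id, forallb_forall; auto.
  - intros t Ht. apply HE. apply trees_valid in Ht. destruct Ht as [_ <-].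
    unfold ndesc. rewrite <- (length_seq (length t) 1) at 2. apply filter_length_le.
Qed.

Lemma Rle_bool_spec a b : reflect (a <= b) (Rle_bool a b).
Proof. unfold Rle_bool. destruct (Rle_dec a b); now constructor. Qed.

(** Since s <= x, the floor of x / s is at least 1, so the truncated subtraction, which accounts for
    the urn law being that of X - 1, is exact. *)
Lemma scaled_cutoff (s x : R) (m : nat) :
  0 < s <= x -> Rle_bool (s * INR m) x = Nat.leb m (S (floor_nat (x / s) - 1)).
Proof.
  intros Hs.
  assert (H1 : 1 <= x / s).
  { apply Rmult_le_reg_r with s; [lra|]. replace (x / s * s) with x by (field; lra). lra. }
  destruct (floor_nat_spec (x / s)) as [Ha Hb]; [lra|].
  assert (H2 : (1 <= floor_nat (x / s))%nat).
  { apply Nat.lt_succ_r. apply INR_lt. rewrite (S_INR (floor_nat _)). change (INR 1) with 1. lra. }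
  replace (S (floor_nat (x / s) - 1)) with (floor_nat (x / s)) by lia.
  assert (Hxs : x / s * s = x) by (field; lra).
  destruct (Rle_bool_spec (s * INR m) x) as [H|H]; destruct (Nat.leb_spec m (floor_nat (x / s))) as [H'|H'];
    auto; exfalso.
  - apply le_INR in H'. rewrite S_INR in H'. nra.
  - apply H. apply le_INR in H'. nra.
Qed.

(** Here s is the scale appearing in the event and h the equivalent mesh of the local limit. In the
    scale s the cutoff lies between x - 2 s and x: one s is lost to the floor, one to the shift by
    1. *)
Lemma scaled_cutoff_cv (s h : nat -> R) (x : R) n0 :
  0 < x -> (forall n, (n0 <= n)%nat -> 0 < s n) -> Un_cv s 0 ->
  Un_cv (fun n => h n / s n) 1 ->
  Un_cv (fun n => INR (floor_nat (x / s n) - 1) * h n) x.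
Proof.
  intros Hx Hs Hs0 Hh.
  assert (H : Un_cv (fun n => INR (floor_nat (x / s n) - 1) * s n) x).
  { destruct (Un_cv_eventually _ _ x Hs0 Hx) as [n1 H1].
    apply Un_cv_squeeze_loc with (n0 := (n0 + n1)%nat)
      (u := fun n => x - 2 * s n) (w := fun _ => x).
    - intros n Hn. specialize (Hs n ltac:(lia)). specialize (H1 n ltac:(lia)).
      rewrite Rminus_0_r, Rabs_pos_eq in H1 by lra.
      assert (H2 : 1 <= x / s n).
      { apply Rmult_le_reg_r with (s n); [lra|].
        replace (x / s n * s n) with x by (field; lra). lra. }
      destruct (floor_nat_spec (x / s n)) as [Ha Hb]; [lra|].
      assert (H3 : (1 <= floor_nat (x / s n))%nat).
      { apply Nat.lt_succ_r. apply INR_lt. rewrite (S_INR (floor_nat _)). change (INR 1) with 1. lra. }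
      rewrite minus_INR by lia. simpl INR at 1.
      assert (Hxs : x / s n * s n = x) by (field; lra). simpl INR. nra.
    - replace x with (x - 2 * 0) at 1 by ring.
      apply CV_minus; [apply Un_cv_const|]. apply CV_mult; auto. apply Un_cv_const.
    - apply Un_cv_const. }
  replace x with (x * 1) at 1 by ring.
  apply Un_cv_ext_loc with (n0 := n0)
    (u := fun n => INR (floor_nat (x / s n) - 1) * s n * (h n / s n)).
  - intros n Hn. specialize (Hs n Hn). field. lra.
  - apply CV_mult; auto.
Qed.

(** * Local limits and tails of the urn law *)

(** A power is monotone in one direction or the other according to the sign of p; the sum of both
    end values covers either case. *)
Lemma Rpower_between al x y p :
  0 < al -> al <= y <= x -> Rpower y p <= Rpower al p + Rpower x p.
Proof.
  intros Hal Hy. pose proof (Rpower_pos al p). pose proof (Rpower_pos x p).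
  destruct (Rle_lt_dec 0 p) as [Hp|Hp].
  - assert (Rpower y p <= Rpower x p) by (apply Rle_Rpower_l; lra). lra.
  - assert (Rpower y p <= Rpower al p); [|lra].
    replace p with (- - p) by ring. rewrite !(Rpower_Ropp _ (- p)).
    apply Rinv_le_contravar; [apply Rpower_pos|]. apply Rle_Rpower_l; lra.
Qed.

(** The mass near 0 will be at most c times the a-th power of a rescaled m + 1; the factor 2 absorbs
    the + 1. The bound 1/4 keeps m below N / 2 in the Beta case. *)
Lemma Rpower_small c a eps :
  0 < a -> 0 < c -> 0 < eps -> exists al, 0 < al <= 1 / 4 /\ c * Rpower (2 * al) a <= eps.
Proof.
  intros Ha Hc He. set (z := Rpower (eps / c) (/ a) / 2).
  assert (Hz : 0 < z) by (apply Rdiv_lt_0_compat; [apply Rpower_pos|lra]).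
  exists (Rmin (1 / 4) z).
  assert (Hm : 0 < Rmin (1 / 4) z) by (apply Rmin_pos; lra).
  split; [split; [auto|apply Rmin_l]|].
  apply Rle_trans with (c * Rpower (2 * z) a).
  - apply Rmult_le_compat_l; [lra|]. apply Rle_Rpower_l; [lra|].
    split; [lra|]. apply Rmult_le_compat_l; [lra|]. apply Rmin_r.
  - unfold z. replace (2 * (Rpower (eps / c) (/ a) / 2)) with (Rpower (eps / c) (/ a)) by field.
    rewrite Rpower_mult, Rinv_l, Rpower_1 by (try apply Rdiv_lt_0_compat; lra).
    apply Req_le. field. lra.
Qed.

Lemma rbin_le_upper_S a :
  0 < a -> exists C, 0 < C /\ forall m, rbin (a + 1) m <= C * Rpower (INR m + 1) a.
Proof.
  intros Ha. destruct (rbin_upper (a + 1) ltac:(lra)) as [C [HC0 HC]].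
  exists C. split; auto. intros m.
  apply Rle_trans with (rbin (a + 1) (S m)).
  - rewrite <- !sum_rbin, tech5 by auto. pose proof (rbin_pos a (S m) Ha). lra.
  - specialize (HC (S m)). rewrite S_INR in HC.
    now replace (a + 1 - 1) with a in HC by ring.
Qed.

Lemma sum_polya_nonneg a b N m : 0 < a -> 0 < b -> 0 <= sum_f_R0 (polya a b N) m.
Proof. intros. apply cond_pos_sum. intros. now apply polya_nonneg. Qed.

(** For i <= N / 2 the factor [rbin b (N - i)] is at most a constant times N^(b-1), so the mass is
    at most a constant times N^(-a) times the sum of [rbin a i], which is of order ((m + 1) /
    N)^a. *)
Lemma polya_left_tail a b :
  0 < a -> 0 < b -> forall eps, 0 < eps ->
  exists al, 0 < al /\ exists n0, forall N m, (n0 <= N)%nat ->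
    INR m * / INR N <= al -> sum_f_R0 (polya a b N) m <= eps.
Proof.
  intros Ha Hb eps He.
  destruct (rbin_upper b Hb) as [Cb [Hb0 HCb]].
  destruct (rbin_lower (a + b) ltac:(lra)) as [D [HD0 HD]].
  destruct (rbin_le_upper_S a Ha) as [C [HC0 HC]].
  (* K bounds (1 - i/N)^(b-1) for 1 - i/N in [1/2, 1], whatever the sign of b - 1. *)
  set (K := Rpower (1 / 2) (b - 1) + 1).
  assert (HK : 0 < K) by (pose proof (Rpower_pos (1 / 2) (b - 1)); unfold K; lra).
  destruct (Rpower_small (Cb * K * D * C) a eps Ha) as [al [Hal1 Hal2]]; auto.
  { repeat apply Rmult_lt_0_compat; auto. }
  exists al. split; [lra|].
  destruct (Un_cv_eventually _ _ al Un_cv_inv_INR ltac:(lra)) as [n0 Hn0].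
  exists (S n0). intros N m HN Hm.
  specialize (Hn0 N ltac:(lia)). rewrite Rminus_0_r in Hn0.
  apply (Rle_trans _ _ _ (Rle_abs _)) in Hn0.
  assert (HN0 : 0 < INR N) by (apply lt_0_INR; lia).
  assert (HmN : INR m <= INR N / 2).
  { apply (Rmult_le_compat_r (INR N)) in Hm; [|lra].
    replace (INR m * / INR N * INR N) with (INR m) in Hm by (field; lra). nra. }
  apply Rle_trans with (sum_f_R0 (fun i => rbin a i * (Cb * K * D * Rpower (INR N) (- a))) m).
  - apply sum_Rle. intros i Hi.
    assert (Hi' : INR i <= INR m) by (apply le_INR; lia).
    assert (HiN : (i <= N)%nat) by (apply INR_le; lra).
    unfold polya. destruct (Nat.leb_spec i N); [|lia].
    unfold Rdiv. rewrite Rmult_assoc. apply Rmult_le_compat_l; [apply Rlt_le, rbin_pos; lra|].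
    apply Rle_trans with
      ((Cb * (K * Rpower (INR N) (b - 1))) * (D * Rpower (INR N) (1 - (a + b)))).
    + apply Rmult_le_compat; auto.
      * apply Rlt_le, rbin_pos; lra.
      * apply Rlt_le, Rinv_0_lt_compat, rbin_pos; lra.
      * eapply Rle_trans; [apply HCb|]. apply Rmult_le_compat_l; [lra|].
        rewrite minus_INR by auto.
        replace (INR N - INR i) with ((INR N - INR i) / INR N * INR N) by (field; lra).
        rewrite <- Rpower_mult_distr by (try apply Rdiv_lt_0_compat; lra).
        apply Rmult_le_compat_r; [apply Rlt_le, Rpower_pos|].
        apply Rle_trans with (Rpower (1 / 2) (b - 1) + Rpower 1 (b - 1));
          [|rewrite Rpower_base_1; unfold K; lra].
        apply Rpower_between; [lra|]. pose proof (pos_INR i).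
        split; apply Rmult_le_reg_r with (INR N); auto;
          replace ((INR N - INR i) / INR N * INR N) with (INR N - INR i) by (field; lra); lra.
    + apply Req_le. replace (- a) with (b - 1 + (1 - (a + b))) by ring.
      rewrite Rpower_plus. ring.
  - rewrite <- scal_sum, sum_rbin by auto.
    apply Rle_trans with ((Cb * K * D * Rpower (INR N) (- a)) * (C * Rpower (INR m + 1) a)).
    + apply Rmult_le_compat_l; auto.
      apply Rlt_le. repeat apply Rmult_lt_0_compat; auto. apply Rpower_pos.
    + refine (Rle_trans _ _ _ _ Hal2). pose proof (pos_INR m).
      replace (Cb * K * D * Rpower (INR N) (- a) * (C * Rpower (INR m + 1) a))
        with (Cb * K * D * C * Rpower ((INR m + 1) / INR N) a).
      * apply Rmult_le_compat_l; [apply Rlt_le; repeat apply Rmult_lt_0_compat; auto|].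
        apply Rle_Rpower_l; [lra|]. split; [apply Rdiv_lt_0_compat; lra|].
        unfold Rdiv. lra.
      * rewrite Rpower_div, Rpower_Ropp by lra. unfold Rdiv. ring.
Qed.

Lemma prod_close B eps :
  0 <= B -> 0 < eps -> exists d, 0 < d /\ forall x x0 y y0,
    Rabs x0 <= B -> Rabs y0 <= B -> Rabs (x - x0) <= d -> Rabs (y - y0) <= d ->
    Rabs (x * y - x0 * y0) <= eps.
Proof.
  intros HB He. exists (Rmin 1 (eps / (2 * B + 1))).
  assert (Hd : 0 < eps / (2 * B + 1)) by (apply Rdiv_lt_0_compat; lra).
  split; [apply Rmin_pos; lra|]. intros x x0 y y0 Hx0 Hy0 Hx Hy.
  set (d := Rmin _ _) in *.
  assert (Hd1 : d <= 1) by apply Rmin_l.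
  assert (Hd2 : d * (2 * B + 1) <= eps).
  { apply Rle_trans with (eps / (2 * B + 1) * (2 * B + 1)).
    - apply Rmult_le_compat_r; [lra|]. apply Rmin_r.
    - apply Req_le. field. lra. }
  replace (x * y - x0 * y0) with ((x - x0) * (y - y0) + (x - x0) * y0 + x0 * (y - y0)) by ring.
  pose proof (Rabs_pos (x - x0)). pose proof (Rabs_pos (y - y0)).
  pose proof (Rabs_pos x0). pose proof (Rabs_pos y0).
  eapply Rle_trans; [apply Rabs_triang|].
  eapply Rle_trans; [apply Rplus_le_compat_r, Rabs_triang|].
  rewrite !Rabs_mult. nra.
Qed.

(** Each [rbin] is a convergent prefactor times a power, and the powers combine to y^(a-1)
    (1-y)^(b-1) / N with y = i / N. Keeping y in [al, x] with x < 1 sends both i and N - i to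
    infinity with N, hence the uniformity. *)
Lemma polya_local_beta a b ga gb gab :
  0 < a -> 0 < b -> 0 < ga -> 0 < gb -> 0 < gab ->
  Un_cv (fun n => rbin a n * Rpower (INR n) (1 - a)) ga ->
  Un_cv (fun n => rbin b n * Rpower (INR n) (1 - b)) gb ->
  Un_cv (fun n => rbin (a + b) n * Rpower (INR n) (1 - (a + b))) gab ->
  forall x, 0 < x < 1 -> forall al eps, 0 < al -> 0 < eps ->
  exists n0, forall N i, (n0 <= N)%nat -> al <= INR i * / INR N <= x ->
    Rabs (polya a b N i
          - / INR N * (ga * gb / gab * (Rpower (INR i * / INR N) (a - 1)
                                    * Rpower (1 - INR i * / INR N) (b - 1)))) <= eps * / INR N.
Proof.
  intros Ha Hb Hga Hgb Hgab Ca Cb Cab x Hx al eps Hal He.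
  (* B bounds y^(a-1) (1-y)^(b-1) on [al, x]. *)
  set (B := (Rpower al (a - 1) + Rpower x (a - 1)) * (Rpower (1 - x) (b - 1) + 1)).
  assert (HB : 0 < B).
  { unfold B. pose proof (Rpower_pos al (a - 1)). pose proof (Rpower_pos x (a - 1)).
    pose proof (Rpower_pos (1 - x) (b - 1)). apply Rmult_lt_0_compat; lra. }
  assert (He' : 0 < eps / B) by (apply Rdiv_lt_0_compat; auto).
  assert (H1g : 0 < 1 / gab) by (apply Rdiv_lt_0_compat; lra).
  assert (Hgg : 0 < ga * gb) by (apply Rmult_lt_0_compat; lra).
  destruct (prod_close (ga * gb + 1 / gab) (eps / B)) as [d1 [Hd1 K1]]; [lra|auto|].
  destruct (prod_close (ga + gb) d1) as [d2 [Hd2 K2]]; [lra|auto|].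
  pose proof (Un_cv_div _ _ _ _ (Un_cv_const 1) Cab ltac:(lra)) as Ci.
  destruct (Un_cv_eventually _ _ d2 Ca Hd2) as [n1 H1].
  destruct (Un_cv_eventually _ _ d2 Cb Hd2) as [n2 H2].
  destruct (Un_cv_eventually _ _ d1 Ci Hd1) as [n3 H3].
  (* N beyond m1 and m2 gives i >= al N >= n1 and N - i >= (1 - x) N >= n2. *)
  destruct (INR_unbounded (INR n1 / al)) as [m1 Hm1].
  destruct (INR_unbounded (INR n2 / (1 - x))) as [m2 Hm2].
  exists (S (m1 + m2 + n3)). intros N i HN Hi.
  assert (HN0 : 0 < INR N) by (apply lt_0_INR; lia).
  assert (Hm1N : INR m1 <= INR N) by (apply le_INR; lia).
  assert (Hm2N : INR m2 <= INR N) by (apply le_INR; lia).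
  set (y := INR i * / INR N) in *.
  assert (Hy : INR i = y * INR N) by (unfold y; field; lra).
  assert (Hlo : al * INR N <= INR i) by (rewrite Hy; apply Rmult_le_compat_r; lra).
  assert (Hhi : INR i <= x * INR N) by (rewrite Hy; apply Rmult_le_compat_r; lra).
  assert (HxN : 0 < (1 - x) * INR N) by (apply Rmult_lt_0_compat; lra).
  assert (HiN : (i < N)%nat) by (apply INR_lt; lra).
  assert (Hin1 : (n1 <= i)%nat).
  { apply INR_le. apply Rle_trans with (al * INR N); auto.
    replace (INR n1) with (al * (INR n1 / al)) by (field; lra).
    apply Rmult_le_compat_l; lra. }
  assert (Hin2 : (n2 <= N - i)%nat).
  { apply INR_le. rewrite minus_INR by lia. apply Rle_trans with ((1 - x) * INR N); [|lra].
    replace (INR n2) with ((1 - x) * (INR n2 / (1 - x))) by (field; lra).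
    apply Rmult_le_compat_l; lra. }
  specialize (H1 i Hin1). specialize (H2 (N - i)%nat Hin2). specialize (H3 N ltac:(lia)).
  cbv beta in H1, H2, H3.
  set (u := rbin a i * Rpower (INR i) (1 - a)) in *.
  set (v := rbin b (N - i) * Rpower (INR (N - i)) (1 - b)) in *.
  set (w := rbin (a + b) N * Rpower (INR N) (1 - (a + b))) in *.
  assert (Ha1 : rbin a i = u * Rpower (INR i) (a - 1)).
  { unfold u. rewrite Rmult_assoc, Rpower_mult_opp by ring. ring. }
  assert (Hb1 : rbin b (N - i) = v * Rpower (INR (N - i)) (b - 1)).
  { unfold v. rewrite Rmult_assoc, Rpower_mult_opp by ring. ring. }
  assert (Hw : 0 < w).
  { apply Rmult_lt_0_compat; [apply rbin_pos; lra|apply Rpower_pos]. }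
  assert (Hab1 : / rbin (a + b) N = 1 / w * Rpower (INR N) (1 - (a + b))).
  { unfold w. pose proof (rbin_pos (a + b) N ltac:(lra)).
    pose proof (Rpower_pos (INR N) (1 - (a + b))). field. lra. }
  assert (HNi : INR (N - i) = (1 - y) * INR N) by (rewrite minus_INR by lia; rewrite Hy; ring).
  assert (Heq : polya a b N i
    = / INR N * (u * v * (1 / w)) * (Rpower y (a - 1) * Rpower (1 - y) (b - 1))).
  { unfold polya. destruct (Nat.leb_spec i N); [|lia].
    unfold Rdiv at 1. rewrite Ha1, Hb1, Hab1, HNi, Hy.
    rewrite <- !Rpower_mult_distr by lra.
    replace (/ INR N) with (Rpower (INR N) (a - 1) * Rpower (INR N) (b - 1)
                            * Rpower (INR N) (1 - (a + b))); [ring|].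
    rewrite <- !Rpower_plus.
    replace (a - 1 + (b - 1) + (1 - (a + b))) with (Ropp 1) by ring.
    rewrite Rpower_Ropp, Rpower_1; auto. }
  rewrite Heq.
  replace (_ - _) with (/ INR N * (Rpower y (a - 1) * Rpower (1 - y) (b - 1))
                        * (u * v * (1 / w) - ga * gb * (1 / gab))) by (field; lra).
  pose proof (Rpower_pos y (a - 1)) as P1. pose proof (Rpower_pos (1 - y) (b - 1)) as P2.
  pose proof (Rinv_0_lt_compat _ HN0) as P3.
  rewrite !Rabs_mult, !(Rabs_pos_eq (Rpower _ _)), (Rabs_pos_eq (/ INR N)) by lra.
  rewrite (Rmult_comm eps), Rmult_assoc. apply Rmult_le_compat_l; [lra|].
  apply Rle_trans with (B * (eps / B)); [|apply Req_le; field; lra].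
  apply Rmult_le_compat; try apply Rabs_pos.
  - apply Rmult_le_pos; lra.
  - apply Rmult_le_compat; try lra.
    + apply Rpower_between; lra.
    + apply Rle_trans with (Rpower (1 - x) (b - 1) + Rpower 1 (b - 1));
        [apply Rpower_between; lra|]. rewrite Rpower_base_1. lra.
  - apply K1; auto.
    + rewrite Rabs_pos_eq; lra.
    + rewrite Rabs_pos_eq; lra.
    + apply K2; auto; rewrite Rabs_pos_eq; lra.
Qed.

(** * Urns whose weight b tends to infinity *)

Lemma rbin_back_ratio_S b N i :
  0 < b -> (S i <= N)%nat ->
  rbin b (N - S i) / rbin b N =
  rbin b (N - i) / rbin b N * ((INR N - INR i) / (INR N - INR (S i) + b)).
Proof.
  intros Hb Hi. pose proof (rbin_S b (N - S i)) as E.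
  replace (S (N - S i)) with (N - i)%nat in E by lia.
  pose proof (rbin_pos b N Hb). pose proof (le_INR _ _ Hi) as Hi'.
  rewrite !minus_INR in E by lia.
  assert (E' : rbin b (N - S i) = rbin b (N - i) * ((INR N - INR i) / (INR N - INR (S i) + b))).
  { apply Rmult_eq_reg_l with (b + (INR N - INR (S i))); [|lra].
    rewrite <- E. field. lra. }
  rewrite E'. field. split; lra.
Qed.

(** Each step back in the index multiplies by 1 - (b-1) / (N - i - 1 + b), which is at most exp (-
    (b-1) / (b + N)). *)
Lemma rbin_back_upper b N i :
  1 <= b -> (i <= N)%nat ->
  rbin b (N - i) / rbin b N <= exp (- (INR i * ((b - 1) / (b + INR N)))).
Proof.
  intros Hb. pose proof (pos_INR N) as HN. induction i as [|i IH]; intros Hi.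
  - rewrite Nat.sub_0_r, Rdiv_diag by (apply Rgt_not_eq, rbin_pos; lra).
    simpl. rewrite Rmult_0_l, Ropp_0, exp_0. lra.
  - rewrite rbin_back_ratio_S by (auto; lra). specialize (IH ltac:(lia)).
    pose proof (le_INR _ _ Hi) as Hi'. rewrite S_INR in *. pose proof (pos_INR i).
    replace (- ((INR i + 1) * ((b - 1) / (b + INR N))))
      with (- (INR i * ((b - 1) / (b + INR N))) + - ((b - 1) / (b + INR N))) by ring.
    rewrite exp_plus. apply Rmult_le_compat; auto.
    + apply Rlt_le, Rdiv_lt_0_compat; apply rbin_pos; lra.
    + apply Rlt_le, Rdiv_lt_0_compat; lra.
    + eapply Rle_trans; [|apply exp_ineq1_le].
      replace ((INR N - INR i) / (INR N - (INR i + 1) + b))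
        with (1 + - ((b - 1) * / (INR N - (INR i + 1) + b))) by (field; lra).
      apply Rplus_le_compat_l, Ropp_le_contravar. unfold Rdiv.
      apply Rmult_le_compat_l; [lra|]. apply Rinv_le_contravar; lra.
Qed.

(** The inverse of a step back is 1 + (b-1) / (N - i), at most exp (b / (N - m)). The bound m on i
    is separate so that this rate stays fixed during the induction. *)
Lemma rbin_back_lower b N m i :
  1 <= b -> (m < N)%nat -> (i <= m)%nat ->
  exp (- (INR i * (b / (INR N - INR m)))) <= rbin b (N - i) / rbin b N.
Proof.
  intros Hb Hm. apply lt_INR in Hm as Hm'. induction i as [|i IH]; intros Hi.
  - rewrite Nat.sub_0_r, Rdiv_diag by (apply Rgt_not_eq, rbin_pos; lra).
    simpl. rewrite Rmult_0_l, Ropp_0, exp_0. lra.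
  - rewrite rbin_back_ratio_S by (lia || lra). specialize (IH ltac:(lia)).
    pose proof (le_INR _ _ Hi) as Hi'. rewrite S_INR in *.
    replace (- ((INR i + 1) * (b / (INR N - INR m))))
      with (- (INR i * (b / (INR N - INR m))) + - (b / (INR N - INR m))) by ring.
    rewrite exp_plus. apply Rmult_le_compat; auto; try (apply Rlt_le, exp_pos).
    rewrite exp_Ropp.
    replace ((INR N - INR i) / (INR N - (INR i + 1) + b))
      with (/ (1 + (b - 1) * / (INR N - INR i))) by (field; lra).
    assert (H0 : 0 <= (b - 1) * / (INR N - INR i)).
    { apply Rmult_le_pos; [lra|]. apply Rlt_le, Rinv_0_lt_compat; lra. }
    apply Rinv_le_contravar; [lra|].
    eapply Rle_trans; [|apply exp_ineq1_le]. apply Rplus_le_compat_l.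
    unfold Rdiv. apply Rmult_le_compat; try lra.
    + apply Rlt_le, Rinv_0_lt_compat; lra.
    + apply Rinv_le_contravar; lra.
Qed.

(** With h = b / (b + N) and y = i h <= x, the two preceding exponents differ from y by relative
    errors of order 1 / b and h, so the quotient is exp (- y) up to a uniformly small error. *)
Lemma rbin_back_exp (b : nat -> R) (N : nat -> nat) n1 :
  (forall n, (n1 <= n)%nat -> 1 <= b n) ->
  Un_cv (fun n => / b n) 0 -> Un_cv (fun n => b n / (b n + INR (N n))) 0 ->
  forall x eps, 0 < x -> 0 < eps -> exists n0, forall n i, (n0 <= n)%nat ->
    INR i * (b n / (b n + INR (N n))) <= x ->
    (i < N n)%nat /\
    Rabs (rbin (b n) (N n - i) / rbin (b n) (N n)
          - exp (- (INR i * (b n / (b n + INR (N n)))))) <= eps.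
Proof.
  intros Hb1 Hb Hh x eps Hx He.
  set (e := Rmin (1 / 2) (eps / (2 * (x + 1)))).
  assert (He0 : 0 < e).
  { apply Rmin_pos; [lra|]. apply Rdiv_lt_0_compat; lra. }
  assert (He1 : e <= 1 / 2) by apply Rmin_l.
  assert (He2 : 2 * (x + 1) * e <= eps).
  { apply Rle_trans with (2 * (x + 1) * (eps / (2 * (x + 1)))).
    - apply Rmult_le_compat_l; [lra|]. apply Rmin_r.
    - apply Req_le. field. lra. }
  assert (Hlim : Un_cv (fun n => b n / (b n + INR (N n)) + x * / b n) (0 + x * 0)).
  { apply CV_plus; auto. apply CV_mult; auto. apply Un_cv_const. }
  destruct (Un_cv_eventually _ _ e Hlim He0) as [n2 H2].
  exists (n1 + n2)%nat. intros n i Hn Hi.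
  specialize (Hb1 n ltac:(lia)). specialize (H2 n ltac:(lia)). cbv beta in H2.
  apply (Rle_trans _ _ _ (Rle_abs _)) in H2.
  pose proof (pos_INR (N n)) as HN. pose proof (pos_INR i) as HI.
  set (c := b n) in *. rename Hb1 into Hc.
  set (H := c + INR (N n)) in *. assert (HH : 0 < H) by (unfold H; lra).
  set (h := c / H) in *. set (y := INR i * h) in *.
  assert (Hh0 : 0 < h) by (apply Rdiv_lt_0_compat; lra).
  assert (Hy0 : 0 <= y) by (apply Rmult_le_pos; lra).
  assert (HcH : c = h * H) by (unfold h; field; lra).
  assert (Hic : 0 < / c) by (apply Rinv_0_lt_compat; lra).
  assert (HiH : INR i = y * / c * H) by (unfold y, h; field; lra).
  assert (Hyc : y * / c <= x * / c) by (apply Rmult_le_compat_r; lra).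
  (* c and i are the fractions h and y / c of H = c + N, so that N - i >= H (1 - e1). *)
  set (e1 := h + x * / c) in *.
  assert (He1' : e1 <= e) by lra.
  assert (HNi : H * (1 - e1) <= INR (N n) - INR i).
  { replace (INR (N n)) with (H - c) by (unfold H; ring). rewrite HcH at 1. rewrite HiH.
    replace (H - h * H - y * / c * H) with (H * (1 - (h + y * / c))) by ring.
    apply Rmult_le_compat_l; [lra|]. unfold e1. lra. }
  assert (HNi0 : 0 < H * (1 - e1)) by (apply Rmult_lt_0_compat; lra).
  assert (HiN : (i < N n)%nat) by (apply INR_lt; lra).
  split; auto.
  pose proof (rbin_back_upper c (N n) i Hc ltac:(lia)) as Up. fold H in Up.
  pose proof (rbin_back_lower c (N n) i i Hc HiN ltac:(lia)) as Lo.
  set (W := rbin c (N n - i) / rbin c (N n)) in *.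
  assert (Hxc : 0 < x * / c) by (apply Rmult_lt_0_compat; lra).
  assert (Hexp : 0 < exp (- y) <= 1).
  { split; [apply exp_pos|]. rewrite <- exp_0. destruct (Req_dec y 0) as [->|Hy].
    - rewrite Ropp_0. lra.
    - left. apply exp_increasing. lra. }
  assert (L : exp (- y) * (1 - 2 * x * e) <= W).
  { refine (Rle_trans _ _ _ _ Lo).
    assert (Hexpo : INR i * (c / (INR (N n) - INR i)) <= y + 2 * x * e).
    { apply Rle_trans with (INR i * (c / (H * (1 - e1)))).
      - apply Rmult_le_compat_l; auto. apply Rmult_le_compat_l; [lra|].
        apply Rinv_le_contravar; auto.
      - replace (INR i * (c / (H * (1 - e1)))) with (y * / (1 - e1)) by (unfold y, h; field; lra).
        apply Rle_trans with (y * (1 + 2 * e)).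
        + apply Rmult_le_compat_l; auto.
          apply Rmult_le_reg_r with (1 - e1); [lra|]. rewrite Rinv_l by lra. nra.
        + assert (y * e <= x * e) by (apply Rmult_le_compat_r; lra). lra. }
    apply Rle_trans with (exp (- y) * exp (- (2 * x * e))).
    - apply Rmult_le_compat_l; [lra|]. apply exp_ineq1_le.
    - rewrite <- exp_plus. destruct (Rle_lt_or_eq_dec _ _ Hexpo) as [Hl|Hl].
      + left. apply exp_increasing. lra.
      + apply Req_le. f_equal. lra. }
  assert (U : W <= exp (- y) * (1 + 2 * e)).
  { refine (Rle_trans _ _ _ Up _).
    replace (- (INR i * ((c - 1) / H))) with (- y + y * / c) by (unfold y, h; field; lra).
    rewrite exp_plus. apply Rmult_le_compat_l; [lra|].
    set (t := y * / c) in *.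
    assert (Ht : t <= e) by (unfold e1 in *; lra).
    pose proof (exp_ineq1_le (- t)) as Ht1. rewrite exp_Ropp in Ht1.
    assert (H1 : exp t * (1 + - t) <= 1).
    { apply (Rmult_le_compat_l (exp t)) in Ht1; [|left; apply exp_pos].
      rewrite Rinv_r in Ht1; auto. pose proof (exp_pos t). lra. }
    apply Rmult_le_reg_r with (1 - t); [lra|].
    assert (0 <= t) by (apply Rmult_le_pos; lra).
    apply Rle_trans with 1; [lra|]. nra. }
  assert (0 <= x * e) by (apply Rmult_le_pos; lra).
  apply Rabs_le_between. nra.
Qed.

Lemma Rpower_ge_self z a : 0 <= a <= 1 -> 0 < z <= 1 -> z <= Rpower z a.
Proof.
  intros Ha Hz. pose proof (Rpower_le_bernoulli z (1 - a) ltac:(lra) ltac:(lra)) as H.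
  assert (H1 : Rpower z (1 - a) <= 1) by nra.
  pose proof (Rpower_pos z a).
  rewrite <- (Rpower_1 z) at 1 by lra.
  replace 1 with (a + (1 - a)) by ring. rewrite Rpower_plus. nra.
Qed.

(** Rewrites the lower bound with the base of the upper one, at the cost of the factor (c + a - 1) /
    c = 1 - (1 - a) / c, which tends to 1 with growing c. *)
Lemma rbin_ratio_lower_scaled a c N :
  0 < a <= 1 -> 1 <= c ->
  (1 - (1 - a) * / c) * Rpower (c / (c + INR N)) a <= rbin c N / rbin (a + c) N.
Proof.
  intros Ha Hc. pose proof (pos_INR N) as HN. set (h := c / (c + INR N)).
  assert (Hh0 : 0 < h) by (apply Rdiv_lt_0_compat; lra).
  pose proof (rbin_ratio_lower a c N Ha ltac:(lra)) as Lo.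
  assert (Hz : 0 < (c + a - 1) / c <= 1).
  { split; [apply Rdiv_lt_0_compat; lra|].
    apply Rmult_le_reg_r with c; [lra|]. unfold Rdiv. rewrite Rmult_assoc, Rinv_l; lra. }
  assert (Lo' : Rpower ((c + a - 1) / c * h) a <= Rpower ((c + a - 1) / (c + a - 1 + INR N)) a).
  { apply Rle_Rpower_l; [lra|]. split; [apply Rmult_lt_0_compat; lra|].
    unfold h. replace ((c + a - 1) / c * (c / (c + INR N)))
      with ((c + a - 1) * / (c + INR N)) by (field; lra).
    apply Rmult_le_compat_l; [lra|]. apply Rinv_le_contravar; lra. }
  rewrite <- Rpower_mult_distr in Lo' by lra.
  pose proof (Rpower_ge_self ((c + a - 1) / c) a ltac:(lra) Hz) as Lz.
  replace (1 - (1 - a) * / c) with ((c + a - 1) / c) by (field; lra).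
  apply Rle_trans with (Rpower ((c + a - 1) / c) a * Rpower h a); [|lra].
  apply Rmult_le_compat_r; [left; apply Rpower_pos|lra].
Qed.

(** The second factor is the mass at 0, close to (b / (b + N))^a for large b; the third compares i
    successes with none and is governed by the exponential bounds. *)
Lemma polya_factor a b N i :
  0 < a -> 0 < b -> (i <= N)%nat ->
  polya a b N i = rbin a i * (rbin b N / rbin (a + b) N) * (rbin b (N - i) / rbin b N).
Proof.
  intros Ha Hb Hi. unfold polya. destruct (Nat.leb_spec i N); [|lia].
  pose proof (rbin_pos b N Hb). pose proof (rbin_pos (a + b) N ltac:(lra)). field. lra.
Qed.

(** With h = b / (b + N), the three factors of the mass behave like g i^(a-1), h^a and exp (- i h),
    and i^(a-1) h^a = h (i h)^(a-1). *)
Lemma polya_local_gamma a g (b : nat -> R) (N : nat -> nat) n1 :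
  0 < a <= 1 -> 0 < g -> Un_cv (fun n => rbin a n * Rpower (INR n) (1 - a)) g ->
  (forall n, (n1 <= n)%nat -> 1 <= b n) ->
  Un_cv (fun n => / b n) 0 -> Un_cv (fun n => b n / (b n + INR (N n))) 0 ->
  forall x al eps, 0 < x -> 0 < al -> 0 < eps -> exists n0, forall n i, (n0 <= n)%nat ->
    al <= INR i * (b n / (b n + INR (N n))) <= x ->
    Rabs (polya a (b n) (N n) i
          - b n / (b n + INR (N n)) *
            (g * (Rpower (INR i * (b n / (b n + INR (N n)))) (a - 1)
                  * exp (- (INR i * (b n / (b n + INR (N n)))))))) <=
    eps * (b n / (b n + INR (N n))).
Proof.
  intros Ha Hg Cg Hb1 Hb Hh x al eps Hx Hal He.
  set (B := Rpower al (a - 1) + Rpower x (a - 1)).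
  assert (HB : 0 < B).
  { unfold B. pose proof (Rpower_pos al (a - 1)). pose proof (Rpower_pos x (a - 1)). lra. }
  assert (He' : 0 < eps / B) by (apply Rdiv_lt_0_compat; auto).
  destruct (prod_close (g + 1) (eps / B)) as [d1 [Hd1 K1]]; [lra|auto|].
  destruct (prod_close (g + 1) d1) as [d2 [Hd2 K2]]; [lra|auto|].
  destruct (Un_cv_eventually _ _ d2 Cg Hd2) as [n2 H2].
  destruct (Un_cv_eventually _ _ (Rmin d2 (1 / 2)) Hb) as [n3 H3]; [apply Rmin_pos; lra|].
  destruct (rbin_back_exp b N n1 Hb1 Hb Hh x d1 Hx Hd1) as [n4 H4].
  (* A mesh this small turns i h >= al into i >= n2, where the asymptotics of [rbin a] are
     available. *)
  destruct (Un_cv_eventually _ _ (al / (INR n2 + 1)) Hh) as [n5 H5].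
  { pose proof (pos_INR n2). apply Rdiv_lt_0_compat; lra. }
  exists (n1 + n3 + n4 + n5)%nat. intros n i Hn Hi.
  specialize (Hb1 n ltac:(lia)). specialize (H3 n ltac:(lia)).
  destruct (H4 n i ltac:(lia) ltac:(lra)) as [HiN H4'].
  specialize (H5 n ltac:(lia)). cbv beta in H3, H5.
  rewrite Rminus_0_r in H3, H5.
  apply (Rle_trans _ _ _ (Rle_abs _)) in H3. apply (Rle_trans _ _ _ (Rle_abs _)) in H5.
  pose proof (Rmin_l d2 (1 / 2)). pose proof (Rmin_r d2 (1 / 2)).
  pose proof (pos_INR (N n)) as HN. pose proof (pos_INR n2) as Hn2.
  set (c := b n) in *. rename Hb1 into Hc.
  set (h := c / (c + INR (N n))) in *. set (y := INR i * h) in *.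
  assert (Hh0 : 0 < h) by (apply Rdiv_lt_0_compat; lra).
  assert (Hi0 : INR n2 <= INR i).
  { apply Rmult_le_reg_r with h; auto. fold y. apply Rle_trans with al; [|lra].
    apply Rle_trans with ((INR n2 + 1) * (al / (INR n2 + 1))); [|apply Req_le; field; lra].
    apply Rmult_le_compat; lra. }
  assert (Hipos : 0 < INR i).
  { apply Rmult_lt_reg_r with h; auto. fold y. lra. }
  apply INR_le in Hi0. specialize (H2 i Hi0). cbv beta in H2.
  set (u := rbin a i * Rpower (INR i) (1 - a)) in *.
  assert (Ha1 : rbin a i = u * Rpower (INR i) (a - 1)).
  { unfold u. rewrite Rmult_assoc, Rpower_mult_opp by ring. ring. }
  set (W := rbin c (N n - i) / rbin c (N n)) in *.
  set (q := rbin c (N n) / rbin (a + c) (N n) / Rpower h a).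
  pose proof (Rpower_pos h a) as Hha.
  assert (Hq : Rabs (q - 1) <= d2).
  { pose proof (rbin_ratio_upper a c (N n) Ha ltac:(lra)) as Up. fold h in Up.
    pose proof (rbin_ratio_lower_scaled a c (N n) Ha Hc) as Lo. fold h in Lo.
    assert (Hic : 0 < / c) by (apply Rinv_0_lt_compat; lra).
    assert (Hq1 : q <= 1).
    { apply Rmult_le_reg_r with (Rpower h a); auto. unfold q.
      unfold Rdiv at 1. rewrite Rmult_assoc, Rinv_l; lra. }
    assert (Hq2 : 1 - (1 - a) * / c <= q).
    { apply Rmult_le_reg_r with (Rpower h a); auto. unfold q.
      unfold Rdiv at 1. rewrite Rmult_assoc, Rinv_l by lra. lra. }
    apply Rabs_le_between. nra. }
  assert (Heq : polya a c (N n) i = h * Rpower y (a - 1) * (u * q * W)).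
  { rewrite polya_factor by (lra || lia). fold W. rewrite Ha1.
    pose proof (rbin_pos (a + c) (N n) ltac:(lra)).
    replace (rbin c (N n) / rbin (a + c) (N n)) with (q * Rpower h a)
      by (unfold q; field; split; lra).
    unfold y. rewrite <- Rpower_mult_distr by auto.
    replace (Rpower h a) with (h * Rpower h (a - 1)); [ring|].
    rewrite <- (Rpower_1 h) at 1 by auto. rewrite <- Rpower_plus. f_equal. ring. }
  rewrite Heq.
  replace (_ - _) with (h * Rpower y (a - 1) * (u * q * W - g * 1 * exp (- y))) by ring.
  pose proof (Rpower_pos y (a - 1)) as P1.
  rewrite !Rabs_mult, (Rabs_pos_eq (Rpower _ _)), (Rabs_pos_eq h) by lra.
  rewrite (Rmult_comm eps), Rmult_assoc. apply Rmult_le_compat_l; [lra|].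
  apply Rle_trans with (B * (eps / B)); [|apply Req_le; field; lra].
  apply Rmult_le_compat; try apply Rabs_pos; try lra.
  - apply Rpower_between; lra.
  - apply K1; auto.
    + rewrite Rabs_pos_eq; lra.
    + rewrite Rabs_pos_eq by (left; apply exp_pos).
      assert (exp (- y) <= exp 0); [left; apply exp_increasing; lra|].
      rewrite exp_0 in *. lra.
    + apply K2; auto; rewrite Rabs_pos_eq; lra.
Qed.

Lemma rbin_decr_index b i N : 1 <= b -> (i <= N)%nat -> rbin b (N - i) <= rbin b N.
Proof.
  intros Hb Hi. pose proof (rbin_back_upper b N i Hb Hi) as H.
  pose proof (rbin_pos b N ltac:(lra)) as Hp.
  apply (Rmult_le_compat_r (rbin b N)) in H; [|lra].
  replace (rbin b (N - i) / rbin b N * rbin b N) with (rbin b (N - i)) in H by (field; lra).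
  refine (Rle_trans _ _ _ H _). rewrite <- (Rmult_1_l (rbin b N)) at 2.
  apply Rmult_le_compat_r; [lra|]. apply Rle_trans with (exp 0); [|rewrite exp_0; lra].
  assert (H0 : 0 <= INR i * ((b - 1) / (b + INR N))).
  { pose proof (pos_INR i). pose proof (pos_INR N).
    apply Rmult_le_pos; auto. apply Rmult_le_pos; [lra|].
    left. apply Rinv_0_lt_compat. lra. }
  destruct H0 as [H0|H0].
  - left. apply exp_increasing. lra.
  - rewrite <- H0, Ropp_0. lra.
Qed.

(** The mass at 0 is at most h^a and, for b >= 1, the remaining quotient is at most 1. The
    hockey-stick sum then bounds the mass up to m by a constant times ((m + 1) h)^a. *)
Lemma polya_left_tail_gamma a (b : nat -> R) (N : nat -> nat) n1 :
  0 < a <= 1 -> (forall n, (n1 <= n)%nat -> 1 <= b n) ->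
  Un_cv (fun n => b n / (b n + INR (N n))) 0 -> forall eps, 0 < eps ->
  exists al, 0 < al /\ exists n0, forall n m, (n0 <= n)%nat ->
    INR m * (b n / (b n + INR (N n))) <= al ->
    Rabs (sum_f_R0 (polya a (b n) (N n)) m) <= eps.
Proof.
  intros Ha Hb1 Hh eps He.
  destruct (rbin_le_upper_S a ltac:(lra)) as [C [HC0 HC]].
  destruct (Rpower_small C a eps ltac:(lra) HC0 He) as [al [Hal1 Hal2]].
  exists al. split; [lra|].
  destruct (Un_cv_eventually _ _ al Hh ltac:(lra)) as [n2 H2].
  exists (n1 + n2)%nat. intros n m Hn Hm.
  specialize (Hb1 n ltac:(lia)). specialize (H2 n ltac:(lia)). cbv beta in H2.
  rewrite Rminus_0_r in H2. apply (Rle_trans _ _ _ (Rle_abs _)) in H2.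
  pose proof (pos_INR (N n)). pose proof (pos_INR m).
  rewrite Rabs_pos_eq by (apply sum_polya_nonneg; lra).
  set (c := b n) in *. rename Hb1 into Hc.
  set (h := c / (c + INR (N n))) in *.
  assert (Hh0 : 0 < h) by (apply Rdiv_lt_0_compat; lra).
  apply Rle_trans with (sum_f_R0 (fun i => rbin a i * Rpower h a) m).
  - apply sum_Rle. intros i _. pose proof (rbin_pos a i ltac:(lra)). pose proof (Rpower_pos h a).
    destruct (le_lt_dec i (N n)) as [Hi|Hi].
    + rewrite polya_factor by (lra || auto). rewrite Rmult_assoc.
      apply Rmult_le_compat_l; [lra|]. rewrite <- (Rmult_1_r (Rpower h a)).
      pose proof (rbin_pos c (N n) ltac:(lra)).
      apply Rmult_le_compat.
      * left. apply rbin_ratio_pos; lra.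
      * left. apply Rdiv_lt_0_compat; apply rbin_pos; lra.
      * apply rbin_ratio_upper; lra.
      * apply Rmult_le_reg_r with (rbin c (N n)); auto.
        unfold Rdiv. rewrite Rmult_assoc, Rinv_l, Rmult_1_r, Rmult_1_l by lra.
        now apply rbin_decr_index.
    + rewrite polya_gt by auto. apply Rmult_le_pos; lra.
  - rewrite <- scal_sum, sum_rbin by lra.
    apply Rle_trans with (Rpower h a * (C * Rpower (INR m + 1) a)).
    + apply Rmult_le_compat_l; [left; apply Rpower_pos|auto].
    + refine (Rle_trans _ _ _ _ Hal2).
      replace (Rpower h a * (C * Rpower (INR m + 1) a))
        with (C * (Rpower (INR m + 1) a * Rpower h a)) by ring.
      apply Rmult_le_compat_l; [lra|]. rewrite Rpower_mult_distr by lra.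
      apply Rle_Rpower_l; [lra|]. split; [apply Rmult_lt_0_compat; lra|lra].
Qed.

(** * Total mass and right tails *)

Lemma markov_sum (p : nat -> R) m N :
  (forall i, 0 <= p i) -> (m <= N)%nat ->
  sum_f_R0 p N <= sum_f_R0 p m + sum_f_R0 (fun i => INR i * p i) N / (INR m + 1).
Proof.
  intros Hp HmN. pose proof (pos_INR m).
  replace N with (m + (N - m))%nat by lia. induction (N - m)%nat as [|d IH].
  - rewrite Nat.add_0_r. assert (0 <= sum_f_R0 (fun i => INR i * p i) m / (INR m + 1)); [|lra].
    apply Rmult_le_pos; [|left; apply Rinv_0_lt_compat; lra].
    apply cond_pos_sum. intros i. apply Rmult_le_pos; auto. apply pos_INR.
  - rewrite Nat.add_succ_r, !tech5.
    assert (H1 : p (S (m + d)) <= INR (S (m + d)) * p (S (m + d)) / (INR m + 1)).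
    { apply Rmult_le_reg_r with (INR m + 1); [lra|].
      unfold Rdiv. rewrite Rmult_assoc, Rinv_l, Rmult_1_r by lra.
      rewrite Rmult_comm. apply Rmult_le_compat_r; auto.
      rewrite S_INR, plus_INR. pose proof (pos_INR d). lra. }
    rewrite Rdiv_plus_distr. lra.
Qed.

Lemma polya_sum_le_1 a b N m : 0 < a -> 0 < b -> sum_f_R0 (polya a b N) m <= 1.
Proof.
  intros Ha Hb. rewrite <- (polya_total a b N Ha Hb).
  destruct (le_lt_dec m N) as [H|H].
  - destruct (Nat.eq_dec m N) as [->|Hne]; [lra|].
    rewrite (tech2 _ m N) by lia.
    assert (0 <= sum_f_R0 (fun i => polya a b N (S m + i)) (N - S m)); [|lra].
    apply cond_pos_sum. intros. now apply polya_nonneg.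
  - rewrite (tech2 _ N m) by auto.
    rewrite (sum_eq _ (fun _ => 0) (m - S N)) by (intros; apply polya_gt; lia).
    rewrite sum_cte. lra.
Qed.

(** Markov's inequality: since a <= 1, the mean N a / (a + b) is at most (b + N) / b, the inverse of
    the mesh. It keeps mass from escaping to infinity in the Gamma regime. *)
Lemma polya_markov a b N m :
  0 < a <= 1 -> 0 < b ->
  1 - 1 / ((INR m + 1) * (b / (b + INR N))) <= sum_f_R0 (polya a b N) m.
Proof.
  intros Ha Hb. pose proof (pos_INR m). pose proof (pos_INR N).
  assert (Hh : 0 < b / (b + INR N)) by (apply Rdiv_lt_0_compat; lra).
  assert (0 < 1 / ((INR m + 1) * (b / (b + INR N)))).
  { apply Rdiv_lt_0_compat; [lra|]. apply Rmult_lt_0_compat; lra. }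
  destruct (le_lt_dec m N) as [Hm|Hm].
  - pose proof (markov_sum (polya a b N) m N (fun i => polya_nonneg a b N i ltac:(lra) Hb) Hm) as HM.
    rewrite polya_total, polya_mean in HM by lra.
    assert (H2 : INR N * a / (a + b) / (INR m + 1) <= 1 / ((INR m + 1) * (b / (b + INR N)))); [|lra].
    replace (1 / ((INR m + 1) * (b / (b + INR N)))) with ((b + INR N) * / b / (INR m + 1))
      by (field; lra).
    apply Rmult_le_compat_r; [left; apply Rinv_0_lt_compat; lra|].
    apply Rmult_le_compat; try nra.
    + left. apply Rinv_0_lt_compat. lra.
    + apply Rinv_le_contravar; lra.
  - rewrite (tech2 _ N m) by auto. rewrite polya_total by lra.
    assert (0 <= sum_f_R0 (fun i => polya a b N (S N + i)) (m - S N)); [|lra].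
    apply cond_pos_sum. intros. apply polya_nonneg; lra.
Qed.

Lemma sum_reverse (p : nat -> R) N r :
  (r < N)%nat ->
  sum_f_R0 p (N - S r) + sum_f_R0 (fun i => p (N - i)%nat) r = sum_f_R0 p N.
Proof.
  induction r as [|r IH]; intros H.
  - simpl. destruct N as [|N]; [lia|]. rewrite tech5. simpl. now rewrite Nat.sub_0_r.
  - rewrite <- IH by lia. rewrite tech5.
    replace (N - S r)%nat with (S (N - S (S r))) at 2 by lia.
    rewrite tech5. replace (S (N - S (S r))) with (N - S r)%nat by lia. ring.
Qed.

(** Counting failures instead of successes exchanges a and b, so a right tail of the urn law is a
    left tail of the exchanged one. *)
Lemma polya_sum_compl a b N m :
  0 < a -> 0 < b -> (m < N)%nat ->
  sum_f_R0 (polya a b N) m + sum_f_R0 (polya b a N) (N - S m) = 1.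
Proof.
  intros Ha Hb Hm. rewrite <- (polya_total a b N Ha Hb).
  rewrite <- (sum_reverse _ N (N - S m)) by lia.
  replace (N - S (N - S m))%nat with m by lia. f_equal.
  apply sum_eq. intros i Hi. unfold polya.
  destruct (Nat.leb_spec i N); [|lia]. destruct (Nat.leb_spec (N - i) N); [|lia].
  replace (N - (N - i))%nat with i by lia. rewrite (Rplus_comm b a). f_equal. ring.
Qed.

(** * Beta and Gamma limits *)

Lemma limit1_in_R f (D : R -> Prop) l x0 :
  limit1_in f D l x0 <->
  forall eps, 0 < eps -> exists al, 0 < al /\
    forall x, D x -> Rabs (x - x0) < al -> Rabs (f x - l) < eps.
Proof.
  unfold limit1_in, limit_in; simpl. unfold Rdist. split; intros H eps He.
  - destruct (H eps He) as [al [Hal K]]. exists al. split; auto.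
  - destruct (H eps He) as [al [Hal K]]. exists al. split; auto. intros x [H1 H2]; auto.
Qed.

Lemma limit1_in_subset f (D E : R -> Prop) l x0 :
  limit1_in f D l x0 -> (forall x, E x -> D x) -> limit1_in f E l x0.
Proof.
  rewrite !limit1_in_R. intros H HDE eps He.
  destruct (H eps He) as [al [Hal K]]. exists al. auto.
Qed.

Lemma limit1_in_eq_of_values f (D : R -> Prop) k l x0 :
  limit1_in f D l x0 ->
  (forall d, 0 < d -> exists y, D y /\ Rabs (y - x0) < d /\ f y = k) ->
  l = k.
Proof.
  intros H K. rewrite limit1_in_R in H. symmetry. apply cond_eq. intros eps He.
  destruct (H eps He) as [al [Hal H1]]. destruct (K al Hal) as [y [Hy1 [Hy2 <-]]]. auto.
Qed.

(** Two antiderivatives differ by a constant inside the interval, and their continuity up to the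
    endpoints extends this there. A value of the distribution function may thus be computed from the
    antiderivative of the density. *)
Lemma improper_int_unique a b h v w :
  a < b -> improper_int a b h v -> improper_int a b h w -> v = w.
Proof.
  intros Hab [G [G1 [G2 G3]]] [F [F1 [F2 F3]]].
  set (D := fun x => G x - F x).
  assert (HD : forall x, a < x < b -> derivable_pt_lim D x 0).
  { intros x Hx. replace 0 with (h x - h x) by ring.
    apply derivable_pt_lim_minus; auto. }
  set (m := (a + b) / 2).
  assert (HDm : forall x, a < x < b -> D x = D m).
  { assert (Hm : a < m < b) by (unfold m; lra).
    intros x Hx. destruct (Rtotal_order x m) as [Hl|[->|Hl]]; auto.
    - destruct (MVT_cor2 D (fun _ => 0) x m) as [c [Hc _]]; auto; [intros; apply HD; lra|lra].
    - destruct (MVT_cor2 D (fun _ => 0) m x) as [c [Hc _]]; auto; [intros; apply HD; lra|lra]. }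
  assert (HDl : forall x0, a <= x0 <= b -> limit1_in D (fun y => a <= y <= b) (D x0) x0).
  { intros x0 Hx0. apply limit_minus; auto. }
  assert (Ha : D a = D m).
  { eapply limit1_in_eq_of_values; [apply HDl; lra|]. intros d Hd.
    set (y := a + Rmin (d / 2) ((b - a) / 2)).
    assert (0 < Rmin (d / 2) ((b - a) / 2)) by (apply Rmin_pos; lra).
    pose proof (Rmin_l (d / 2) ((b - a) / 2)). pose proof (Rmin_r (d / 2) ((b - a) / 2)).
    exists y. unfold y. repeat split; try lra.
    - apply Rabs_def1; lra.
    - apply HDm; lra. }
  assert (Hb : D b = D m).
  { eapply limit1_in_eq_of_values; [apply HDl; lra|]. intros d Hd.
    set (y := b - Rmin (d / 2) ((b - a) / 2)).
    assert (0 < Rmin (d / 2) ((b - a) / 2)) by (apply Rmin_pos; lra).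
    pose proof (Rmin_l (d / 2) ((b - a) / 2)). pose proof (Rmin_r (d / 2) ((b - a) / 2)).
    exists y. unfold y. repeat split; try lra.
    - apply Rabs_def1; lra.
    - apply HDm; lra. }
  unfold D in *. lra.
Qed.

Lemma continuity_pt_Rpower p y : 0 < y -> continuity_pt (fun x => Rpower x p) y.
Proof.
  intros Hy. apply derivable_continuous_pt. exists (p * Rpower y (p - 1)).
  now apply derivable_pt_lim_power.
Qed.

Lemma Un_cv_ge_loc u l k n0 : Un_cv u l -> (forall n, (n0 <= n)%nat -> k <= u n) -> k <= l.
Proof.
  intros H K. apply Rnot_lt_le. intros Hl.
  destruct (Un_cv_eventually _ _ ((k - l) / 2) H ltac:(lra)) as [n1 H1].
  specialize (H1 (n0 + n1)%nat ltac:(lia)). specialize (K (n0 + n1)%nat ltac:(lia)).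
  apply Rabs_le_between in H1. lra.
Qed.

Lemma Un_cv_le_loc u l k n0 : Un_cv u l -> (forall n, (n0 <= n)%nat -> u n <= k) -> l <= k.
Proof.
  intros H K. apply Rnot_lt_le. intros Hl.
  destruct (Un_cv_eventually _ _ ((l - k) / 2) H ltac:(lra)) as [n1 H1].
  specialize (H1 (n0 + n1)%nat ltac:(lia)). specialize (K (n0 + n1)%nat ltac:(lia)).
  apply Rabs_le_between in H1. lra.
Qed.

Lemma tends_pos N : tends_to_inf N -> exists n0, forall n, (n0 <= n)%nat -> 0 < INR (N n).
Proof.
  intros H. destruct (H 1%nat) as [n0 H0]. exists n0. intros n Hn.
  specialize (H0 n Hn). apply lt_0_INR. lia.
Qed.

Lemma Un_cv_one_ratio h n0 :
  (forall n, (n0 <= n)%nat -> 0 < h n) -> Un_cv (fun n => h n / h n) 1.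
Proof.
  intros H. apply Un_cv_ext_loc with (n0 := n0) (u := fun _ => 1); [|apply Un_cv_const].
  intros n Hn. specialize (H n Hn). field. lra.
Qed.

Lemma polya_beta_cdf a b f x v (N M : nat -> nat) :
  0 < a -> 0 < b -> beta_density a b f -> 0 < x < 1 -> improper_int 0 x f v ->
  tends_to_inf N -> Un_cv (fun n => INR (M n) * / INR (N n)) x ->
  Un_cv (fun n => sum_f_R0 (polya a b (N n)) (M n)) v.
Proof.
  intros Ha Hb [[c [Hc Hf]] [G [G1 [G2 G3]]]] Hx Hv HN HM.
  assert (v = G x - G 0) as ->.
  { apply (improper_int_unique 0 x f); [lra|auto|]. exists G.
    split; [|split; [intros; apply G2; lra|reflexivity]].
    intros y Hy. apply (limit1_in_subset _ _ _ _ _ (G1 y ltac:(lra))). intros; lra. }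
  clear Hv.
  destruct (rbin_asymp a Ha) as [ga [Hga Ca]].
  destruct (rbin_asymp b Hb) as [gb [Hgb Cb]].
  destruct (rbin_asymp (a + b) ltac:(lra)) as [gab [Hgab Cab]].
  (* The quotient of the constant of the local limit by that of the density. *)
  set (r := ga * gb / gab / c).
  assert (Main : forall (N M : nat -> nat) x, tends_to_inf N -> 0 < x < 1 ->
    Un_cv (fun n => INR (M n) * / INR (N n)) x ->
    Un_cv (fun n => sum_f_R0 (polya a b (N n)) (M n)) (r * G x - r * G 0)).
  { clear x Hx N M HN HM. intros N M x HN Hx HM.
    destruct (tends_pos N HN) as [n1 Hn1].
    apply (cdf_of_local_limit (fun n => polya a b (N n)) (fun n => / INR (N n))
      (fun y => ga * gb / gab * (Rpower y (a - 1) * Rpower (1 - y) (b - 1)))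
      (fun y => r * G y) x ((1 + x) / 2) M n1); auto.
    - lra.
    - intros n Hn. apply Rinv_0_lt_compat. auto.
    - now apply Un_cv_inv_tends.
    - intros eps He. destruct (polya_left_tail a b Ha Hb eps He) as [al [Hal [n0 H0]]].
      destruct (HN n0) as [n2 H2]. exists al. split; auto. exists n2. intros n m Hn Hm.
      rewrite Rabs_pos_eq by (now apply sum_polya_nonneg). apply H0; auto.
    - intros al eps Hal He.
      destruct (polya_local_beta a b ga gb gab Ha Hb Hga Hgb Hgab Ca Cb Cab ((1 + x) / 2)
        ltac:(lra) al eps Hal He) as [n0 H0].
      destruct (HN n0) as [n2 H2]. exists n2. intros n i Hn Hi. apply H0; auto.
    - intros y Hy. apply continuity_pt_mult; [apply continuity_pt_const; now intros ? ?|].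
      apply continuity_pt_mult; [apply continuity_pt_Rpower; lra|].
      apply (continuity_pt_comp (fun y => 1 - y) (fun z => Rpower z (b - 1))).
      + apply continuity_pt_minus; [apply continuity_pt_const; now intros ? ?|].
        apply derivable_continuous_pt, derivable_pt_id.
      + apply continuity_pt_Rpower. lra.
    - intros y Hy.
      replace (ga * gb / gab * (Rpower y (a - 1) * Rpower (1 - y) (b - 1))) with (r * f y).
      + apply derivable_pt_lim_scal. apply G2. lra.
      + rewrite Hf by lra. unfold r. field. lra.
    - intros eps He. specialize (G1 0 ltac:(lra)). rewrite limit1_in_R in G1.
      assert (Hr : 0 < r).
      { unfold r. apply Rdiv_lt_0_compat; auto. apply Rdiv_lt_0_compat; auto.
        now apply Rmult_lt_0_compat. }
      destruct (G1 (eps / r)) as [al [Hal K]]; [now apply Rdiv_lt_0_compat|].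
      assert (0 < Rmin (al / 2) 1) by (apply Rmin_pos; lra).
      pose proof (Rmin_l (al / 2) 1). pose proof (Rmin_r (al / 2) 1).
      exists (Rmin (al / 2) 1). split; auto. intros y Hy.
      specialize (K y ltac:(lra) ltac:(rewrite Rminus_0_r, Rabs_pos_eq; lra)).
      replace (r * G y - r * G 0) with (r * (G y - G 0)) by ring.
      rewrite Rabs_mult, Rabs_pos_eq by lra.
      apply Rle_trans with (r * (eps / r)); [apply Rmult_le_compat_l; lra|].
      apply Req_le. field. lra. }
  (* The case N = n with cutoffs at arbitrary y in (0, 1) determines r: total mass bounds from
     above, the right tail from below, and continuity of G at 1 normalizes. *)
  assert (Hr1 : r = 1).
  { assert (Hid : tends_to_inf (fun n => n)) by (intros m; exists m; auto).
    assert (Hpos : forall n, (1 <= n)%nat -> 0 < / INR n).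
    { intros n Hn. apply Rinv_0_lt_compat, lt_0_INR. lia. }
    set (Mx := fun y n => (floor_nat (y / / INR n) - 1)%nat).
    assert (HMx : forall y, 0 < y -> Un_cv (fun n => INR (Mx y n) * / INR n) y).
    { intros y Hy. apply (scaled_cutoff_cv (fun n => / INR n) (fun n => / INR n) y 1); auto.
      - apply Un_cv_inv_INR.
      - now apply (Un_cv_one_ratio _ 1). }
    apply (scale_one r (fun y => G y - G 0) (fun y => 0 < y < 1)).
    - intros y Hy. pose proof (Main (fun n => n) (Mx y) y Hid Hy (HMx y ltac:(lra))) as L.
      rewrite Rmult_minus_distr_l.
      apply (Un_cv_le_loc _ _ _ 0 L). intros. now apply polya_sum_le_1.
    - intros eps He.
      (* With successes and failures exchanged, the mass beyond the cutoff is a left tail; y >= 1 -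
         al / 2 makes it at most eps. *)
      destruct (polya_left_tail b a Hb Ha eps He) as [al [Hal [n0 H0]]].
      set (d := Rmin (al / 2) (1 / 2)).
      assert (Hd : 0 < d) by (apply Rmin_pos; lra).
      assert (Hd1 : d <= al / 2) by apply Rmin_l. assert (Hd2 : d <= 1 / 2) by apply Rmin_r.
      exists (1 - d). split; [lra|]. intros y Hy1 Hy2.
      pose proof (Main (fun n => n) (Mx y) y Hid Hy2 (HMx y ltac:(lra))) as L.
      rewrite Rmult_minus_distr_l.
      destruct (Un_cv_eventually _ _ (Rmin (al / 2) ((1 - y) / 2)) (HMx y ltac:(lra)))
        as [n2 H2]; [apply Rmin_pos; lra|].
      apply (Un_cv_ge_loc _ _ _ (S (n0 + n2)) L). intros n Hn.
      specialize (H2 n ltac:(lia)). cbv beta in H2. apply Rabs_le_between in H2.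
      pose proof (Rmin_l (al / 2) ((1 - y) / 2)). pose proof (Rmin_r (al / 2) ((1 - y) / 2)).
      assert (Hn0 : 0 < INR n) by (apply lt_0_INR; lia).
      specialize (Hpos n ltac:(lia)).
      set (m := Mx y n) in *.
      assert (Hm : (m < n)%nat).
      { apply INR_lt. apply Rmult_lt_reg_r with (/ INR n); auto. rewrite Rinv_r; lra. }
      assert (INR (n - S m) * / INR n <= al).
      { rewrite minus_INR, S_INR by lia.
        replace ((INR n - (INR m + 1)) * / INR n) with (1 - INR m * / INR n - / INR n)
          by (field; lra). lra. }
      pose proof (polya_sum_compl a b n m Ha Hb Hm).
      specialize (H0 n (n - S m)%nat ltac:(lia) ltac:(auto)). lra.
    - intros eps He. specialize (G1 1 ltac:(lra)). rewrite limit1_in_R in G1.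
      destruct (G1 eps He) as [al [Hal K]].
      assert (0 < Rmin (al / 2) (1 / 2)) by (apply Rmin_pos; lra).
      pose proof (Rmin_l (al / 2) (1 / 2)). pose proof (Rmin_r (al / 2) (1 / 2)).
      exists (1 - Rmin (al / 2) (1 / 2)). split; [lra|]. intros y Hy1 Hy2.
      replace (G y - G 0 - 1) with (G y - G 1) by lra.
      left. apply K; [lra|]. apply Rabs_def1; lra. }
  specialize (Main N M x HN Hx HM). rewrite Hr1, !Rmult_1_l in Main. exact Main.
Qed.

Lemma polya_gamma_cdf a f x v (b : nat -> R) (N M : nat -> nat) n1 :
  0 < a <= 1 -> gamma_density a f -> 0 < x -> improper_int 0 x f v ->
  (forall n, (n1 <= n)%nat -> 1 <= b n) ->
  Un_cv (fun n => / b n) 0 -> Un_cv (fun n => b n / (b n + INR (N n))) 0 ->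
  Un_cv (fun n => INR (M n) * (b n / (b n + INR (N n)))) x ->
  Un_cv (fun n => sum_f_R0 (polya a (b n) (N n)) (M n)) v.
Proof.
  intros Ha [[c [Hc Hf]] [G [G1 [G2 G3]]]] Hx Hv Hb1 Hb Hh HM.
  assert (v = G x - G 0) as ->.
  { apply (improper_int_unique 0 x f); [lra|auto|]. exists G.
    split; [|split; [intros; apply G2; lra|reflexivity]].
    intros y Hy. apply (limit1_in_subset _ _ _ _ _ (G1 y ltac:(lra))). intros; lra. }
  clear Hv.
  destruct (rbin_asymp a ltac:(lra)) as [g [Hg Cg]].
  set (r := g / c). set (h := fun n => b n / (b n + INR (N n))) in *.
  assert (Hhpos : forall n, (n1 <= n)%nat -> 0 < h n).
  { intros n Hn. specialize (Hb1 n Hn). pose proof (pos_INR (N n)).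
    apply Rdiv_lt_0_compat; lra. }
  assert (Main : forall (M : nat -> nat) x, 0 < x ->
    Un_cv (fun n => INR (M n) * h n) x ->
    Un_cv (fun n => sum_f_R0 (polya a (b n) (N n)) (M n)) (r * G x - r * G 0)).
  { clear x Hx M HM. intros M x Hx HM.
    apply (cdf_of_local_limit (fun n => polya a (b n) (N n)) h
      (fun y => g * (Rpower y (a - 1) * exp (- y)))
      (fun y => r * G y) x (x + 1) M n1); auto.
    - lra.
    - now apply polya_left_tail_gamma with n1.
    - intros al eps Hal He.
      apply (polya_local_gamma a g b N n1 Ha Hg Cg Hb1 Hb Hh (x + 1) al eps); lra.
    - intros y Hy. apply continuity_pt_mult; [apply continuity_pt_const; now intros ? ?|].
      apply continuity_pt_mult; [apply continuity_pt_Rpower; lra|].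
      apply (continuity_pt_comp (fun y => - y) exp).
      + apply continuity_pt_opp. apply derivable_continuous_pt, derivable_pt_id.
      + apply derivable_continuous_pt, derivable_pt_exp.
    - intros y Hy.
      replace (g * (Rpower y (a - 1) * exp (- y))) with (r * f y).
      + apply derivable_pt_lim_scal. apply G2. lra.
      + rewrite Hf by lra. unfold r. field. lra.
    - intros eps He. specialize (G1 0 ltac:(lra)). rewrite limit1_in_R in G1.
      assert (Hr : 0 < r) by (unfold r; now apply Rdiv_lt_0_compat).
      destruct (G1 (eps / r)) as [al [Hal K]]; [now apply Rdiv_lt_0_compat|].
      exists (al / 2). split; [lra|]. intros y Hy.
      specialize (K y ltac:(lra) ltac:(rewrite Rminus_0_r, Rabs_pos_eq; lra)).
      replace (r * G y - r * G 0) with (r * (G y - G 0)) by ring.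
      rewrite Rabs_mult, Rabs_pos_eq by lra.
      apply Rle_trans with (r * (eps / r)); [apply Rmult_le_compat_l; lra|].
      apply Req_le. field. lra. }
  assert (Hr1 : r = 1).
  { set (Mx := fun y n => (floor_nat (y / h n) - 1)%nat).
    assert (HMx : forall y, 0 < y -> Un_cv (fun n => INR (Mx y n) * h n) y).
    { intros y Hy. apply (scaled_cutoff_cv h h y n1); auto.
      now apply (Un_cv_one_ratio _ n1). }
    apply (scale_one r (fun y => G y - G 0) (fun y => 0 < y)).
    - intros y Hy. pose proof (Main (Mx y) y Hy (HMx y ltac:(lra))) as L.
      rewrite Rmult_minus_distr_l.
      apply (Un_cv_le_loc _ _ _ n1 L). intros n Hn. specialize (Hb1 n Hn).
      apply polya_sum_le_1; lra.
    (* Eventually the rescaled cutoff exceeds y / 2 >= 1 / eps, so Markov's bound leaves at most eps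
       beyond it. *)
    - intros eps He. exists (2 / eps).
      assert (H2e : 0 < 2 / eps) by (apply Rdiv_lt_0_compat; lra).
      split; auto. intros y Hy1 Hy.
      pose proof (Main (Mx y) y Hy (HMx y ltac:(lra))) as L.
      rewrite Rmult_minus_distr_l.
      destruct (Un_cv_eventually _ _ (y / 2) (HMx y Hy)) as [n2 H2]; [lra|].
      apply (Un_cv_ge_loc _ _ _ (n1 + n2) L). intros n Hn.
      specialize (H2 n ltac:(lia)). cbv beta in H2. apply Rabs_le_between in H2.
      specialize (Hb1 n ltac:(lia)). specialize (Hhpos n ltac:(lia)).
      pose proof (polya_markov a (b n) (N n) (Mx y n) Ha ltac:(lra)) as K. fold (h n) in K.
      assert (1 / ((INR (Mx y n) + 1) * h n) <= eps); [|lra].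
      replace eps with (1 / (/ eps)) by (field; lra).
      assert (0 < / eps) by (apply Rinv_0_lt_compat; lra).
      unfold Rdiv. apply Rmult_le_compat_l; [lra|]. apply Rinv_le_contravar; auto.
      unfold Rdiv in *. lra.
    - intros eps He. destruct (G3 eps He) as [m Hm].
      exists (Rmax 1 (m + 1)). pose proof (Rmax_l 1 (m + 1)). pose proof (Rmax_r 1 (m + 1)).
      split; [lra|]. intros y Hy _. left. apply Hm. lra. }
  specialize (Main M x Hx HM). rewrite Hr1, !Rmult_1_l in Main. exact Main.
Qed.

(** * Existence and moments of the limit densities *)

(* Rpower 0 p is 1 in Stdlib; this is the continuous extension of x^p by 0 (for p > 0). *)
Definition rpow0 (x p : R) : R := if Rle_dec x 0 then 0 else Rpower x p.

Lemma rpow0_pos x p : 0 < x -> rpow0 x p = Rpower x p.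
Proof. intros H. unfold rpow0. destruct (Rle_dec x 0); [lra|reflexivity]. Qed.

Lemma rpow0_0 p : rpow0 0 p = 0.
Proof. unfold rpow0. destruct (Rle_dec 0 0); [reflexivity|lra]. Qed.

Lemma locally_gt (x m : R) : m < x -> locally x (fun y => m < y).
Proof. apply open_gt. Qed.

Lemma locally_lt (x m : R) : x < m -> locally x (fun y => y < m).
Proof. apply open_lt. Qed.

Lemma derivable_rpow0 x p : 0 < x -> derivable_pt_lim (fun y => rpow0 y p) x (p * Rpower x (p - 1)).
Proof.
  intros Hx. apply is_derive_Reals. apply is_derive_ext_loc with (fun y => Rpower y p).
  - generalize (locally_gt x 0 Hx). apply filter_imp. intros y Hy. now rewrite rpow0_pos.
  - apply is_derive_Reals. now apply derivable_pt_lim_power.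
Qed.

Lemma continuity_rpow0 p x : 0 < p -> continuity_pt (fun y => rpow0 y p) x.
Proof.
  intros Hp. destruct (Rtotal_order x 0) as [Hx|[->|Hx]].
  - apply continuity_pt_ext_loc with (fun _ => 0).
    + generalize (locally_lt x 0 Hx). apply filter_imp. intros y Hy.
      unfold rpow0. destruct (Rle_dec y 0); [reflexivity|lra].
    + apply continuity_pt_const. now intros ? ?.
  - apply continuity_pt_locally. intros eps. rewrite rpow0_0.
    exists (mkposreal _ (Rpower_pos eps (/ p))). intros y Hy.
    change (Rabs (y - 0) < Rpower eps (/ p)) in Hy. rewrite Rminus_0_r in *.
    unfold rpow0. destruct (Rle_dec y 0) as [Hy0|Hy0].
    + rewrite Rabs_R0. apply cond_pos.
    + rewrite Rabs_pos_eq in Hy by lra. rewrite Rabs_pos_eq by (left; apply Rpower_pos).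
      assert (H : Rpower y p < Rpower (Rpower eps (/ p)) p) by (apply Rlt_Rpower_l; lra).
      rewrite Rpower_mult, Rinv_l, Rpower_1 in H; [exact H|apply cond_pos|lra].
  - apply derivable_continuous_pt. exists (p * Rpower x (p - 1)). now apply derivable_rpow0.
Qed.

Lemma continuous_primitive (g : R -> R) :
  (forall x, continuity_pt g x) -> exists F, forall x, derivable_pt_lim F x (g x).
Proof.
  intros Hg. assert (Hc : forall x, continuous g x) by (intros x; now apply continuity_pt_filterlim).
  exists (RInt g 0). intros x. apply is_derive_Reals. apply is_derive_RInt with 0; auto.
  apply filter_forall. intros y. apply (RInt_correct (V := R_CompleteNormedModule) g 0 y).
  apply (ex_RInt_continuous (V := R_CompleteNormedModule)). auto.
Qed.

Lemma derivable_continuity F x l : derivable_pt_lim F x l -> continuity_pt F x.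
Proof. intros H. apply derivable_continuous_pt. now exists l. Qed.

(* The substitution u = x^a removes the singularity at 0. *)
Lemma power_primitive a (g : R -> R) :
  0 < a -> (forall x, continuity_pt g x) ->
  exists F, (forall x, continuity_pt F x) /\
    forall x, 0 < x -> derivable_pt_lim F x (Rpower x (a - 1) * g x).
Proof.
  intros Ha Hg.
  assert (Hia : 0 < / a) by (apply Rinv_0_lt_compat; lra).
  destruct (continuous_primitive (fun v => g (rpow0 v (/ a)))) as [F HF].
  { intros x. apply (continuity_pt_comp (fun v => rpow0 v (/ a)) g); auto.
    now apply continuity_rpow0. }
  exists (fun x => / a * F (rpow0 x a)). split.
  - intros x. apply continuity_pt_mult; [apply continuity_pt_const; now intros ? ?|].
    apply (continuity_pt_comp (fun v => rpow0 v a) F); [now apply continuity_rpow0|].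
    eapply derivable_continuity. apply HF.
  - intros x Hx.
    replace (Rpower x (a - 1) * g x) with (/ a * (g x * (a * Rpower x (a - 1)))) by (field; lra).
    apply (derivable_pt_lim_scal (fun y => F (rpow0 y a))).
    apply (derivable_pt_lim_comp (fun y => rpow0 y a) F); [now apply derivable_rpow0|].
    specialize (HF (rpow0 x a)). cbv beta in HF.
    rewrite !rpow0_pos in HF by (auto; apply Rpower_pos).
    rewrite Rpower_mult, Rinv_r, Rpower_1 in HF by lra. rewrite rpow0_pos by auto. exact HF.
Qed.

Lemma limit1_in_continuity f D x : continuity_pt f x -> limit1_in f D (f x) x.
Proof.
  intros H. rewrite limit1_in_R. intros eps He.
  rewrite continuity_pt_locally in H. destruct (H (mkposreal eps He)) as [d Hd].
  exists d. split; [apply cond_pos|]. intros y _ Hy. now apply Hd.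
Qed.

Lemma increment_pos F dF a b :
  a < b -> (forall x, a < x < b -> derivable_pt_lim F x (dF x)) ->
  (forall x, continuity_pt F x) -> (forall x, 0 < dF x) -> F a < F b.
Proof.
  intros Hab HF Hc Hp. destruct (MVT_gen F a b dF) as [c [_ E]].
  - rewrite Rmin_left, Rmax_right by lra. intros x Hx. apply is_derive_Reals. auto.
  - auto.
  - specialize (Hp c). assert (0 < dF c * (b - a)) by (apply Rmult_lt_0_compat; lra). lra.
Qed.

Lemma derivable_one_minus F x l :
  derivable_pt_lim F (1 - x) l -> derivable_pt_lim (fun y => F (1 - y)) x (- l).
Proof.
  intros H. replace (- l) with (l * (0 - 1)) by ring.
  apply (derivable_pt_lim_comp (fun y => 1 - y) F); auto.
  apply derivable_pt_lim_minus; [apply derivable_pt_lim_const|apply derivable_pt_lim_id].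
Qed.

Lemma continuity_one_minus F x :
  continuity_pt F (1 - x) -> continuity_pt (fun y => F (1 - y)) x.
Proof.
  intros H. apply (continuity_pt_comp (fun y => 1 - y) F); auto.
  apply continuity_pt_minus; [apply continuity_pt_const; now intros ? ?|].
  apply derivable_continuous_pt, derivable_pt_id.
Qed.

Lemma Rpower_minus_1 x p : 0 < x -> Rpower x p = x * Rpower x (p - 1).
Proof.
  intros Hx. rewrite <- (Rpower_1 x) at 2 by auto. rewrite <- Rpower_plus. f_equal. ring.
Qed.

(** Multiplying by 1 = (1 - x) + x splits x^(a-1) (1-x)^(b-1) into two terms, each with a possible
    singularity at one end only; the primitive of the second is obtained by reflecting x to 1 -
    x. *)
Lemma beta_density_exists a b : 0 < a -> 0 < b -> exists f, beta_density a b f.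
Proof.
  intros Ha Hb.
  destruct (power_primitive a (fun y => rpow0 (1 - y) b) Ha) as [F [F1 F2]].
  { intros x. apply (continuity_one_minus (fun z => rpow0 z b)). now apply continuity_rpow0. }
  destruct (power_primitive b (fun y => rpow0 (1 - y) a) Hb) as [H [H1 H2]].
  { intros x. apply (continuity_one_minus (fun z => rpow0 z a)). now apply continuity_rpow0. }
  set (G := fun x => F x - H (1 - x)).
  set (phi := fun x => Rpower x (a - 1) * Rpower (1 - x) (b - 1)).
  assert (Gc : forall x, continuity_pt G x).
  { intros x. apply continuity_pt_minus; auto. apply continuity_one_minus; auto. }
  assert (Gd : forall x, 0 < x < 1 -> derivable_pt_lim G x (phi x)).
  { intros x Hx. unfold phi.
    replace (Rpower x (a - 1) * Rpower (1 - x) (b - 1))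
      with (Rpower x (a - 1) * rpow0 (1 - x) b
            - - (Rpower (1 - x) (b - 1) * rpow0 (1 - (1 - x)) a)).
    - apply derivable_pt_lim_minus; [apply F2; lra|]. apply derivable_one_minus. apply H2. lra.
    - rewrite !rpow0_pos by lra. replace (1 - (1 - x)) with x by ring.
      rewrite (Rpower_minus_1 x a), (Rpower_minus_1 (1 - x) b) by lra. ring. }
  assert (HG : G 0 < G 1).
  { apply increment_pos with phi; auto; [lra|]. intros x. unfold phi.
    apply Rmult_lt_0_compat; apply Rpower_pos. }
  set (c := / (G 1 - G 0)). assert (Hc : 0 < c) by (apply Rinv_0_lt_compat; lra).
  exists (fun x => c * Rpower x (a - 1) * Rpower (1 - x) (b - 1)). split.
  - exists c. auto.
  - exists (fun x => c * G x). split; [|split].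
    + intros x _. apply (limit1_in_continuity (fun x => c * G x)).
      apply continuity_pt_mult; auto. apply continuity_pt_const. now intros ? ?.
    + intros x Hx. rewrite Rmult_assoc. apply derivable_pt_lim_scal. now apply Gd.
    + unfold c. field. lra.
Qed.

Lemma beta_moments a b f s :
  0 < a -> 0 < b -> beta_density a b f ->
  improper_int 0 1 (fun x => x ^ s * f x) (rbin a s / rbin (a + b) s).
Proof.
  intros Ha Hb [[c [Hc Hf]] Hint]. induction s as [|s [G [G1 [G2 G3]]]].
  - destruct Hint as [G [G1 [G2 G3]]]. exists G. split; [auto|split].
    + intros x Hx. simpl. rewrite Rmult_1_l. auto.
    + simpl. lra.
  - pose proof (pos_INR s) as Hs.
    (* T vanishes at 0 and 1, and c T' = (a+s) x^s f - (a+b+s) x^(s+1) f. Solving for x^(s+1) f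
       gives the coefficients [k1] and [k2]. *)
    set (T := fun x => rpow0 x (a + INR s) * rpow0 (1 - x) b).
    assert (Tc : forall x, continuity_pt T x).
    { intros x. apply continuity_pt_mult; [apply continuity_rpow0; lra|].
      apply (continuity_one_minus (fun z => rpow0 z b)). now apply continuity_rpow0. }
    set (k1 := (a + INR s) / (a + b + INR s)). set (k2 := c / (a + b + INR s)).
    exists (fun x => k1 * G x - k2 * T x). split; [|split].
    + intros x Hx. apply limit_minus.
      * apply limit_mul; auto. apply (limit1_in_continuity (fun _ => k1)).
        apply continuity_pt_const. now intros ? ?.
      * apply limit_mul; apply limit1_in_continuity; auto.
        apply continuity_pt_const. now intros ? ?.
    + intros x Hx. specialize (G2 x Hx). cbv beta in G2.
      replace (x ^ S s * f x) with (k1 * (x ^ s * f x)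
        - k2 * ((a + INR s) * Rpower x (a + INR s - 1) * rpow0 (1 - x) b
                + rpow0 x (a + INR s) * (- (b * Rpower (1 - x) (b - 1))))).
      * apply derivable_pt_lim_minus; [now apply derivable_pt_lim_scal|].
        apply (derivable_pt_lim_scal T).
        apply (derivable_pt_lim_mult (fun x => rpow0 x (a + INR s)) (fun x => rpow0 (1 - x) b)).
        -- apply derivable_rpow0. lra.
        -- apply (derivable_one_minus (fun z => rpow0 z b)). apply derivable_rpow0. lra.
      * rewrite !rpow0_pos, Hf by lra.
        rewrite (Rpower_minus_1 x (a + INR s)), (Rpower_minus_1 (1 - x) b) by lra.
        replace (a + INR s - 1) with (INR s + (a - 1)) by ring.
        rewrite Rpower_plus, Rpower_pow by lra. unfold k1, k2. simpl. field. lra.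
    + unfold T. rewrite Rminus_diag, !rpow0_0.
      pose proof (rbin_pos (a + b) s ltac:(lra)). pose proof (INR_S_pos s).
      replace (k1 * G 1 - k2 * (rpow0 1 (a + INR s) * 0)
               - (k1 * G 0 - k2 * (0 * rpow0 (1 - 0) b))) with (k1 * (G 1 - G 0)) by ring.
      rewrite G3. unfold k1. cbn [rbin]. field. lra.
Qed.

Lemma derivable_exp_opp x : derivable_pt_lim (fun y => exp (- y)) x (- exp (- x)).
Proof.
  replace (- exp (- x)) with (exp (- x) * - (1)) by ring.
  apply (derivable_pt_lim_comp (fun y => - y) exp).
  - apply derivable_pt_lim_opp, derivable_pt_lim_id.
  - apply derivable_pt_lim_exp.
Qed.

(** For a <= 1 the integrand is at most exp (- x) beyond 1, so G x + exp (- x) does not increase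
    there. Hence the increasing G is bounded, and its supremum supplies the normalizing constant. *)
Lemma gamma_density_exists a : 0 < a <= 1 -> exists f, gamma_density a f.
Proof.
  intros Ha.
  destruct (power_primitive a (fun y => exp (- y)) ltac:(lra)) as [G [Gc Gd]].
  { intros x. eapply derivable_continuity. apply derivable_exp_opp. }
  assert (Ginc : forall x y, 0 <= x < y -> G x < G y).
  { intros x y Hxy. apply increment_pos with (fun x => Rpower x (a - 1) * exp (- x)); auto.
    - lra.
    - intros z Hz. apply Gd. lra.
    - intros z. apply Rmult_lt_0_compat; [apply Rpower_pos|apply exp_pos]. }
  assert (Gub : forall x, 1 <= x -> G x <= G 1 + exp (- (1))).
  { intros x [Hx| <-]; [|pose proof (exp_pos (- (1))); lra].
    destruct (MVT_cor2 (fun y => G y + exp (- y))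
      (fun y => Rpower y (a - 1) * exp (- y) + - exp (- y)) 1 x Hx) as [z [Hz1 Hz2]].
    { intros z Hz. apply derivable_pt_lim_plus; [apply Gd; lra|apply derivable_exp_opp]. }
    assert (Hz : Rpower z (a - 1) <= 1).
    { apply Rle_trans with (Rpower z 0); [apply Rle_Rpower; lra|rewrite Rpower_O; lra]. }
    pose proof (exp_pos (- z)). pose proof (exp_pos (- x)).
    assert (Hn : Rpower z (a - 1) * exp (- z) + - exp (- z) <= 0) by nra.
    assert ((Rpower z (a - 1) * exp (- z) + - exp (- z)) * (x - 1) <= 0) by nra. lra. }
  destruct (completeness (fun v => exists x, 1 <= x /\ v = G x)) as [L [HL1 HL2]].
  { exists (G 1 + exp (- (1))). intros v [x [Hx ->]]. auto. }
  { exists (G 1), 1. split; [lra|auto]. }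
  assert (HL : G 0 < L).
  { apply Rlt_le_trans with (G 1); [apply Ginc; lra|]. apply HL1. exists 1. split; [lra|auto]. }
  set (c := / (L - G 0)). assert (Hc : 0 < c) by (apply Rinv_0_lt_compat; lra).
  exists (fun x => c * Rpower x (a - 1) * exp (- x)). split.
  - exists c. auto.
  - exists (fun x => c * G x). split; [|split].
    + intros x _. apply (limit1_in_continuity (fun x => c * G x)).
      apply continuity_pt_mult; auto. apply continuity_pt_const. now intros ? ?.
    + intros x Hx. rewrite Rmult_assoc. apply derivable_pt_lim_scal. now apply Gd.
    + intros eps He.
      assert (Hex : exists x, 1 <= x /\ L - eps / c < G x).
      { apply Classical_Prop.NNPP. intros Hn.
        assert (L <= L - eps / c).
        { apply HL2. intros v [x [Hx ->]]. apply Rnot_lt_le. intros Hlt. apply Hn. eauto. }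
        assert (0 < eps / c) by now apply Rdiv_lt_0_compat. lra. }
      destruct Hex as [m [Hm1 Hm2]]. exists m. intros x Hx.
      assert (G m < G x) by (apply Ginc; lra).
      assert (G x <= L) by (apply HL1; exists x; split; [lra|auto]).
      replace (c * G x - c * G 0 - 1) with (c * (G x - L)) by (unfold c; field; lra).
      rewrite Rabs_mult, (Rabs_pos_eq c) by lra. rewrite Rabs_left1 by lra.
      apply Rlt_le_trans with (c * (eps / c)); [apply Rmult_lt_compat_l; lra|].
      apply Req_le. field. lra.
Qed.

(** With q = p + 1, exp x = (exp (x/q))^q >= (x/q)^q, so x^p exp (- x) <= q^q / x. *)
Lemma power_exp_vanishes p eps :
  0 < p -> 0 < eps -> exists M, 0 < M /\ forall x, M < x -> Rpower x p * exp (- x) < eps.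
Proof.
  intros Hp He. set (q := p + 1). pose proof (Rpower_pos q q) as Hq.
  exists (Rpower q q / eps). split; [now apply Rdiv_lt_0_compat|]. intros x Hx.
  assert (Hx0 : 0 < x) by (apply Rlt_trans with (2 := Hx); now apply Rdiv_lt_0_compat).
  assert (H1 : Rpower (x / q) q <= exp x).
  { apply Rle_trans with (Rpower (exp (x / q)) q).
    - apply Rle_Rpower_l; [unfold q; lra|]. split; [apply Rdiv_lt_0_compat; unfold q; lra|].
      pose proof (exp_ineq1_le (x / q)). lra.
    - unfold Rpower. rewrite ln_exp. apply Req_le. f_equal. field. unfold q. lra. }
  rewrite Rpower_div in H1 by (unfold q; lra).
  replace (Rpower x q) with (Rpower x p * x) in H1
    by (unfold q; now rewrite Rpower_plus, Rpower_1).
  pose proof (exp_pos x) as Hex. pose proof (Rpower_pos x p) as Hxp.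
  rewrite exp_Ropp. apply Rmult_lt_reg_r with (exp x); auto.
  rewrite Rmult_assoc, Rinv_l, Rmult_1_r by lra.
  apply Rlt_le_trans with (eps * (Rpower x p * x / Rpower q q)).
  - apply (Rmult_lt_compat_r eps) in Hx; auto.
    replace (Rpower q q / eps * eps) with (Rpower q q) in Hx by (field; lra).
    apply Rmult_lt_reg_r with (Rpower q q); auto.
    replace (eps * (Rpower x p * x / Rpower q q) * Rpower q q) with (Rpower x p * (x * eps))
      by (field; lra).
    apply Rmult_lt_compat_l; auto.
  - apply Rmult_le_compat_l; lra.
Qed.

Lemma gamma_moments a f s :
  0 < a <= 1 -> gamma_density a f ->
  improper_int_inf 0 (fun x => x ^ s * f x) (INR (fact s) * rbin a s).
Proof.
  intros Ha [[c [Hc Hf]] Hint]. induction s as [|s [G [G1 [G2 G3]]]].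
  - destruct Hint as [G [G1 [G2 G3]]]. exists G. split; [auto|split].
    + intros x Hx. simpl. rewrite Rmult_1_l. auto.
    + simpl. now rewrite Rmult_1_l.
  - pose proof (pos_INR s) as Hs.
    (* T vanishes at 0 and at infinity, and c T' = (a+s) x^s f - x^(s+1) f. *)
    set (T := fun x => rpow0 x (a + INR s) * exp (- x)).
    assert (Tc : forall x, continuity_pt T x).
    { intros x. apply continuity_pt_mult; [apply continuity_rpow0; lra|].
      eapply derivable_continuity. apply derivable_exp_opp. }
    exists (fun x => (a + INR s) * G x - c * T x). split; [|split].
    + intros x Hx. apply limit_minus.
      * apply limit_mul; auto. apply (limit1_in_continuity (fun _ => a + INR s)).
        apply continuity_pt_const. now intros ? ?.
      * apply limit_mul; apply limit1_in_continuity; auto.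
        apply continuity_pt_const. now intros ? ?.
    + intros x Hx. specialize (G2 x Hx). cbv beta in G2.
      replace (x ^ S s * f x) with ((a + INR s) * (x ^ s * f x)
        - c * ((a + INR s) * Rpower x (a + INR s - 1) * exp (- x)
                + rpow0 x (a + INR s) * (- exp (- x)))).
      * apply derivable_pt_lim_minus; [now apply derivable_pt_lim_scal|].
        apply (derivable_pt_lim_scal T).
        apply (derivable_pt_lim_mult (fun x => rpow0 x (a + INR s)) (fun x => exp (- x))).
        -- apply derivable_rpow0. lra.
        -- apply derivable_exp_opp.
      * rewrite !rpow0_pos, Hf by lra.
        rewrite (Rpower_minus_1 x (a + INR s)) by lra.
        replace (a + INR s - 1) with (INR s + (a - 1)) by ring.
        rewrite Rpower_plus, Rpower_pow by lra. simpl. ring.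
    + intros eps He.
      destruct (G3 (eps / 2 / (a + INR s))) as [m1 Hm1]; [repeat apply Rdiv_lt_0_compat; lra|].
      destruct (power_exp_vanishes (a + INR s) (eps / 2 / c)) as [m2 [Hm20 Hm2]];
        [lra|repeat apply Rdiv_lt_0_compat; lra|].
      exists (Rmax m1 m2). intros x Hx.
      pose proof (Rmax_l m1 m2). pose proof (Rmax_r m1 m2).
      specialize (Hm1 x ltac:(lra)). specialize (Hm2 x ltac:(lra)).
      assert (Hfs : INR (fact (S s)) * rbin a (S s) = (a + INR s) * (INR (fact s) * rbin a s)).
      { change (fact (S s)) with (S s * fact s)%nat. rewrite mult_INR.
        rewrite Rmult_assoc, (Rmult_comm (INR (fact s))), <- Rmult_assoc, rbin_S. ring. }
      rewrite Hfs. unfold T. rewrite rpow0_0, rpow0_pos by lra.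
      replace ((a + INR s) * G x - c * (Rpower x (a + INR s) * exp (- x))
               - ((a + INR s) * G 0 - c * (0 * exp (- 0))) - (a + INR s) * (INR (fact s) * rbin a s))
        with ((a + INR s) * (G x - G 0 - INR (fact s) * rbin a s)
              + - (c * (Rpower x (a + INR s) * exp (- x)))) by ring.
      eapply Rle_lt_trans; [apply Rabs_triang|].
      rewrite Rabs_Ropp, !Rabs_mult, (Rabs_pos_eq (a + INR s)), (Rabs_pos_eq c),
        (Rabs_pos_eq (Rpower _ _)), (Rabs_pos_eq (exp _))
        by (try (left; apply Rpower_pos); try (left; apply exp_pos); lra).
      apply (Rmult_lt_compat_l (a + INR s)) in Hm1; [|lra].
      apply (Rmult_lt_compat_l c) in Hm2; [|lra].
      replace ((a + INR s) * (eps / 2 / (a + INR s))) with (eps / 2) in Hm1 by (field; lra).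
      replace (c * (eps / 2 / c)) with (eps / 2) in Hm2 by (field; lra). lra.
Qed.

(** * The negative binomial regime and the theorem *)

(** The limit of the mass at 0, squeezed between the two scaled bounds. The value rho = 1 is
    included and yields the degenerate regime. *)
Lemma rbin_ratio_cv a (b : nat -> R) (N : nat -> nat) n1 rho :
  0 < a <= 1 -> 0 < rho -> (forall n, (n1 <= n)%nat -> 1 <= b n) ->
  Un_cv (fun n => / b n) 0 -> Un_cv (fun n => b n / (b n + INR (N n))) rho ->
  Un_cv (fun n => rbin (b n) (N n) / rbin (a + b n) (N n)) (Rpower rho a).
Proof.
  intros Ha Hrho Hb1 Hb Hh.
  assert (Hp : Un_cv (fun n => Rpower (b n / (b n + INR (N n))) a) (Rpower rho a)).
  { apply (continuity_seq (fun y => Rpower y a) _ rho); auto. now apply continuity_pt_Rpower. }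
  apply Un_cv_squeeze_loc with (n0 := n1)
    (u := fun n => (1 - (1 - a) * / b n) * Rpower (b n / (b n + INR (N n))) a)
    (w := fun n => Rpower (b n / (b n + INR (N n))) a); auto.
  - intros n Hn. specialize (Hb1 n Hn).
    split; [now apply rbin_ratio_lower_scaled|apply rbin_ratio_upper; lra].
  - replace (Rpower rho a) with ((1 - (1 - a) * 0) * Rpower rho a) by ring.
    apply CV_mult; auto. apply CV_minus; [apply Un_cv_const|].
    apply CV_mult; [apply Un_cv_const|auto].
Qed.

Lemma polya_0 a b N : 0 < a -> 0 < b -> polya a b N 0 = rbin b N / rbin (a + b) N.
Proof.
  intros Ha Hb. rewrite polya_factor by (auto; lia). rewrite Nat.sub_0_r. cbn [rbin].
  rewrite (Rdiv_diag (rbin b N)) by (apply Rgt_not_eq, rbin_pos; lra). ring.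
Qed.

(** By induction on i: consecutive masses have the quotient (a+i)/(i+1) * (N-i)/(N-i-1+b), whose
    last factor tends to 1 - rho. *)
Lemma polya_negbin_cv a (b : nat -> R) (N : nat -> nat) n1 rho :
  0 < a <= 1 -> 0 < rho < 1 -> (forall n, (n1 <= n)%nat -> 1 <= b n) ->
  Un_cv (fun n => / b n) 0 -> Un_cv (fun n => b n / (b n + INR (N n))) rho ->
  forall i, Un_cv (fun n => polya a (b n) (N n) i) (rbin a i * Rpower rho a * (1 - rho) ^ i).
Proof.
  intros Ha Hrho Hb1 Hb Hh.
  assert (Hinv : Un_cv (fun n => / (b n + INR (N n))) 0).
  { apply Un_cv_squeeze_loc with (n0 := n1) (u := fun _ => 0) (w := fun n => / b n);
      [|apply Un_cv_const|auto].
    intros n Hn. specialize (Hb1 n Hn). pose proof (pos_INR (N n)).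
    split; [left; apply Rinv_0_lt_compat; lra|apply Rinv_le_contravar; lra]. }
  assert (Hscale : forall c, Un_cv (fun n => c * / (b n + INR (N n))) 0).
  { intros c. replace 0 with (c * 0) by ring. apply CV_mult; auto. apply Un_cv_const. }
  induction i as [|i IH].
  - simpl. rewrite Rmult_1_l, Rmult_1_r.
    apply Un_cv_ext_loc with (n0 := n1)
      (u := fun n => rbin (b n) (N n) / rbin (a + b n) (N n)).
    + intros n Hn. specialize (Hb1 n Hn). rewrite polya_0; auto; lra.
    + apply rbin_ratio_cv with n1; auto; lra.
  (* [w c n] equals (N - c) / (b + N); its positivity at c = i + 1 guarantees i + 1 < N. *)
  - set (w := fun c n => 1 - b n / (b n + INR (N n)) - c * / (b n + INR (N n))).
    assert (Hw : forall c, Un_cv (w c) (1 - rho)).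
    { intros c. replace (1 - rho) with (1 - rho - 0) by ring.
      apply CV_minus; auto. apply CV_minus; auto. apply Un_cv_const. }
    destruct (Un_cv_eventually _ _ ((1 - rho) / 2) (Hw (INR (S i)))) as [n2 H2]; [lra|].
    apply Un_cv_ext_loc with (n0 := (n1 + n2)%nat)
      (u := fun n => polya a (b n) (N n) i * ((a + INR i) / INR (S i)
              * (w (INR i) n / (1 - INR (S i) * / (b n + INR (N n)))))).
    + intros n Hn. specialize (Hb1 n ltac:(lia)). specialize (H2 n ltac:(lia)).
      pose proof (pos_INR (N n)) as HN. apply Rabs_le_between in H2.
      assert (Hlt : INR (S i) < INR (N n)).
      { assert (Hpos : 0 < w (INR (S i)) n) by lra. unfold w in Hpos.
        replace (1 - b n / (b n + INR (N n)) - INR (S i) * / (b n + INR (N n)))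
          with ((INR (N n) - INR (S i)) * / (b n + INR (N n))) in Hpos by (field; lra).
        apply Rnot_le_lt. intros Hle.
        assert (0 < / (b n + INR (N n))) by (apply Rinv_0_lt_compat; lra). nra. }
      apply INR_lt in Hlt as Hlt'. pose proof (INR_S_pos i).
      rewrite !(polya_factor a (b n)) by (lra || lia).
      rewrite rbin_back_ratio_S by (lra || lia). cbn [rbin].
      pose proof (rbin_pos (b n) (N n) ltac:(lra)).
      pose proof (rbin_pos (a + b n) (N n) ltac:(lra)).
      unfold w. field. lra.
    + replace (rbin a (S i) * Rpower rho a * (1 - rho) ^ S i)
        with (rbin a i * Rpower rho a * (1 - rho) ^ i
              * ((a + INR i) / INR (S i) * ((1 - rho) / (1 - 0)))).
      * apply CV_mult; auto. apply CV_mult; [apply Un_cv_const|].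
        apply Un_cv_div; auto; [|lra]. apply CV_minus; auto. apply Un_cv_const.
      * cbn [rbin pow]. pose proof (INR_S_pos i). field. lra.
Qed.

Lemma Un_cv_limit_eq u l l' : l = l' -> Un_cv u l -> Un_cv u l'.
Proof. now intros ->. Qed.

Lemma index_shift_cv (u : nat -> nat) t :
  tends_to_inf u -> Un_cv (fun n => (INR (u n) - 1 + t) / INR (u n)) 1.
Proof.
  intros Hu. destruct (tends_pos u Hu) as [n0 H0].
  apply Un_cv_ext_loc with (n0 := n0) (u := fun n => 1 - (1 - t) * / INR (u n)).
  - intros n Hn. specialize (H0 n Hn). field. lra.
  - apply (Un_cv_limit_eq _ (1 - (1 - t) * 0)); [ring|].
    apply CV_minus; [apply Un_cv_const|]. apply CV_mult; [apply Un_cv_const|].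
    now apply Un_cv_inv_tends.
Qed.

Lemma tends_id : tends_to_inf (fun n => n).
Proof. intros m. exists m. auto. Qed.

(** As b + N = n - 1 + t, the mesh b / (b + N) of the local limit is equivalent to the scale j / n
    of the statement. *)
Lemma urn_ratio_cv (jn : nat -> nat) t :
  0 < t -> (forall n, (1 <= n)%nat -> (1 <= jn n <= n)%nat) -> tends_to_inf jn ->
  Un_cv (fun n => (INR (jn n) - 1 + t) / (INR (jn n) - 1 + t + INR (n - jn n))
                  / (INR (jn n) / INR n)) 1.
Proof.
  intros Ht Hj Hinf.
  apply Un_cv_ext_loc with (n0 := 1%nat)
    (u := fun n => ((INR (jn n) - 1 + t) / INR (jn n)) / ((INR n - 1 + t) / INR n)).
  - intros n Hn. destruct (Hj n Hn) as [H1 H2]. rewrite minus_INR by lia.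
    apply le_INR in H1, H2. simpl in H1. field. lra.
  - apply (Un_cv_limit_eq _ (1 / 1)); [field|].
    apply Un_cv_div; [now apply index_shift_cv| |lra].
    apply (index_shift_cv (fun n => n)), tends_id.
Qed.

Lemma urn_fraction_cv (jn : nat -> nat) t rho :
  0 < t -> (forall n, (1 <= n)%nat -> (1 <= jn n <= n)%nat) -> tends_to_inf jn ->
  Un_cv (fun n => INR (jn n) / INR n) rho ->
  Un_cv (fun n => (INR (jn n) - 1 + t) / (INR (jn n) - 1 + t + INR (n - jn n))) rho.
Proof.
  intros Ht Hj Hinf Hrho.
  pose proof (CV_mult _ _ _ _ (urn_ratio_cv jn t Ht Hj Hinf) Hrho) as H.
  rewrite Rmult_1_l in H. revert H.
  apply Un_cv_ext_loc with (n0 := 1%nat). intros n Hn.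
  destruct (Hj n Hn) as [H1 H2]. rewrite minus_INR by lia.
  apply le_INR in H1, H2. simpl in H1. field. lra.
Qed.

Lemma urn_weight_inv_cv (jn : nat -> nat) t :
  tends_to_inf jn -> Un_cv (fun n => / (INR (jn n) - 1 + t)) 0.
Proof.
  intros Hinf. apply (Un_cv_limit_eq _ (0 / 1)); [field|].
  destruct (tends_pos jn Hinf) as [n0 H0].
  destruct (Un_cv_eventually _ _ (1 / 2) (index_shift_cv jn t Hinf)) as [n1 H1]; [lra|].
  apply Un_cv_ext_loc with (n0 := (n0 + n1)%nat)
    (u := fun n => / INR (jn n) / ((INR (jn n) - 1 + t) / INR (jn n))).
  - intros n Hn. specialize (H0 n ltac:(lia)). specialize (H1 n ltac:(lia)).
    cbv beta in H1. apply Rabs_le_between in H1. field. split; [|lra].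
    intros E. rewrite E in H1. unfold Rdiv in H1. lra.
  - apply Un_cv_div; [now apply Un_cv_inv_tends|now apply index_shift_cv|lra].
Qed.

Lemma urn_weight_ge_1 (jn : nat -> nat) t :
  0 < t -> tends_to_inf jn ->
  exists n1, forall n, (n1 <= n)%nat -> 1 <= INR (jn n) - 1 + t.
Proof.
  intros Ht Hinf. destruct (Hinf 2%nat) as [n1 H1]. exists n1. intros n Hn.
  specialize (H1 n Hn). apply le_INR in H1. simpl in H1. lra.
Qed.

Theorem theorem5 (k : nat) (hk : (1 <= k)%nat) :
  (* exact distribution *)
  (forall n j m : nat, (1 <= j <= n)%nat -> (1 <= m)%nat ->
     prob k n (fun t => Nat.eqb (ndesc k t j) m) =
       gbinom (INR m - 1 - 1 / (INR k + 1)) (m - 1)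
       * gbinomZ (INR n - INR m - 1 + 2 / (INR k + 1))
                 (Z.of_nat n - Z.of_nat m - Z.of_nat j + 1)%Z
       / gbinom (INR n - INR k / (INR k + 1)) (n - j)) /\
  (* (i) fixed j: Beta limit law *)
  (forall j : nat, (1 <= j)%nat ->
     (exists f, beta_density (INR k / (INR k + 1)) (INR j - 1 + 2 / (INR k + 1)) f) /\
     forall f, beta_density (INR k / (INR k + 1)) (INR j - 1 + 2 / (INR k + 1)) f ->
       (forall s : nat,
          improper_int 0 1 (fun x => x ^ s * f x)
            (gbinom (INR s - 1 / (INR k + 1)) s
             / gbinom (INR s + INR j - INR k / (INR k + 1)) s)) /\
       (forall x v, cdf01 f x v ->
          Un_cv (fun n => prob k n (fun t => Rle_bool (INR (ndesc k t j) / INR n) x)) v)) /\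
  (* (ii) j -> oo, j = o(n): Gamma limit law *)
  (forall jn : nat -> nat,
     (forall n, (1 <= n)%nat -> (1 <= jn n <= n)%nat) ->
     tends_to_inf jn ->
     Un_cv (fun n => INR (jn n) / INR n) 0 ->
     (exists f, gamma_density (INR k / (INR k + 1)) f) /\
     forall f, gamma_density (INR k / (INR k + 1)) f ->
       (forall s : nat,
          improper_int_inf 0 (fun x => x ^ s * f x)
            (INR (fact s) * gbinom (INR s - 1 / (INR k + 1)) s)) /\
       (forall x v, cdf0inf f x v ->
          Un_cv (fun n => prob k n
                   (fun t => Rle_bool (INR (jn n) / INR n * INR (ndesc k (t) (jn n))) x)) v)) /\
  (* (iii) j ~ rho n: negative binomial limit law for X_{n,j} - 1 *)
  (forall (jn : nat -> nat) (rho : R),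
     0 < rho < 1 ->
     (forall n, (1 <= n)%nat -> (1 <= jn n <= n)%nat) ->
     tends_to_inf jn ->
     Un_cv (fun n => INR (jn n) / (rho * INR n)) 1 ->
     let p := fun m : nat =>
       gbinom (INR m - 1 / (INR k + 1)) m * Rpower rho (INR k / (INR k + 1))
       * (1 - rho) ^ m in
     (forall x, x < 0 ->
        Un_cv (fun n => prob k n (fun t => Rle_bool (INR (ndesc k t (jn n)) - 1) x)) 0) /\
     (forall (N : nat) (x : R), INR N < x < INR N + 1 ->
        Un_cv (fun n => prob k n (fun t => Rle_bool (INR (ndesc k t (jn n)) - 1) x))
              (sum_f_R0 p N))) /\
  (* (iv) j -> oo, n - j = o(n) *)
  (forall jn : nat -> nat,
     (forall n, (1 <= n)%nat -> (1 <= jn n <= n)%nat) ->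
     tends_to_inf jn ->
     Un_cv (fun n => (INR n - INR (jn n)) / INR n) 0 ->
     Un_cv (fun n => prob k n (fun t => Nat.eqb (ndesc k t (jn n)) 1)) 1).
Proof.
  pose proof (le_INR _ _ hk) as Hk. simpl in Hk.
  set (a := INR k / (INR k + 1)) in *. set (t0 := 2 / (INR k + 1)) in *.
  assert (Ha' : 1 / (INR k + 1) = 1 - a) by (unfold a; field; lra).
  assert (Ht' : t0 = 2 * (1 - a)) by (unfold t0; rewrite <- Ha'; field; lra).
  assert (Ha1 : 0 < 1 - a).
  { rewrite <- Ha'. apply Rdiv_lt_0_compat; lra. }
  assert (Ha0 : 0 < a) by (apply Rdiv_lt_0_compat; lra).
  assert (Ht0 : 0 < t0) by lra.
  assert (Ha : 0 < a <= 1) by lra.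
  assert (Hgb : forall i, gbinom (INR i - 1 / (INR k + 1)) i = rbin a i).
  { intros i. rewrite <- gbinom_rbin. f_equal. rewrite Ha'. ring. }
  split; [|split; [|split; [|split]]].
  - intros n j m Hj Hm. destruct m as [|i]; [lia|]. rewrite ndesc_law by auto.
    fold a t0. simpl Nat.sub. rewrite Nat.sub_0_r.
    assert (HjR : 1 <= INR j) by (apply (le_INR 1); lia).
    replace (INR (S i) - 1 - 1 / (INR k + 1)) with (INR i - 1 / (INR k + 1))
      by (rewrite S_INR; ring).
    rewrite Hgb.
    (* Since t0 = 2 (1 - a), the urn parameters a and b add up to j + 1 - a. *)
    replace (INR n - a) with (a + (INR j - 1 + t0) + INR (n - j) - 1)
      by (rewrite minus_INR by lia; lra).
    rewrite gbinom_rbin. unfold gbinomZ, polya.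
    (* When m - 1 > n - j both sides vanish: the urn law by definition, the binomial by its negative
       lower index. *)
    destruct (Nat.leb_spec i (n - j)); destruct (Z.ltb_spec (Z.of_nat n - Z.of_nat (S i) - Z.of_nat j + 1) 0); try lia.
    + replace (Z.to_nat (Z.of_nat n - Z.of_nat (S i) - Z.of_nat j + 1)) with (n - j - i)%nat by lia.
      replace (INR n - INR (S i) - 1 + t0) with (INR j - 1 + t0 + INR (n - j - i) - 1)
        by (rewrite !minus_INR, S_INR by lia; ring).
      now rewrite gbinom_rbin.
    + unfold Rdiv. ring.
  - intros j Hj. assert (HjR : 1 <= INR j) by (apply (le_INR 1); lia).
    assert (Hb : 0 < INR j - 1 + t0) by lra.
    split; [now apply beta_density_exists|]. intros f Hf. split.
    + intros s. pose proof (beta_moments _ _ f s Ha0 Hb Hf) as H.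
      rewrite Hgb. replace (INR s + INR j - a) with (a + (INR j - 1 + t0) + INR s - 1) by lra.
      now rewrite gbinom_rbin.
    + intros x v [[Hx ->]|[[Hx Hv]|[Hx ->]]].
      * apply Un_cv_ext_loc with (n0 := j) (u := fun _ => 0); [|apply Un_cv_const].
        intros n Hn. symmetry.
        apply (prob_ndesc_none k n j (fun m => Rle_bool (INR m / INR n) x)); [lia|].
        intros m Hm. destruct (Rle_bool_spec (INR m / INR n) x) as [H|H]; auto. exfalso.
        assert (0 < INR m / INR n) by (apply Rdiv_lt_0_compat; apply lt_0_INR; lia). lra.
      * destruct (Un_cv_eventually _ _ x Un_cv_inv_INR ltac:(lra)) as [n1 H1].
        apply Un_cv_ext_loc with (n0 := (j + n1)%nat)
          (u := fun n => sum_f_R0 (polya a (INR j - 1 + t0) (n - j)) (floor_nat (x / / INR n) - 1)).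
        { intros n Hn. symmetry. unfold a, t0.
          apply (prob_ndesc_le k n j _ (fun m => Rle_bool (INR m / INR n) x)); auto; [lia|].
          intros m _. specialize (H1 n ltac:(lia)). rewrite Rminus_0_r in H1.
          apply (Rle_trans _ _ _ (Rle_abs _)) in H1.
          unfold Rdiv at 1. rewrite Rmult_comm. apply scaled_cutoff. split; auto.
          apply Rinv_0_lt_compat, lt_0_INR. lia. }
        apply (polya_beta_cdf a (INR j - 1 + t0) f x v (fun n => n - j)%nat
                 (fun n => floor_nat (x / / INR n) - 1)%nat); auto.
        { intros m. exists (m + j)%nat. intros n Hn. lia. }
        (* The event is scaled by 1 / n while the urn makes n - j draws; for fixed j the two meshes
           are equivalent. *)
        apply (scaled_cutoff_cv (fun n => / INR n) (fun n => / INR (n - j)) x 1); [lra| | |].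
        { intros n Hn. apply Rinv_0_lt_compat, lt_0_INR. lia. }
        { apply Un_cv_inv_INR. }
        apply Un_cv_ext_loc with (n0 := S j) (u := fun n => 1 / (1 - INR j * / INR n)).
        { intros n Hn. rewrite minus_INR by lia.
          assert (INR j < INR n) by (apply lt_INR; lia). field. lra. }
        apply (Un_cv_limit_eq _ (1 / (1 - INR j * 0))); [field|].
        apply Un_cv_div; [apply Un_cv_const| |lra].
        apply CV_minus; [apply Un_cv_const|]. apply CV_mult; [apply Un_cv_const|apply Un_cv_inv_INR].
      * apply Un_cv_ext_loc with (n0 := j) (u := fun _ => 1); [|apply Un_cv_const].
        intros n Hn. symmetry.
        apply (prob_ndesc_all k n j (fun m => Rle_bool (INR m / INR n) x)); [lia|].
        intros m Hm. destruct (Rle_bool_spec (INR m / INR n) x) as [H|H]; auto. exfalso. apply H.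
        assert (0 < INR n) by (apply lt_0_INR; lia). apply le_INR in Hm.
        apply Rle_trans with 1; auto. apply Rmult_le_reg_r with (INR n); auto.
        unfold Rdiv. rewrite Rmult_assoc, Rinv_l; lra.
  - intros jn Hj Hinf H0. split; [now apply gamma_density_exists|]. intros f Hf. split.
    + intros s. rewrite Hgb. now apply gamma_moments.
    + intros x v Hcdf.
      assert (Hs : forall n, (1 <= n)%nat -> 0 < INR (jn n) / INR n).
      { intros n Hn. specialize (Hj n Hn). apply Rdiv_lt_0_compat; apply lt_0_INR; lia. }
      destruct Hcdf as [[Hx ->]|[Hx Hv]].
      * apply Un_cv_ext_loc with (n0 := 1%nat) (u := fun _ => 0); [|apply Un_cv_const].
        intros n Hn. symmetry.
        apply (prob_ndesc_none k n (jn n) (fun m => Rle_bool (INR (jn n) / INR n * INR m) x)); auto.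
        intros m Hm. destruct (Rle_bool_spec (INR (jn n) / INR n * INR m) x) as [H|H]; auto. exfalso.
        specialize (Hs n Hn). apply le_INR in Hm. simpl in Hm.
        assert (0 < INR (jn n) / INR n * INR m) by (apply Rmult_lt_0_compat; lra). lra.
      * destruct (Un_cv_eventually _ _ x H0 ltac:(lra)) as [n1 H1].
        destruct (urn_weight_ge_1 jn t0 Ht0 Hinf) as [n2 H2].
        apply Un_cv_ext_loc with (n0 := S n1)
          (u := fun n => sum_f_R0 (polya a (INR (jn n) - 1 + t0) (n - jn n))
                                  (floor_nat (x / (INR (jn n) / INR n)) - 1)).
        { intros n Hn. symmetry. unfold a, t0.
          apply (prob_ndesc_le k n (jn n) _ (fun m => Rle_bool (INR (jn n) / INR n * INR m) x)); auto.
          - apply Hj. lia.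
          - intros m _. specialize (H1 n ltac:(lia)). rewrite Rminus_0_r in H1.
            apply (Rle_trans _ _ _ (Rle_abs _)) in H1.
            apply scaled_cutoff. split; auto. apply Hs. lia. }
        apply (polya_gamma_cdf a f x v (fun n => INR (jn n) - 1 + t0) (fun n => n - jn n)%nat
                 (fun n => floor_nat (x / (INR (jn n) / INR n)) - 1)%nat n2); auto.
        { now apply urn_weight_inv_cv. }
        { now apply urn_fraction_cv. }
        apply (scaled_cutoff_cv (fun n => INR (jn n) / INR n)
          (fun n => (INR (jn n) - 1 + t0) / (INR (jn n) - 1 + t0 + INR (n - jn n))) x 1); auto.
        now apply urn_ratio_cv.
  - intros jn rho Hrho Hj Hinf Hlim p.
    assert (Hfrac : Un_cv (fun n => INR (jn n) / INR n) rho).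
    { apply (Un_cv_limit_eq _ (rho * 1)); [ring|].
      apply Un_cv_ext_loc with (n0 := 1%nat) (u := fun n => rho * (INR (jn n) / (rho * INR n))).
      - intros n Hn. assert (0 < INR n) by (apply lt_0_INR; lia). field. lra.
      - apply CV_mult; auto. apply Un_cv_const. }
    destruct (urn_weight_ge_1 jn t0 Ht0 Hinf) as [n2 H2].
    split.
    + intros x Hx. apply Un_cv_ext_loc with (n0 := 1%nat) (u := fun _ => 0); [|apply Un_cv_const].
      intros n Hn. symmetry.
      apply (prob_ndesc_none k n (jn n) (fun m => Rle_bool (INR m - 1) x)); auto.
      intros m Hm. destruct (Rle_bool_spec (INR m - 1) x) as [H|H]; auto. exfalso.
      apply le_INR in Hm. simpl in Hm. lra.
    + intros N x Hx. apply Un_cv_ext_loc with (n0 := 1%nat)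
        (u := fun n => sum_f_R0 (polya a (INR (jn n) - 1 + t0) (n - jn n)) N).
      * intros n Hn. symmetry. unfold a, t0.
        apply (prob_ndesc_le k n (jn n) _ (fun m => Rle_bool (INR m - 1) x)); auto.
        intros m _. destruct (Rle_bool_spec (INR m - 1) x) as [H|H];
          destruct (Nat.leb_spec m (S N)) as [H'|H']; auto; exfalso.
        -- apply le_INR in H'. rewrite !S_INR in H'. lra.
        -- apply H. apply le_INR in H'. rewrite S_INR in H'. lra.
      (* The distribution function at x is a sum over the fixed range 0, ..., N, so convergence of
         the point masses is enough. *)
      * assert (Hp : forall i, Un_cv (fun n => polya a (INR (jn n) - 1 + t0) (n - jn n) i) (p i)).
        { intros i. unfold p. rewrite Hgb.
          apply (polya_negbin_cv a (fun n => INR (jn n) - 1 + t0) (fun n => n - jn n)%nat n2); auto.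
          - now apply urn_weight_inv_cv.
          - now apply urn_fraction_cv. }
        clear Hx. induction N as [|N IH]; [apply Hp|]. cbn [sum_f_R0]. now apply CV_plus.
  - intros jn Hj Hinf Hlim.
    assert (Hfrac : Un_cv (fun n => INR (jn n) / INR n) 1).
    { apply (Un_cv_limit_eq _ (1 - 0)); [ring|].
      apply Un_cv_ext_loc with (n0 := 1%nat) (u := fun n => 1 - (INR n - INR (jn n)) / INR n).
      - intros n Hn. assert (0 < INR n) by (apply lt_0_INR; lia). field. lra.
      - apply CV_minus; auto. apply Un_cv_const. }
    destruct (urn_weight_ge_1 jn t0 Ht0 Hinf) as [n2 H2].
    (* The event X = 1 is that of no success in the urn, whose mass tends to rho^a with rho = 1. *)
    apply (Un_cv_limit_eq _ (Rpower 1 a)); [apply Rpower_base_1|].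
    apply Un_cv_ext_loc with (n0 := S n2)
      (u := fun n => rbin (INR (jn n) - 1 + t0) (n - jn n)
                     / rbin (a + (INR (jn n) - 1 + t0)) (n - jn n)).
    + intros n Hn. specialize (H2 n ltac:(lia)).
      rewrite <- polya_0 by lra. symmetry. apply ndesc_law; auto. apply Hj. lia.
    + apply (rbin_ratio_cv a (fun n => INR (jn n) - 1 + t0) (fun n => n - jn n)%nat n2);
        auto; try lra.
      * now apply urn_weight_inv_cv.
      * now apply urn_fraction_cv.
Qed.
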